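(* Let $d=1$ and let $(\rho,u)$ be a global-in-time classical solution of $$\partial_t\rho+\partial_x(\rho u)=0,\qquad \partial_t(\rho u)+\partial_x(\rho u^2)=-\rho\,(\partial_xW\star\rho)-\rho\int_{\mathbb R}\psi(x-y)\,(u(t,x)-u(t,y))\,\rho(t,y)\,dy$$ on $\mathbb R_+\times\mathbb R$ with initial data $(\rho_0,u_0)$. Suppose that the interaction potential is $$W(x)=-|x|+\tfrac12x^2$$ and that $\rho_0$ is compactly supported. Define $$\rho_\infty(t,x):=\tfrac12\,\mathbf 1_{\{\eta_c(t)-1\le x\le\eta_c(t)+1\}},$$ and assume that $$\psi(x)\ge\psi_{\rm m}>0\quad\text{for all } |x|\le R$$ for some $R>0$. Then the following decay estimates hold: (i) If $\psi$ is bounded from above, then $${\rm d}_\infty(\rho(t),\rho_\infty(t))+\|u(t,\cdot)-u_\infty\|_{L^\infty(\mathrm{supp}(\rho(t)))}\to0$$ exponentially fast as $t\to\infty$. (ii) If $\psi$ satisfies $\psi(x)\le\dfrac{B}{|x|^\alpha}$ for all $0\le|x|\le R$, for some $\alpha\in(0,1)$ and $R>0$ (with a constant $B>0$), then $${\rm d}_2(\rho(t),\rho_\infty(t))=\mathcal O\Big(t^{-(\frac{3}{4\alpha}-\frac12)}\Big),\qquad \|u(t,\cdot)-u_\infty\|_{L^2(\rho(t))}=\mathcal O\Big(t^{-(1-\alpha)(\frac{3}{4\alpha}-\frac12)}\Big)$$ as $t\to\infty$.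
   Context: Standing assumptions: The communication weight is $\psi(x)=\phi(|x|)$, where $\phi$ is nonnegative and nonincreasing in the distance (possibly singular at $0$ in case (ii), where the bound is understood for $x\ne0$). $\rho\ge0$ is a probability density: $\|\rho(t)\|_{L^1}=1$ for all $t\ge0$ (mass is conserved). Here $\partial_xW(x)=-\mathrm{sgn}(x)+x$. ''Global-in-time classical solution'' means that $(\rho,u)$ is defined for all $t\ge0$ and is regular enough for the equations to hold in the classical sense and for the forward characteristics $\partial_t\eta(t,x)=u(t,\eta(t,x))$, $\eta(0,x)=x$, $x\in\mathrm{supp}(\rho_0)$, to be well defined and non-colliding, with $\rho(t)=\eta(t,\cdot)\#\rho_0$. Notation: $\eta_c(t):=\int_{\mathbb R}x\,\rho(t,x)\,dx$ is the center of mass; $u_\infty:=\int_{\mathbb R}\rho_0u_0\,dx$; $\|f\|_{L^2(\rho(t))}^2=\int_{\mathbb R}|f(x)|^2\rho(t,x)\,dx$. With $\Pi(\mu,\nu)$ the set of couplings of $\mu,\nu$: ${\rm d}_2(\mu,\nu):=\inf_{\pi\in\Pi(\mu,\nu)}\big(\iint|x-y|^2\,d\pi(x,y)\big)^{1/2}$ and ${\rm d}_\infty(\mu,\nu):=\inf_{\pi\in\Pi(\mu,\nu)}\sup_{(x,y)\in\mathrm{supp}\,\pi}|x-y|$. ''$f(t)\to0$ exponentially fast'' means $f(t)\le Ce^{-ct}$ for all $t\ge0$ for some $C,c>0$ independent of $t$. $f=\mathcal O(g)$ as $t\to\infty$ means $f(t)\le Cg(t)$ for some $C>0$ independent of $t$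 and all large $t$. *)

(* Defs.v *)
From HB Require Import structures.
From mathcomp Require Import all_boot all_order all_algebra.
From mathcomp Require Import all_classical all_reals all_analysis.
From mathcomp Require Import ring.

Set Implicit Arguments.
Unset Strict Implicit.
Unset Printing Implicit Defensive.
Import Order.TTheory GRing.Theory Num.Theory.
Import numFieldNormedType.Exports.
Local Open Scope classical_set_scope.
Local Open Scope ring_scope.

Section Measures.
Context {R : realType}.
Local Notation Rm := (measurableTypeR R).
Implicit Types (mu nu : set Rm -> \bar R) (r f : R -> R).

(* The measure r(x) dx, as a set function. *)
Definition dens r : set Rm -> \bar R :=
  fun A => (\int[lebesgue_measure]_(x in A) (r x)%:E)%E.

(* Points all of whose open neighbourhoods have positive mass; used both on the
   line and, for couplings, on the plane. *)
Definition msupport {T : topologicalType} (m : set T -> \bar R) : set T :=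
  [set x | forall U : set T, open U -> U x -> (0 < m U)%E].

Definition supp r : set R := msupport (dens r).

Definition prob_density r : Prop :=
  [/\ measurable_fun [set: Rm] r, forall x, 0 <= r x & dens r setT = 1%E].

Definition couplings mu nu : set (probability (Rm * Rm)%type R) :=
  [set pi | (forall A : set Rm, measurable A -> pi (A `*` setT) = mu A) /\
            (forall A : set Rm, measurable A -> pi (setT `*` A) = nu A)].

Definition d2 mu nu : \bar R :=
  ereal_inf [set ((\int[pi]_z (`|z.1 - z.2| ^+ 2)%:E) `^ 2^-1)%E
            | pi in couplings mu nu].

Definition dinf mu nu : \bar R :=
  ereal_inf [set ereal_sup [set (`|z.1 - z.2|)%:E
                           | z in @msupport (R * R)%type pi]
            | pi in couplings mu nu].

Definition norm_Linf (E : set R) f : \bar R :=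
  Lnorm (@lebesgue_measure R) +oo%E (fun x => (f x * \1_E x)%:E).

Definition norm_L2 r f : \bar R :=
  ((\int[lebesgue_measure]_x (`|f x| ^+ 2 * r x)%:E) `^ 2^-1)%E.

End Measures.

Section Model.
Context {R : realType}.
Local Notation leb := (@lebesgue_measure R).
Implicit Types (psi : R -> R) (rho u eta : R -> R -> R).

Definition W (x : R) : R := - `|x| + x ^+ 2 / 2.

Definition dW (x : R) : R := - Num.sg x + x.

Lemma is_derive_W (x : R) : x != 0 -> is_derive x 1 W (dW x).
Proof.
move=> x0.
have sq (a : R) : is_derive x 1 (fun y : R => a * y + y ^+ 2 / 2) (a + x).
  by apply: is_derive_eq; rewrite /GRing.scale/=; field.
have := x0; rewrite neq_lt => /orP[xn|xp].
- rewrite /dW ltr0_sg// opprK; apply: near_eq_is_derive (sq 1).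
  by near=> y; rewrite /W ltr0_norm ?opprK ?mul1r//; near: y; exact: lt_nbhsl.
- rewrite /dW gtr0_sg//; apply: near_eq_is_derive (sq (- 1)).
  by near=> y; rewrite /W gtr0_norm ?mulN1r//; near: y; exact: lt_nbhsr.
Unshelve. all: by end_near.
Qed.

(* The value at distance 0, where the weight may be singular, is left
   unconstrained: it does not affect the equations. *)
Definition comm_weight psi : Prop :=
  exists phi : R -> R,
    [/\ forall x, psi x = phi `|x|,
        forall r : R, 0 < r -> 0 <= phi r
      & forall r s : R, 0 < r -> r <= s -> phi s <= phi r].

(* C([0,oo) x R) and C^1((0,oo) x R), for f : time -> space -> R. *)
Definition classical_regular (f : R -> R -> R) : Prop :=
  {within [set z : R * R | 0 <= z.1], continuous (fun z => f z.1 z.2)} /\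
  (forall t x : R, 0 < t ->
    [/\ derivable (f^~ x) t 1, derivable (f t) x 1,
        {for (t, x), continuous (fun z : R * R => derive1 (f^~ z.2) z.1)}
      & {for (t, x), continuous (fun z : R * R => derive1 (f z.1) z.2)}]).

Definition continuity_eq rho u (t x : R) : Prop :=
  derive1 (rho^~ x) t + derive1 (fun y => rho t y * u t y) x = 0.

Definition momentum_eq psi rho u (t x : R) : Prop :=
  derive1 (fun s => rho s x * u s x) t +
    derive1 (fun y => rho t y * u t y ^+ 2) x =
  - (rho t x * \int[leb]_y (dW (x - y) * rho t y))
  - rho t x * \int[leb]_y (psi (x - y) * (u t x - u t y) * rho t y).

(* Only the values of eta on supp rho0 are relevant. *)
Definition forward_characteristics rho u (rho0 : R -> R) eta : Prop :=
  [/\ forall x, supp rho0 x ->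
        [/\ eta 0 x = x,
            {within [set t : R | 0 <= t], continuous (eta^~ x)}
          & forall t : R, 0 < t -> is_derive t 1 (eta^~ x) (u t (eta t x))],
      forall t : R, 0 <= t -> forall x y, supp rho0 x -> supp rho0 y ->
        eta t x = eta t y -> x = y
    & forall t : R, 0 <= t -> forall A : set (measurableTypeR R), measurable A ->
        dens (rho t) A = dens rho0 (supp rho0 `&` eta t @^-1` A)].

Definition global_classical_solution psi rho u (rho0 u0 : R -> R) : Prop :=
  [/\ classical_regular rho /\ classical_regular u,
      (forall x, rho 0 x = rho0 x) /\ (forall x, u 0 x = u0 x),
      forall t : R, 0 <= t -> prob_density (rho t),
      forall t x : R, 0 < t ->
        continuity_eq rho u t x /\ momentum_eq psi rho u t x
    & exists eta, forward_characteristics rho u rho0 eta].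

Definition eta_c rho (t : R) : R := \int[leb]_x (x * rho t x).

Definition u_inf (rho0 u0 : R -> R) : R := \int[leb]_x (rho0 x * u0 x).

Definition rho_inf rho (t x : R) : R :=
  2^-1 * \1_`[eta_c rho t - 1, eta_c rho t + 1] x.

Definition exp_decay (f : R -> \bar R) : Prop :=
  exists C c : R, [/\ 0 < C, 0 < c
    & forall t : R, 0 <= t -> (f t <= (C * expR (- (c * t)))%:E)%E].

Definition bigO_pinfty (f : R -> \bar R) (g : R -> R) : Prop :=
  exists2 C : R, 0 < C & \forall t \near +oo, (f t <= (C * g t)%:E)%E.

End Model.

(* Main.v *)
Require Import Defs.
From HB Require Import structures.
From mathcomp Require Import all_boot all_order all_algebra.
From mathcomp Require Import all_classical all_reals all_analysis.
From mathcomp Require Import measurable_realfun ring lra.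
Set Implicit Arguments.
Unset Strict Implicit.
Unset Printing Implicit Defensive.
Import Order.TTheory GRing.Theory Num.Theory.
Import numFieldNormedType.Exports.
Local Open Scope classical_set_scope.
Local Open Scope ring_scope.

(** The statement concerns a cloud of particles. Follow the particle with label
    x along its characteristic X(t,x), and let m(x) be the mass initially to the
    left of x. Characteristics do not collide, so in one space dimension they keep
    their order and m(x) remains the mass to the left of X(t,x). Since the
    repulsive part of the force is a sign, the force at X(t,x) is then the affine
    expression 2m - 1 - (X - eta_c). Put

      h = X - eta_c - (2m - 1),       w = u(t,X) - u_infty.

    Mass conservation makes m uniform on [0,1] under the initial measure mu, so
    eta_c + 2m - 1 has the law rho_infty(t), and (X, eta_c + 2m - 1) couples rho(t)
    with rho_infty(t) at distance |h|. All four quantities in the statement are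
    therefore bounded by norms of h and w, which satisfy

      h' = w,    w' = - h - L w,    (L w)(x) = int psi(X x - X y) (w x - w y) dmu(y),

    a family of harmonic oscillators coupled by a nonlocal damping
    ([solution_flow], [flow_of_solution]).

    The damping is known to be effective only at distances at most R. First,
    particles whose labels are close come within that distance ([fl_close]). Let
    Psi be the odd primitive of psi; then w + int Psi(X x - X y) dmu(y) has
    derivative - h, so for two labels x, y with mass difference dl the distance
    d = X y - X x satisfies d' = Dl - G, Dl' = 2 dl - d, where G is nonnegative and
    at most eps + M d. This is a damped oscillator constrained to d >= 0. Rotating
    through a quarter of a period turns bounds on Dl into bounds on d, and iterating
    makes d at most a constant multiple of dl + eps. Second, chains of close labels
    join any two labels, which gives a Poincare inequality for mean zero functions of
    the label ([poincare]); hence int w (L w) dominates int w^2.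

    The energy E = 1/2 int (h^2 + w^2) now loses int w^2 but not int h^2. Let Phi be
    a primitive of Psi. The corrector

      H = int h (w + int Psi) + 1/2 int int (Phi(2 (m x - m y)) - Phi(X x - X y))

    has derivative int w^2 - int h^2, so a combination F = E + kappa H decreases
    at rate E ([energy_lyapunov]). It remains to bound F by E. The double integral in
    H combines with int h (int Psi) to a Bregman distance of the convex function Phi,
    which is at most e^2 / M + M (int h^2) up to constants as soon as
    Psi b - Psi a <= e + M (b - a) for a <= b.

    If psi is bounded by M, one may take e = 0, and E decays exponentially. Each label
    then carries a uniformly damped oscillator with an exponentially small forcing,
    so that h and w decay uniformly ([flow_exp_decay]). If psi <= B |x|^-alpha,
    cutting psi off at distance theta gives M = B theta^-alpha and e of order
    theta^(1 - alpha); letting theta be of order t^(-1/alpha) yields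
    E = O(t^-(2/alpha - 1)) ([energy_alg_decay], [power_kernel_modulus]). The norms of
    h and w are thus O(t^-(1/alpha - 1/2)), at least as small as both of the rates
    claimed. *)

(** * Bounded measurable functions *)

(** All functions of the label met below are bounded and measurable, hence integrable
    against the probability; this class is closed under the algebraic operations. *)
Definition bdm d (T : measurableType d) (R : realType) (f : T -> R) :=
  measurable_fun [set: T] f /\ exists C : R, forall x, `|f x| <= C.

Section BoundedMeasurable.
Context d (T : measurableType d) (R : realType).
Implicit Types f g : T -> R.

Lemma bdm_cst (c : R) : @bdm d T R (fun=> c).
Proof. by split; [exact: measurable_cst|exists `|c|]. Qed.

Lemma bdmD f g : bdm f -> bdm g -> bdm (fun x => f x + g x).
Proof.
move=> [mf [C fC]] [mg [C' gC]]; split; first exact: measurable_funD.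
by exists (C + C') => x; rewrite (le_trans (ler_normD _ _))// lerD.
Qed.

Lemma bdmN f : bdm f -> bdm (fun x => - f x).
Proof.
move=> [mf [C fC]]; split; first exact: measurableT_comp.
by exists C => x; rewrite normrN.
Qed.

Lemma bdmB f g : bdm f -> bdm g -> bdm (fun x => f x - g x).
Proof. by move=> bf bg; apply: bdmD => //; exact: bdmN. Qed.

Lemma bdmM f g : bdm f -> bdm g -> bdm (fun x => f x * g x).
Proof.
move=> [mf [C fC]] [mg [C' gC]]; split; first exact: measurable_funM.
by exists (C * C') => x; rewrite normrM ler_pM.
Qed.

Lemma bdmZ (c : R) f : bdm f -> bdm (fun x => c * f x).
Proof. by move=> bf; apply: bdmM => //; exact: bdm_cst. Qed.

Lemma bdmX f n : bdm f -> bdm (fun x => f x ^+ n).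
Proof.
move=> bf; elim: n => [|n ih]; first by under eq_fun do rewrite expr0; exact: bdm_cst.
by under eq_fun do rewrite exprS; exact: bdmM.
Qed.

Lemma bdm_norm f : bdm f -> bdm (fun x => `|f x|).
Proof.
move=> [mf [C fC]]; split; first exact: measurableT_comp.
by exists C => x; rewrite normr_id.
Qed.

Lemma bdm_bound f : bdm f -> exists2 C : R, 0 <= C & forall x, `|f x| <= C.
Proof.
move=> [_ [C fC]]; exists `|C| => // x.
by rewrite (le_trans (fC x))// ler_norm.
Qed.

End BoundedMeasurable.

Lemma bdm_comp d d' (T : measurableType d) (U : measurableType d') (R : realType)
  (f : T -> R) (p : U -> T) : bdm f -> measurable_fun setT p -> bdm (f \o p).
Proof.
move=> [mf [C fC]] mp; split; first exact: measurableT_comp.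
by exists C => x /=.
Qed.

Section ProbabilityIntegral.
Context d (T : measurableType d) (R : realType) (mu : probability T R).
Implicit Types f g : T -> R.

Lemma bdm_integrable f : bdm f -> mu.-integrable setT (EFin \o f).
Proof.
move=> [mf [C fC]]; apply: (@le_integrable _ _ _ mu _ measurableT _ (cst C%:E)).
- exact/measurable_EFinP.
- by move=> x _ /=; rewrite lee_fin (le_trans (fC x))// ler_norm.
- exact: finite_measure_integrable_cst.
Qed.
Hint Resolve bdm_integrable : core.

Lemma probD f g : bdm f -> bdm g ->
  \int[mu]_x (f x + g x) = \int[mu]_x f x + \int[mu]_x g x.
Proof. by move=> bf bg; rewrite RintegralD//; exact: bdm_integrable. Qed.

Lemma probB f g : bdm f -> bdm g ->
  \int[mu]_x (f x - g x) = \int[mu]_x f x - \int[mu]_x g x.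
Proof. by move=> bf bg; rewrite RintegralB//; exact: bdm_integrable. Qed.

Lemma probZ c f : bdm f -> \int[mu]_x (c * f x) = c * \int[mu]_x f x.
Proof. by move=> bf; rewrite RintegralZl//; exact: bdm_integrable. Qed.

Lemma probN f : bdm f -> \int[mu]_x (- f x) = - \int[mu]_x f x.
Proof.
by move=> bf; under eq_Rintegral do rewrite -mulN1r; rewrite probZ// mulN1r.
Qed.

Lemma prob_cst (c : R) : \int[mu]_x c = c.
Proof. by rewrite Rintegral_cst// (_ : fine _ = 1) ?mulr1// -[RHS]/(fine 1%E) -(probability_setT mu). Qed.

Lemma prob_le f g : bdm f -> bdm g -> (forall x, f x <= g x) ->
  \int[mu]_x f x <= \int[mu]_x g x.
Proof. by move=> bf bg fg; apply: le_Rintegral => //; exact: bdm_integrable. Qed.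

Lemma eq_prob f g : f =1 g -> \int[mu]_x f x = \int[mu]_x g x.
Proof. by move=> fg; apply: eq_Rintegral => x _; exact: fg. Qed.

Lemma prob_ge0 f : (forall x, 0 <= f x) -> 0 <= \int[mu]_x f x.
Proof. by move=> f0; exact: Rintegral_ge0. Qed.

Lemma prob_norm_le f (C : R) : bdm f -> (forall x, `|f x| <= C) ->
  `|\int[mu]_x f x| <= C.
Proof.
move=> bf fC; apply: (le_trans (le_normr_Rintegral _ _)) => //.
  exact: bdm_integrable.
rewrite -[leRHS]prob_cst; apply: prob_le => //; first exact: bdm_norm.
exact: bdm_cst.
Qed.

Lemma prob_le_cst f (C : R) : bdm f -> (forall x, f x <= C) ->
  \int[mu]_x f x <= C.
Proof.
move=> bf fC; rewrite -[leRHS]prob_cst; apply: prob_le => //; exact: bdm_cst.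
Qed.

Lemma prob_ae_eq f g : bdm f -> bdm g -> mu.-negligible [set x | f x != g x] ->
  \int[mu]_x f x = \int[mu]_x g x.
Proof.
move=> [mf _] [mg _] fg; rewrite /Rintegral; congr fine.
apply: ae_eq_integral => //; [exact/measurable_EFinP|exact/measurable_EFinP|].
apply: (negligibleS _ fg) => x /= h; apply/eqP => fgx; apply: h => _.
by rewrite fgx.
Qed.

End ProbabilityIntegral.

Section DoubleIntegral.
Context d (T : measurableType d) (R : realType) (mu : probability T R).
Implicit Types f g : T -> T -> R.

Definition bdm2 f := bdm (fun z : T * T => f z.1 z.2).

Lemma bdm2_slice f x : bdm2 f -> bdm (f x).
Proof.
move=> bf; apply: (bdm_comp (p := fun y => (x, y)) bf); exact: pair1_measurable.
Qed.

Lemma bdm2_slice2 f y : bdm2 f -> bdm (f^~ y).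
Proof.
move=> bf; apply: (bdm_comp (p := fun x => (x, y)) bf); exact: pair2_measurable.
Qed.

Lemma bdm2_fst (f : T -> R) : bdm f -> bdm2 (fun x _ => f x).
Proof. by move=> bf; exact: (bdm_comp bf measurable_fst). Qed.

Lemma bdm2_snd (f : T -> R) : bdm f -> bdm2 (fun _ y => f y).
Proof. by move=> bf; exact: (bdm_comp bf measurable_snd). Qed.

Lemma bdm2_integrable f : bdm2 f ->
  (mu \x mu)%E.-integrable setT (EFin \o (fun z => f z.1 z.2)).
Proof.
by move=> bf; exact: (bdm_integrable [the probability _ _ of (mu \x mu)%E] bf).
Qed.

Lemma bdm2_int f : bdm2 f -> bdm (fun x => \int[mu]_y f x y).
Proof.
move=> bf; split; last first.
  have [C _ fC] := bdm_bound bf.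
  exists C => x; apply: prob_norm_le; first exact: bdm2_slice.
  by move=> y; exact: (fC (x, y)).
have /= := measurable_fubini_F (bdm2_integrable bf).
by move=> mF; apply: (measurableT_comp _ mF); exact: fine_measurable.
Qed.

Lemma bdm2_swap f : bdm2 f -> bdm2 (fun x y => f y x).
Proof.
move=> bf; apply: (bdm_comp (p := fun z : T * T => (z.2, z.1)) bf).
exact: measurable_swap.
Qed.

Lemma prob_swap f : bdm2 f ->
  \int[mu]_x \int[mu]_y f x y = \int[mu]_x \int[mu]_y f y x.
Proof.
move=> bf; have iff := bdm2_integrable bf.
have h := Fubini iff.
rewrite /Rintegral; congr fine.
have e1 x : (fine (\int[mu]_y (f x y)%:E))%:E = (\int[mu]_y (f x y)%:E)%E.
  by rewrite fineK//; apply: integrable_fin_num => //; apply: bdm_integrable; exact: bdm2_slice.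
have e2 x : (fine (\int[mu]_y (f y x)%:E))%:E = (\int[mu]_y (f y x)%:E)%E.
  by rewrite fineK//; apply: integrable_fin_num => //; apply: bdm_integrable; exact: bdm2_slice2.
under eq_integral do rewrite e1.
under [RHS]eq_integral do rewrite e2.
exact: h.
Qed.

End DoubleIntegral.

(** * Derivatives under the integral sign *)

Section DeriveUnderIntegral.
Context d (T : measurableType d) (R : realType) (mu : probability T R).

Lemma cvg_Rintegral_seq (f : nat -> T -> R) (g : T -> R) (C : R) :
  (forall n, bdm (f n)) -> bdm g -> (forall n y, `|f n y| <= C) ->
  {ae mu, forall y, f n y @[n --> \oo] --> g y} ->
  \int[mu]_y f n y @[n --> \oo] --> \int[mu]_y g y.
Proof.
move=> bf bg fC fg.
have [] := @dominated_convergence _ _ _ mu _ measurableT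
  (fun n y => (f n y)%:E) (EFin \o g) (cst C%:E).
- by move=> n; apply/measurable_EFinP; case: (bf n).
- by apply/measurable_EFinP; case: bg.
- apply: filterS fg => y fgy _; apply: cvg_EFin => //; exact: nearW.
- exact: finite_measure_integrable_cst.
- by apply/aeW => y n _; rewrite /= lee_fin.
move=> _ _ h; apply: fine_cvg.
rewrite fineK; first exact: h.
by apply: integrable_fin_num => //; exact: bdm_integrable.
Qed.

(** The pointwise derivative is only required almost everywhere: a primitive of psi
    fails to be differentiable where psi jumps. The Lipschitz bound is the domination. *)
Lemma is_derive_Rintegral (f : R -> T -> R) (g : T -> R) (t C e : R) :
  0 < e -> (forall s, `|s - t| < e -> bdm (f s)) -> bdm g ->
  (forall s y, `|s - t| < e -> `|f s y - f t y| <= C * `|s - t|) ->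
  {ae mu, forall y, is_derive t 1 (f^~ y) (g y)} ->
  is_derive t 1 (fun s => \int[mu]_y f s y) (\int[mu]_y g y).
Proof.
move=> e0 bf bg fC df.
set F := fun s => _.
have bft : bdm (f t) by apply: bf; rewrite subrr normr0.
suff H : h^-1 *: (F (h + t) - F t) @[h --> 0^'] --> \int[mu]_y g y.
  have e1 : (fun h : R => h^-1 *: (F (h *: 1 + t) - F t)) =
            (fun h => h^-1 *: (F (h + t) - F t)).
    by apply/funext => h; rewrite [h *: 1]mulr1.
  apply: DeriveDef.
    by apply/cvg_ex; exists (\int[mu]_y g y); rewrite e1.
  by rewrite /derive/= e1; apply/cvg_lim => //; exact: Rhausdorff.
apply/cvgr_dnbhsP => s [s0 s_cvg0].
have /cvgr0_norm_lt/(_ _ e0)[N _ sN] := s_cvg0.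
rewrite -(cvg_shiftn N).
pose q n y : R := (s (n + N)%N)^-1 * (f (s (n + N)%N + t) y - f t y).
have se n : `|s (n + N)%N + t - t| < e by rewrite addrK sN//= leq_addl.
have bq n : bdm (q n) by apply: bdmZ; apply: bdmB => //; apply: bf.
rewrite (_ : (fun n : nat => _) = (fun n => \int[mu]_y q n y)); last first.
  apply/funext => n; rewrite probZ; last by apply: bdmB => //; apply: bf.
  by rewrite probB//; apply: bf.
apply: (cvg_Rintegral_seq (C := C)) => //.
  move=> n y; rewrite /q normrM normfV mulrC.
  rewrite ler_pdivrMr ?normr_gt0//.
  by rewrite (le_trans (fC _ _ (se n)))// addrK.
apply: filterS df => y [dy dy'].
have /cvgr_dnbhsP/(_ s (conj s0 s_cvg0)) := dy.
rewrite -[X in _ --> X -> _]/('D_1 (f^~ y) t) dy' => h.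
rewrite (_ : (fun n : nat => q n y) = (fun n => (s (n + N)%N)^-1 *:
   (f (s (n + N)%N *: 1 + t) y - f t y))); last first.
  by apply/funext => n; rewrite /q [_ *: 1]mulr1.
by rewrite (cvg_shiftn N (fun n => (s n)^-1 *: (f (s n *: 1 + t) y - f t y))).
Qed.

End DeriveUnderIntegral.

(** * Differential inequalities *)

Section Calculus.
Context (R : realType).
Implicit Types (f g : R -> R) (s t : R).

Lemma le_of_derive_le0 f f' s t : s <= t ->
  (forall x, s <= x -> x <= t -> is_derive x 1 f (f' x)) ->
  (forall x, s <= x -> x <= t -> f' x <= 0) -> f t <= f s.
Proof.
rewrite le_eqVlt => /predU1P[->//|st] df f'0.
have [||c] := @MVT _ f f' s t st.
- by move=> x; rewrite in_itv/= => /andP[sx xt]; apply: df; exact: ltW.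
- apply: derivable_within_continuous => x; rewrite in_itv/= => /andP[sx xt].
  by have [] := df _ sx xt.
rewrite in_itv/= => /andP[sc ct] ftfs.
rewrite -subr_le0 ftfs mulr_le0_ge0//; first by apply: f'0; exact: ltW.
by rewrite subr_ge0 ltW.
Qed.

Lemma gronwall f f' (q b : R) s t : s <= t ->
  (forall x, s <= x -> x <= t -> is_derive x 1 f (f' x)) ->
  (forall x, s <= x -> x <= t -> f' x <= - q * (f x - b)) ->
  f t - b <= (f s - b) * expR (- (q * (t - s))).
Proof.
move=> st df f'q.
have : (f t - b) * expR (q * t) <= (f s - b) * expR (q * s).
  apply: (@le_of_derive_le0 (fun x => (f x - b) * expR (q * x))
    (fun x => (f' x + q * (f x - b)) * expR (q * x))) => // x sx xt.
    have dfx := df x sx xt.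
    by apply: is_derive_eq; rewrite /GRing.scale/=; ring.
  rewrite mulr_le0_ge0 ?expR_ge0//.
  by have := f'q x sx xt; rewrite mulNr -lerBrDr sub0r.
rewrite -ler_pdivlMr ?expR_gt0// => /le_trans; apply.
by rewrite -mulrA -expRN -expRD (_ : q * s + - (q * t) = - (q * (t - s)))//; ring.
Qed.

Lemma expR_decay_le (C q e : R) : 0 <= C -> 0 < q -> 0 < e ->
  C * expR (- (q * (C / (q * e)))) <= e.
Proof.
move=> C0 q0 e0.
have -> : q * (C / (q * e)) = C / e by field; rewrite !gt_eqF.
rewrite expRN ler_pdivrMr ?expR_gt0//.
apply: (@le_trans _ _ (e * (1 + C / e))).
  by rewrite mulrDr mulr1 mulrCA divff ?gt_eqF// mulr1 lerDr ltW.
by rewrite ler_pM2l// expR_ge1Dx.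
Qed.

Lemma half_pow_le (L e : R) : 0 <= L -> 0 < e -> exists n : nat, L / 2 ^+ n <= e.
Proof.
move=> L0 e0; exists (Num.bound (L / e)).
have Ln := archi_boundP (divr_ge0 L0 (ltW e0)).
rewrite ler_pdivrMr ?exprn_gt0// mulrC -ler_pdivrMr//.
apply: (le_trans (ltW Ln)).
by rewrite -natrX ler_nat ltnW// ltn_expl.
Qed.

(** A bound over one delay propagates, and each further delay halves the excess over
    the fixed point 2k. *)
Lemma delay_contraction f (a p k L : R) : 0 < p -> 0 <= k -> 0 <= L ->
  (forall t, a <= t -> f (t + p) <= k + f t / 2) ->
  (forall t, a <= t -> t <= a + p -> f t <= L) ->
  forall n : nat, forall t, a + n%:R * p <= t -> f t <= 2 * k + L / 2 ^+ n.
Proof.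
move=> p0 k0 L0 fp fL n t ant.
have step m : forall s, a + m%:R * p <= s -> s <= a + m.+1%:R * p ->
    f s <= 2 * k + L / 2 ^+ m.
  elim: m => [|m ih] s; rewrite ?mul0r ?addr0 ?mul1r.
    move=> h1 h2; rewrite expr0 divr1 (le_trans (fL _ h1 h2))// lerDr.
    by rewrite mulr_ge0.
  move=> h1 h2.
  have mp : 0 <= m%:R * p by rewrite mulr_ge0// ltW.
  have := fp (s - p); rewrite subrK => /(_ _)/le_trans; apply.
    by move: h1; rewrite -natr1; lra.
  have h3 : a + m%:R * p <= s - p by move: h1; rewrite -natr1; lra.
  have h4 : s - p <= a + m.+1%:R * p by move: h2; rewrite -(natr1 m.+1); lra.
  by have := ih _ h3 h4; rewrite exprS invfM; lra.
have [m [nm h1 h2]] : exists m : nat, [/\ (n <= m)%N, a + m%:R * p <= t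
    & t <= a + m.+1%:R * p].
  have tp : 0 <= (t - a) / p.
    apply: divr_ge0; last exact: ltW.
    by rewrite subr_ge0 (le_trans _ ant)// lerDl mulr_ge0// ltW.
  exists (Num.truncn ((t - a) / p)).
  have /andP[h1 h2] := truncn_itv tp; split.
  - by rewrite truncn_ge_nat// ler_pdivlMr// lerBrDl.
  - by move: h1; rewrite ler_pdivlMr// lerBrDl.
  - by move: h2; rewrite ltr_pdivrMr// ltrBlDl => /ltW.
rewrite (le_trans (step _ _ h1 h2))// lerD2l ler_wpM2l// lef_pV2 ?posrE ?exprn_gt0//.
by rewrite ler_eXn2l// ltr1n.
Qed.

End Calculus.

(** * A pair of particles *)

(** Here d is the distance of two ordered particles, dl the mass between them, Dl the
    difference of the quantities whose derivative is - h, and G the difference of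
    their drags, which is nonnegative by monotonicity. *)
Section Pair.
Context (R : realType) (d Dl G : R -> R) (dl a : R).
Hypothesis dd : forall t, a <= t -> is_derive t 1 d (Dl t - G t).
Hypothesis dDl : forall t, a <= t -> is_derive t 1 Dl (2 * dl - d t).
Hypothesis d0 : forall t, a <= t -> 0 <= d t.
Hypothesis G0 : forall t, a <= t -> 0 <= G t.

(** In the phase plane of the undamped oscillator, the component along a direction
    that rotates with the flow has derivative - G sin, which is nonpositive during a
    quarter turn. It starts as Dl and ends as d - 2 dl. *)
Lemma pair_quarter_turn t : a <= t -> d (t + pi / 2) <= 2 * dl + Dl t.
Proof.
move=> at_.
have p0 : 0 <= pi / 2 :> R by rewrite divr_ge0// pi_ge0.
have := @le_of_derive_le0 _
  (fun x => (d x - 2 * dl) * sin (x - t) + Dl x * cos (x - t))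
  (fun x => - G x * sin (x - t)) t (t + pi / 2).
rewrite subrr sin0 cos0 mulr0 add0r mulr1 addrAC subrr add0r sin_pihalf cos_pihalf.
rewrite mulr0 addr0 mulr1 lerBlDl; apply; first by rewrite lerDl.
- move=> x tx xt; have ddx := dd (le_trans at_ tx).
  have dDx := dDl (le_trans at_ tx).
  by apply: is_derive_eq; rewrite /GRing.scale/=; ring.
- move=> x tx xt; rewrite mulNr oppr_le0 mulr_ge0//; first exact/G0/(le_trans at_).
  by apply: sin_ge0_pi; have := pi_ge0 R; lra.
Qed.

(** With q = 1 / (M + 1), the quantity Dl - q d satisfies V' <= - q V + 2 dl + q eps
    because G is at most eps + M d. *)
Lemma pair_lyapunov (eps M : R) : 0 <= M -> 0 <= eps -> 0 <= dl ->
  (forall t, a <= t -> G t <= eps + M * d t) ->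
  forall t, a <= t ->
  Dl t - d t / (M + 1) <= Num.max (Dl a) 0 * expR (- ((t - a) / (M + 1)))
     + (2 * dl * (M + 1) + eps).
Proof.
move=> M0 eps0 dl0 GM t at_.
have M1 : 0 < M + 1 by rewrite ltr_wpDl.
set q := (M + 1)^-1; have q0 : 0 < q by rewrite invr_gt0.
have qM : q * M = 1 - q by rewrite /q; field; rewrite gt_eqF.
have := @gronwall _ (fun x => Dl x - d x * q)
  (fun x => 2 * dl - d x - q * (Dl x - G x)) q (2 * dl * (M + 1) + eps) a t at_.
rewrite -lerBlDr [(t - a) * q]mulrC => /(_ _ _)/le_trans; apply.
- move=> x ax xt; have ddx := dd ax; have dDx := dDl ax.
  by apply: is_derive_eq; rewrite /GRing.scale/=; ring.
- move=> x ax xt.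
  have e1 : q * (2 * dl * (M + 1)) = 2 * dl by rewrite /q; field; rewrite gt_eqF.
  have := GM _ ax; rewrite -(ler_pM2l q0) => h.
  have e2 : q * (eps + M * d x) = q * eps + (1 - q) * d x by rewrite mulrDr mulrA qM.
  have h2 : 0 <= q * q * d x by rewrite mulr_ge0 ?d0// mulr_ge0// ltW.
  have h3 : 0 <= q * d x by rewrite mulr_ge0 ?d0// ltW.
  by move: h; rewrite e2 => h; nra.
- rewrite ler_wpM2r ?expR_ge0//.
  have : 0 <= d a * q by rewrite mulr_ge0 ?d0// ltW.
  have : 0 <= 2 * dl * (M + 1) by rewrite mulr_ge0 ?mulr_ge0// ltW.
  have : Dl a <= Num.max (Dl a) 0 by rewrite le_max lexx.
  by lra.
Qed.

End Pair.

Section PairsClose.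
Context (R : realType).

(** The two previous lemmas combine to d(t + pi/2) <= d(t)/2 + small once the transient
    of Dl is small. The time and the threshold dl0 depend on the pair only through
    the bound C on its initial data, so that they serve for all pairs of labels. *)
Lemma pairs_close (r M C : R) : 0 < r -> 1 <= M -> 0 <= C ->
  exists T dl0 : R, [/\ 0 <= T, 0 < dl0 &
    forall (d Dl G : R -> R) (dl a : R),
    (forall t, a <= t -> is_derive t 1 d (Dl t - G t)) ->
    (forall t, a <= t -> is_derive t 1 Dl (2 * dl - d t)) ->
    (forall t, a <= t -> 0 <= d t) ->
    (forall t, a <= t -> 0 <= G t <= r / 8 + M * d t) ->
    Dl a <= C -> (forall t, a <= t -> t <= a + pi / 2 -> d t <= C) ->
    0 <= dl <= dl0 -> forall t, a + T <= t -> d t <= r].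
Proof.
move=> r0 M1 C0; set e := r / 8.
have e0 : 0 < e by rewrite divr_gt0.
have M10 : 0 < M + 1 by lra.
have p0 : 0 < pi / 2 :> R by rewrite divr_gt0// pi_gt0.
(* time after which the transient of Dl is below e, by expR_decay_le *)
set T1 := C / ((M + 1)^-1 * e).
have T10 : 0 <= T1 by rewrite divr_ge0// mulr_ge0 ?invr_ge0 ?ltW//.
set L1 := 2 * (C + 2 * e) + C.
have L10 : 0 <= L1 by rewrite /L1; lra.
have [n Ln] := half_pow_le L10 e0.
exists (T1 + n%:R * (pi / 2)), (e / (2 * (M + 1) + 2)); split.
- by rewrite addr_ge0// mulr_ge0// ltW.
- by rewrite divr_gt0//; lra.
move=> d Dl G dl a dd dDl d0 GM Da dC /andP[dl0 dle] t aTt.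
have hdl : 2 * dl * (M + 1) + 2 * dl <= e.
  (* the threshold is chosen so that all terms in dl add up to at most r / 8 *)
  by move: dle; rewrite ler_pdivlMr; [nra|lra].
have G0 s : a <= s -> 0 <= G s by move=> /GM/andP[].
have Gle s : a <= s -> G s <= e + M * d s by move=> /GM/andP[].
have V s : a <= s -> Dl s <= C * expR (- ((s - a) / (M + 1))) +
    (2 * dl * (M + 1) + e) + d s / 2.
  move=> as_.
  have M0 : 0 <= M by lra.
  have := pair_lyapunov dd dDl d0 M0 (ltW e0) dl0 Gle as_.
  have : d s / (M + 1) <= d s / 2.
    by rewrite ler_wpM2l ?d0// lef_pV2 ?posrE//; lra.
  have : Num.max (Dl a) 0 * expR (- ((s - a) / (M + 1)))
       <= C * expR (- ((s - a) / (M + 1))).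
    by rewrite ler_wpM2r ?expR_ge0// ge_max Da.
  by lra.
have turn s := pair_quarter_turn dd dDl G0 (t := s).
have dL1 s : a <= s -> d s <= L1.
  move=> as_.
  have := @delay_contraction _ d a (pi / 2) (C + 2 * e) C p0 _ C0 _ dC 0 s.
  rewrite mul0r addr0 expr0 divr1; apply => //; first by lra.
  move=> x ax; have := turn _ ax; have := V _ ax.
  have : C * expR (- ((x - a) / (M + 1))) <= C.
    rewrite ler_piMr// -[leRHS]expR0 ler_expR oppr_le0.
    by rewrite divr_ge0 ?subr_ge0 ?(ltW M10).
  by lra.
have := @delay_contraction _ d (a + T1) (pi / 2) (3 * e) L1 p0 _ L10 _ _ n t.
move=> /(_ _ _ _ _)/le_trans; apply; last by rewrite /e; move: Ln; rewrite /e; lra.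
- by lra.
- move=> x ax.
  have ax' : a <= x by lra.
  have := turn _ ax'; have := V _ ax'.
  have : C * expR (- ((x - a) / (M + 1))) <= e.
    apply: (@le_trans _ _ (C * expR (- ((M + 1)^-1 * T1)))); last first.
      by apply: expR_decay_le => //; rewrite invr_gt0.
    rewrite ler_wpM2l// ler_expR lerN2 mulrC ler_wpM2r//; last by lra.
    by rewrite invr_ge0 ltW.
  by lra.
- by move=> x ax _; apply: dL1; lra.
- by move: aTt; rewrite addrA.
Qed.

End PairsClose.

(** * The communication weight and its primitives *)

Section Kernel.
Context (R : realType).
Local Notation leb := (@lebesgue_measure R).

(** Integrability near 0 is the only restriction on the singularity of the weight. *)
Record comm_kernel (psi : R -> R) : Prop := CommKernel {
  kernel_even : forall x, psi (- x) = psi x;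
  kernel_ge0 : forall x, 0 <= psi x;
  kernel_noninc : forall r s, 0 < r -> r <= s -> psi s <= psi r;
  kernel_int : forall y, leb.-integrable `[0, y] (EFin \o psi) }.

Lemma noninc_pos_measurable (f : R -> R) :
  (forall r s, 0 < r -> r <= s -> f s <= f r) -> measurable_fun (`]0, +oo[%classic : set R) f.
Proof.
move=> nf.
apply: (measurability (@RGenCInfty.G R)) => [|/= _ [_] [r] -> <-].
  exact: RGenCInfty.measurableE.
apply: is_interval_measurable => s t/=.
rewrite !in_itv/= !andbT => -[s0 fs] [t0 ft] w /andP[sw wt].
have w0 : 0 < w by rewrite (lt_le_trans s0).
by rewrite !in_itv/= !andbT w0; split => //; rewrite (le_trans ft)// nf.
Qed.

Variable psi : R -> R.
Hypothesis kp : comm_kernel psi.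
Implicit Types a b e r s x M : R.

Lemma kernel_measurable : measurable_fun [set: measurableTypeR R] psi.
Proof.
have mg : measurable_fun [set: measurableTypeR R] (psi \_ `]0, +oo[).
  apply/(measurable_restrictT _ _).1 => //.
  by apply: noninc_pos_measurable; exact: kernel_noninc kp.
rewrite (_ : psi = (fun x => (psi \_ `]0, +oo[) x + (psi \_ `]0, +oo[) (- x)
   + psi 0 * \1_[set 0%R] x)).
  apply: measurable_funD; [apply: measurable_funD => //|].
  - by apply: measurableT_comp => //; exact: oppr_measurable.
  - by apply: measurable_funM => //; apply: measurable_indic; exact: measurable_set1.
apply/funext => x; rewrite !patchE indicE.
have [x0|x0|->] := ltgtP x 0.
- rewrite memNset/=; last by rewrite in_itv/= andbT (lt_gtF x0).
  rewrite mem_set/=; last by rewrite in_itv/= andbT oppr_gt0.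
  by rewrite memNset ?mulr0 ?addr0 ?add0r ?(kernel_even kp)//=; apply/eqP; rewrite lt_eqF.
- rewrite mem_set/=; last by rewrite in_itv/= andbT.
  rewrite memNset/=; last by rewrite in_itv/= andbT oppr_gt0 (lt_gtF x0).
  by rewrite memNset ?mulr0 ?addr0//=; apply/eqP; rewrite gt_eqF.
- rewrite oppr0 memNset/=; last by rewrite in_itv/= ltxx.
  by rewrite mem_set//= mulr1 !add0r.
Qed.

(** The primitive from 0, continued by 0 to the negative numbers. *)
Definition prim_half (s : R) := \int[leb]_(x in `[0, s]) psi x.
(** The odd primitive Psi of the weight. *)
Definition prim (s : R) := prim_half s - prim_half (- s).

Lemma kernel_int_sub (a b : R) : 0 <= a -> leb.-integrable `]a, b] (EFin \o psi).
Proof.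
move=> a0; apply: (integrableS _ _ _ (kernel_int kp b)) => //.
by move=> x/=; rewrite !in_itv/= => /andP[ax ->]; rewrite (le_trans a0) ?ltW.
Qed.

Lemma prim_half_neg s : s <= 0 -> prim_half s = 0.
Proof.
rewrite /prim_half le_eqVlt => /predU1P[->|s0].
  by rewrite set_itv1 Rintegral_set1.
by rewrite set_itv_ge ?Rintegral_set0// bnd_simp -ltNge.
Qed.

Lemma prim_halfB a b : 0 <= a -> a <= b ->
  prim_half b - prim_half a = \int[leb]_(x in `]a, b]) psi x.
Proof.
move=> a0 ab; rewrite /prim_half Rintegral_itvB// ?bnd_simp//.
exact: kernel_int.
Qed.

Lemma Rintegral_itv_cst (a b M : R) : a <= b ->
  \int[leb]_(x in `]a, b]) M = M * (b - a).
Proof.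
move=> ab; rewrite Rintegral_cst//= lebesgue_measure_itv/= lte_fin.
by move: ab; rewrite le_eqVlt => /predU1P[->|->]//=; rewrite ltxx subrr.
Qed.

Lemma itv_cst_integrable (a b M : R) : leb.-integrable `]a, b] (EFin \o cst M).
Proof.
apply/integrableP; split; first exact/measurable_EFinP.
under eq_integral do rewrite /=.
rewrite integral_cst//= lebesgue_measure_itv/=.
by case: ifP => _; rewrite ?mule0// -EFinM ltry.
Qed.

Lemma prim_half_le a b M : 0 <= a -> a <= b ->
  (forall x, a < x -> x <= b -> psi x <= M) ->
  prim_half b - prim_half a <= M * (b - a).
Proof.
move=> a0 ab pM; rewrite prim_halfB// -Rintegral_itv_cst//.
apply: le_Rintegral => //; [exact: kernel_int_sub|exact: itv_cst_integrable|].
by move=> x /=; rewrite in_itv/= => /andP[ax xb]; exact: pM.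
Qed.

Lemma prim_half_ge a b M : 0 <= a -> a <= b ->
  (forall x, a < x -> x <= b -> M <= psi x) ->
  M * (b - a) <= prim_half b - prim_half a.
Proof.
move=> a0 ab pM; rewrite prim_halfB// -Rintegral_itv_cst//.
apply: le_Rintegral => //; [exact: itv_cst_integrable|exact: kernel_int_sub|].
by move=> x /=; rewrite in_itv/= => /andP[ax xb]; exact: pM.
Qed.

Lemma prim_half_nd a b : a <= b -> prim_half a <= prim_half b.
Proof.
move=> ab; have [a0|a0] := leP a 0.
  by rewrite (prim_half_neg a0); apply: Rintegral_ge0 => x _; exact: kernel_ge0.
rewrite -subr_ge0 (le_trans _ (prim_half_ge (M := 0) (ltW a0) ab _)) ?mul0r//.
by move=> x _ _; exact: kernel_ge0.
Qed.

Lemma prim_half_ge0 a : 0 <= prim_half a.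
Proof. by apply: Rintegral_ge0 => x _; exact: kernel_ge0. Qed.

Lemma primN s : prim (- s) = - prim s.
Proof. by rewrite /prim opprK opprB. Qed.

Lemma prim_nd a b : a <= b -> prim a <= prim b.
Proof.
by move=> ab; rewrite lerB// prim_half_nd// lerN2.
Qed.

(** A nonincreasing function is at most its mean over the interval from 0. *)
Lemma kernel_mul_le s : 0 < s -> psi s * s <= prim_half s.
Proof.
move=> s0; have := @prim_half_ge 0 s (psi s) (lexx _) (ltW s0).
rewrite subr0 (prim_half_neg (lexx 0)) subr0; apply => x x0 xs.
exact: kernel_noninc kp _ _ x0 xs.
Qed.

(** For a singular weight, Psi is not Lipschitz; e measures what is lost by cutting the
    weight off at height M. *)
Definition affine_modulus (f : R -> R) (e M : R) :=
  forall a b, a <= b -> f b - f a <= e + M * (b - a).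

Lemma prim_half_modulus r a b : 0 < r -> 0 <= a -> a <= b ->
  prim_half b - prim_half a <= prim_half r + psi r * (b - a).
Proof.
move=> r0 a0 ab.
have pr := kernel_ge0 kp r; have hr := prim_half_ge0 r.
have ha := prim_half_ge0 a.
have [br|rb] := leP b r.
  have := prim_half_nd br.
  have : 0 <= psi r * (b - a) by rewrite mulr_ge0// subr_ge0.
  by lra.
have [ra|ar] := leP r a.
  have := @prim_half_le a b (psi r) a0 ab _; move=> /(_ _)/le_trans; apply.
    by move=> x ax xb; apply: kernel_noninc kp _ _ r0 _; lra.
  by lra.
have := @prim_half_le r b (psi r) (ltW r0) (ltW rb) _ => /(_ _).
have : psi r * (b - r) <= psi r * (b - a) by rewrite ler_wpM2l//; lra.
move=> h1 h2; suff : prim_half b - prim_half r <= psi r * (b - r) by lra.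
by apply: h2 => x rx xb; apply: kernel_noninc kp _ _ r0 (ltW rx).
Qed.

(** Cut at distance r: beyond it the slope of Psi is at most psi r, and the two halves of
    the part within it weigh at most prim_half r each. *)
Lemma prim_modulus r : 0 < r -> affine_modulus prim (2 * prim_half r) (psi r).
Proof.
move=> r0 a b ab; rewrite /prim.
have pr := kernel_ge0 kp r; have hr := prim_half_ge0 r.
have [a0|a0] := leP 0 a.
  rewrite (@prim_half_neg (- b)) ?(@prim_half_neg (- a)); try lra.
  by have := prim_half_modulus r0 a0 ab; lra.
have [b0|b0] := leP b 0.
  rewrite (@prim_half_neg b) ?(@prim_half_neg a); try lra.
  have := @prim_half_modulus r (- b) (- a) r0; rewrite lerN2 => /(_ _ ab).
  by rewrite oppr_ge0 => /(_ b0); lra.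
rewrite (@prim_half_neg (- b)) ?(@prim_half_neg a); try lra.
have := @prim_half_modulus r 0 b r0 (lexx _) (ltW b0).
have := @prim_half_modulus r 0 (- a) r0 (lexx _).
rewrite oppr_ge0 => /(_ (ltW a0)); rewrite (prim_half_neg (lexx 0)) => h1 h2.
by lra.
Qed.

Lemma prim_half_cvg0 e : 0 < e -> exists2 r, 0 < r & prim_half r <= e.
Proof.
move=> e0.
have := @parameterized_integral_continuous _ 0 1 psi ler01 (kernel_int kp 1).
move=> /(continuous_within_itvP _ ltr01)[_ + _].
rewrite {2}/parameterized_integral set_itv1 Rintegral_set1.
move=> /cvgrPdist_le/(_ _ e0) h.
near (0 : R)^'+ => r; exists r; first by near: r; exact: nbhs_right_gt.
have : `|0 - parameterized_integral lebesgue_measure 0 r psi| <= e by near: r.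
by rewrite sub0r normrN ger0_norm// prim_half_ge0.
Unshelve. all: by end_near. Qed.

Lemma prim_modulus_bounded M : (forall x, psi x <= M) -> affine_modulus prim 0 M.
Proof.
move=> pM a b ab; rewrite add0r; apply/ler_addgt0Pr => e e0.
have [r r0 re] := prim_half_cvg0 (e := e / 2) ltac:(by rewrite divr_gt0).
have := prim_modulus r0 ab.
have : psi r * (b - a) <= M * (b - a) by rewrite ler_wpM2r ?subr_ge0.
by lra.
Qed.

Lemma prim_half_derive s : 0 < s -> {for s, continuous psi} ->
  is_derive s 1 prim_half (psi s).
Proof.
move=> s0 cs.
have [|dp pE] := @continuous_FTC1_closed _ psi 0 s (s + 1) _ (kernel_int kp _) s0 cs.
  by rewrite ltrDl.
by apply: DeriveDef dp _; rewrite -derive1E; exact: pE.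
Qed.

Lemma prim_derive s : s != 0 -> {for `|s|, continuous psi} ->
  is_derive s 1 prim (psi s).
Proof.
rewrite neq_lt => /orP[s0|s0] cs.
- have d1 : is_derive s 1 (fun x => - prim_half (- x)) (psi s).
    move: cs; rewrite ltr0_norm// => cs.
    have d2 := prim_half_derive (s := - s) _ cs.
    have {}d2 : is_derive (- s) 1 prim_half (psi (- s)) by apply: d2; rewrite oppr_gt0.
    have d3 : is_derive s 1 (fun x : R => - x) (- 1) by apply: is_derive_eq.
    have := @is_derive1_comp _ prim_half (fun x : R => - x) s _ _ d2 d3.
    move=> d4; apply: is_derive_eq.
    by rewrite (kernel_even kp) mulrN1 opprK.
  apply: near_eq_is_derive d1; near=> y.
  have y0 : y < 0 by near: y; exact: lt_nbhsl.
  by rewrite /prim (prim_half_neg (ltW y0)) sub0r.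
- have d1 : is_derive s 1 prim_half (psi s).
    by apply: prim_half_derive => //; move: cs; rewrite gtr0_norm.
  apply: near_eq_is_derive d1; near=> y.
  have y0 : 0 < y by near: y; exact: lt_nbhsr.
  by rewrite /prim [prim_half (- y)]prim_half_neg ?subr0// oppr_le0 ltW.
Unshelve. all: by end_near. Qed.

(** A monotone function has countably many jumps; since the weight may be unbounded, the
    line is exhausted by compact intervals avoiding 0. *)
Lemma kernel_countable_discontinuities :
  exists2 J : set R, countable J &
    forall s, 0 < s -> ~ J s -> {for s, continuous psi}.
Proof.
pose J n := [set x : R | (x \in `]n.+1%:R^-1, n.+1%:R[) /\ discontinuity (\- psi) x].
exists (\bigcup_n J n).
  apply: bigcup_countable => // n _; apply: discontinuity_countable.
  move=> x y; rewrite !in_itv/= => /andP[x0 _] _ xy.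
  rewrite lerN2; apply: kernel_noninc kp _ _ _ xy.
  by rewrite (lt_le_trans _ x0)// invr_gt0.
move=> s s0 nJ.
have nds : forall x y, 0 < x -> x <= y -> (\- psi) x <= (\- psi) y.
  by move=> x y x0 xy; rewrite /= lerN2; apply: kernel_noninc kp _ _ x0 xy.
have cl : cvg ((\- psi) x @[x --> s^'-]).
  apply: nondecreasing_at_left_is_cvgr; near=> x.
    move=> y z; rewrite !in_itv/= => /andP[xy _] _; apply: nds.
    by rewrite (lt_trans _ xy)//; near: x; exact: nbhs_left_gt.
  exists ((\- psi) s) => _ [y /= + <-]; rewrite in_itv/= => /andP[xy /ltW ys].
  apply: nds => //; rewrite (lt_trans _ xy)//; near: x; exact: nbhs_left_gt.
have cr : cvg ((\- psi) x @[x --> s^'+]).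
  apply: nondecreasing_at_right_is_cvgr; near=> x.
    move=> y z; rewrite !in_itv/= => /andP[sy _] _; apply: nds.
    by rewrite (lt_trans _ sy).
  by exists ((\- psi) s) => _ [y /= + <-]; rewrite in_itv/= => /andP[/ltW sy _]; exact: nds.
have lims : lim ((\- psi) x @[x --> s^'-]) = lim ((\- psi) x @[x --> s^'+]).
  apply/eqP; apply/negPn/negP => dis; apply: nJ.
  have s1 : 0 <= Num.max s s^-1 by rewrite le_max ltW.
  have := archi_boundP s1; set n := Num.bound _ => sn.
  have {}sn : Num.max s s^-1 < n.+1%:R by rewrite (lt_trans sn)// ltr_nat.
  exists n => //; split => //; rewrite in_itv/=.
  by move: sn; rewrite gt_max invf_plt ?posrE// andbC.
have l1 : lim ((\- psi) x @[x --> s^'-]) <= (\- psi) s.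
  apply: limr_le => //; near=> x; apply: nds; last by near: x; exact: nbhs_left_le.
  by near: x; exact: nbhs_left_gt.
have l2 : (\- psi) s <= lim ((\- psi) x @[x --> s^'+]).
  by apply: limr_ge => //; near=> x; apply: nds => //; near: x; exact: nbhs_right_ge.
have lE : lim ((\- psi) x @[x --> s^'-]) = (\- psi) s.
  by apply/eqP; rewrite eq_le l1 lims l2.
have cN : (\- psi) x @[x --> s] --> (\- psi) s.
  apply/left_right_continuousP; split; first by rewrite -lE.
  by rewrite -lE lims.
have c2 : - (\- psi) x @[x --> s] --> - (\- psi) s by exact: cvgN.
have e2 : - (\- psi) s = psi s by rewrite /= opprK.
rewrite e2 in c2; apply: cvg_trans c2; apply: near_eq_cvg.
by near=> x; rewrite /= opprK.
Unshelve. all: by end_near. Qed.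

Lemma prim_derive_countable :
  exists2 J : set R, countable J & forall s, ~ J s -> is_derive s 1 prim (psi s).
Proof.
have [J cJ Jc] := kernel_countable_discontinuities.
pose F (o : option bool) : set R := match o with
  | None => [set 0] | Some true => J | Some false => [set - x | x in J] end.
exists (\bigcup_o F o).
  apply: bigcup_countable => [|[[]|] _] //=.
  by apply: sub_countable cJ; exact: card_image_le.
move=> s nF.
have nJ : ~ J s by move=> Js; apply: nF; exists (Some true).
have nJ' : ~ [set - x | x in J] s by move=> Js; apply: nF; exists (Some false).
have s0 : s <> 0 by move=> s0; apply: nF; exists None.
apply: prim_derive; first exact/eqP.
have [sp|sn|s00] := ltgtP 0 s.
- by rewrite gtr0_norm//; exact: Jc.
- rewrite ltr0_norm//; apply: Jc; first by rewrite oppr_gt0.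
  by move=> Js; apply: nJ'; exists (- s) => //; rewrite opprK.
- by exfalso; apply: s0.
Qed.

Lemma prim0 : prim 0 = 0.
Proof. by rewrite /prim oppr0 subrr. Qed.

Lemma prim_continuous : continuous prim.
Proof.
move=> s; apply/cvgrPdist_le => e e0.
have [r r0 re] := prim_half_cvg0 (e := e / 4) ltac:(lra).
have pr := kernel_ge0 kp r.
have h a b : a <= b -> `|prim a - prim b| <= e / 2 + psi r * (b - a).
  move=> ab; rewrite distrC ger0_norm ?subr_ge0 ?prim_nd//.
  by have := prim_modulus r0 ab; lra.
have p1 : 0 < psi r + 1 by lra.
near=> x.
have dx : `|s - x| <= e / 2 / (psi r + 1).
  by near: x; apply: cvgr_dist_le => //; rewrite !divr_gt0.
have {}dx : psi r * `|s - x| <= e / 2.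
  by move: dx; rewrite ler_pdivlMr// => dx; have := normr_ge0 (s - x); nra.
have [sx|xs] := leP s x.
  by have := h _ _ sx; rewrite distrC ger0_norm ?subr_ge0// in dx; lra.
rewrite distrC; rewrite ger0_norm ?subr_ge0 ?(ltW xs)// in dx.
by have := h _ _ (ltW xs); lra.
Unshelve. all: by end_near. Qed.

(** The even primitive Phi of Psi, convex because Psi is nondecreasing. *)
Definition prim2 s := \int[leb]_(x in `[0, `|s|]) prim x.

Let prim_integrable y : leb.-integrable `[0, y] (EFin \o prim).
Proof.
apply: continuous_compact_integrable; first exact: segment_compact.
by apply: continuous_subspaceT; exact: prim_continuous.
Qed.

Lemma prim2_derive s : is_derive s 1 prim2 (prim s).
Proof.
have dpos x : 0 < x -> is_derive x 1 (fun y => \int[leb]_(z in `[0, y]) prim z) (prim x).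
  move=> x0; have [|dp pE] := @continuous_FTC1_closed _ prim 0 x (x + 1) _
    (prim_integrable _) x0 (@prim_continuous x); first by rewrite ltrDl.
  by apply: DeriveDef dp _; rewrite -derive1E; exact: pE.
have [->|] := eqVneq s 0; last rewrite neq_lt => /orP[s0|s0].
- rewrite prim0.
  have bnd h : `|prim2 h| <= `|h| * prim `|h|.
    have h0 := normr_ge0 h.
    have e1 : \int[leb]_(x in `[0, `|h|]) prim `|h| = prim `|h| * `|h|.
      rewrite Rintegral_cst//= lebesgue_measure_itv/= lte_fin.
      by case: ltgtP h0 => //= [h1|<-] _; rewrite ?oppr0 ?addr0 ?subr0 ?mulr0.
    have pp x : 0 <= x -> 0 <= prim x by move=> x0; rewrite -prim0; exact: prim_nd.
    rewrite ger0_norm; last first.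
      by apply: Rintegral_ge0 => x /=; rewrite in_itv/= => /andP[x0 _]; exact: pp.
    rewrite mulrC -e1; apply: le_Rintegral => //.
      apply: continuous_compact_integrable; first exact: segment_compact.
      by apply: continuous_subspaceT; exact: cst_continuous.
    by move=> x /=; rewrite in_itv/= => /andP[x0 xh]; exact: prim_nd.
  suff H : h^-1 *: (prim2 (h *: 1 + 0) - prim2 0) @[h --> 0^'] --> (0 : R).
    by apply: DeriveDef; [apply/cvg_ex; exists 0|apply/cvg_lim].
  apply/cvgrPdist_le => e e0.
  have := @prim_continuous 0 => /cvgrPdist_le/(_ _ e0).
  move=> /nbhs_ballP[r /= r0 rp].
  near=> h; rewrite sub0r normrN [h *: 1]mulr1 addr0.
  have -> : prim2 0 = 0 by rewrite /prim2 normr0 set_itv1 Rintegral_set1.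
  have h0 : h != 0 by near: h; exact: nbhs_dnbhs_neq.
  rewrite subr0 normrZ normfV ler_pdivrMl ?normr_gt0//.
  rewrite (le_trans (bnd h))// ler_wpM2l//.
  have := rp `|h|; rewrite /ball/= !sub0r !normrN normr_id prim0 sub0r normrN.
  move=> /(_ _)/(le_trans (ler_norm _)); apply.
  by near: h; apply: dnbhs0_lt.
- have d2 : is_derive (- s) 1 (fun y => \int[leb]_(z in `[0, y]) prim z) (prim (- s)).
    by apply: dpos; rewrite oppr_gt0.
  have d3 : is_derive s 1 (fun x : R => - x) (- 1) by apply: is_derive_eq.
  have d4 := @is_derive1_comp _ _ (fun x : R => - x) s _ _ d2 d3.
  have {}d4 : is_derive s 1 ((fun y => \int[leb]_(z in `[0, y]) prim z) \o -%R) (prim s).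
    by apply: is_derive_eq; rewrite primN mulrN1 opprK.
  apply: near_eq_is_derive d4; near=> y.
  have y0 : y < 0 by near: y; exact: lt_nbhsl.
  by rewrite /prim2 /= ltr0_norm.
- apply: near_eq_is_derive (dpos _ s0); near=> y.
  have y0 : 0 < y by near: y; exact: lt_nbhsr.
  by rewrite /prim2 gtr0_norm.
Unshelve. all: by end_near. Qed.

(** The mean value theorem for Phi; the sign is the monotonicity of Psi. *)
Lemma prim2_bregman a b : exists c, [/\ `|c - a| <= `|b - a|,
   prim2 b - prim2 a - prim a * (b - a) = (prim c - prim a) * (b - a)
   & 0 <= (prim c - prim a) * (b - a)].
Proof.
have [ab|ba|->] := ltgtP a b; last by exists b; rewrite !subrr !mulr0 subrr.
- have [||c] := @MVT _ prim2 prim a b ab.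
  + by move=> x _; exact: prim2_derive.
  + apply: derivable_within_continuous => x _.
    by have [] := prim2_derive x.
  rewrite in_itv/= => /andP[ac cb] e; exists c; split.
  + by rewrite !gtr0_norm ?subr_gt0// lerD2r ltW.
  + by rewrite e; ring.
  + by rewrite mulr_ge0 ?subr_ge0 ?(ltW ab)// prim_nd// ltW.
- have [||c] := @MVT _ prim2 prim b a ba.
  + by move=> x _; exact: prim2_derive.
  + apply: derivable_within_continuous => x _.
    by have [] := prim2_derive x.
  rewrite in_itv/= => /andP[bc ca] e; exists c; split.
  + by rewrite !ltr0_norm ?subr_lt0// lerN2 lerD2r ltW.
  + by rewrite -opprB e; ring.
  + by rewrite mulr_le0 ?subr_le0 ?(ltW ba)// prim_nd// ltW.
Qed.

Lemma prim2_bregman_ge0 a b : 0 <= prim2 b - prim2 a - prim a * (b - a).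
Proof. by have [c [_ -> ]] := prim2_bregman a b. Qed.

(** The difference of slopes is at most e + M |b - a|; the product of e with |b - a| is
    split by Young's inequality. *)
Lemma prim2_bregman_le e M a b : 0 <= e -> 0 < M -> affine_modulus prim e M ->
  prim2 b - prim2 a - prim a * (b - a) <= e ^+ 2 / M + 2 * M * (b - a) ^+ 2.
Proof.
move=> e0 M0 mod; have [c [ca -> _]] := prim2_bregman a b.
rewrite (le_trans (ler_norm _))// normrM.
have h : `|prim c - prim a| <= e + M * `|c - a|.
  have [ac|ca'] := leP a c.
    by rewrite !ger0_norm ?subr_ge0 ?prim_nd//; exact: mod.
  have {}ca' := ltW ca'.
  by rewrite distrC [`|c - a|]distrC !ger0_norm ?subr_ge0 ?prim_nd//; exact: mod.
rewrite -[(b - a) ^+ 2]real_normK ?num_real//.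
set x := `|b - a| in ca *; have x0 : 0 <= x by exact: normr_ge0.
apply: (@le_trans _ _ ((e + M * x) * x)).
  rewrite ler_wpM2r// (le_trans h)// lerD2l ler_wpM2l//; exact: ltW.
suff : e * x <= e ^+ 2 / M + M * x ^+ 2 by nra.
rewrite -subr_ge0.
have -> : e ^+ 2 / M + M * x ^+ 2 - e * x = ((e - M * x) ^+ 2 + M * e * x) / M.
  by field; rewrite gt_eqF.
by rewrite divr_ge0 ?(ltW M0)// addr_ge0 ?sqr_ge0// mulr_ge0 ?mulr_ge0// ltW.
Qed.

End Kernel.

(** * Families of functions of time *)

Section C1Families.
Context (R : realType).

Lemma lipschitz_of_derive (f f' : R -> R) (K s t : R) : s <= t ->
  (forall x, s <= x -> x <= t -> is_derive x 1 f (f' x)) ->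
  (forall x, s <= x -> x <= t -> `|f' x| <= K) -> `|f t - f s| <= K * (t - s).
Proof.
move=> st df f'K.
have h1 := @le_of_derive_le0 _ (fun x => f x - K * x) (fun x => f' x - K) s t st.
have h2 := @le_of_derive_le0 _ (fun x => - f x - K * x) (fun x => - f' x - K) s t st.
rewrite ler_norml; apply/andP; split.
  suff : - f t - K * t <= - f s - K * s by lra.
  apply: h2 => x sx xt; last by have := f'K x sx xt; rewrite ler_norml; lra.
  by have dx := df x sx xt; apply: is_derive_eq; rewrite /GRing.scale/=; ring.
suff : f t - K * t <= f s - K * s by lra.
apply: h1 => x sx xt; last by have := f'K x sx xt; rewrite ler_norml; lra.
by have dx := df x sx xt; apply: is_derive_eq; rewrite /GRing.scale/=; ring.
Qed.

Lemma lipschitz_of_derive_sym (f f' : R -> R) (K a b s t : R) :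
  a <= s <= b -> a <= t <= b ->
  (forall x, a <= x -> x <= b -> is_derive x 1 f (f' x)) ->
  (forall x, a <= x -> x <= b -> `|f' x| <= K) -> `|f t - f s| <= K * `|t - s|.
Proof.
move=> /andP[as_ sb] /andP[at_ tb] df f'K; have [st|/ltW ts] := leP s t.
  rewrite [`|t - s|]ger0_norm ?subr_ge0//.
  by apply: lipschitz_of_derive => // x sx xt; [apply: df|apply: f'K]; lra.
rewrite distrC [`|t - s|]distrC [`|s - t|]ger0_norm ?subr_ge0//.
by apply: lipschitz_of_derive => // x sx xt; [apply: df|apply: f'K]; lra.
Qed.

Section Families.
Context d (T : measurableType d).
Implicit Types f g : R -> T -> R.

Definition locally_bounded f := forall r S : R, 0 < r ->
  exists K : R, forall t x, r <= t -> t <= S -> `|f t x| <= K.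

(** Functions of a time t > 0 and a label, with time derivatives f'. The bounds are
    uniform in the label and locally in time, which is what is needed to
    differentiate integrals over the labels. *)
Record c1fam f f' : Prop := C1fam {
  c1fam_meas : forall t : R, 0 < t -> measurable_fun [set: T] (f t);
  c1fam_meas' : forall t : R, 0 < t -> measurable_fun [set: T] (f' t);
  c1fam_derive : forall (t : R) x, 0 < t -> is_derive t 1 (f^~ x) (f' t x);
  c1fam_bnd : locally_bounded f;
  c1fam_bnd' : locally_bounded f' }.

Lemma c1fam_bdm f f' t : c1fam f f' -> 0 < t -> bdm (f t).
Proof.
move=> cf t0; split; first exact: c1fam_meas cf _ t0.
have [K fK] := c1fam_bnd cf t t0; exists K => x; exact: fK.
Qed.

Lemma c1fam_bdm' f f' t : c1fam f f' -> 0 < t -> bdm (f' t).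
Proof.
move=> cf t0; split; first exact: c1fam_meas' cf _ t0.
have [K fK] := c1fam_bnd' cf t t0; exists K => x; exact: fK.
Qed.

Lemma c1fam_ext f f' g g' : c1fam f f' -> f = g -> f' = g' -> c1fam g g'.
Proof. by move=> + <- <-. Qed.

Lemma c1fam_const (f : T -> R) : bdm f -> c1fam (fun=> f) (fun _ _ => 0).
Proof.
move=> bf; split => //; [by move=> t _; case: bf|move=> t x _; exact: is_derive_cst|..].
  by move=> r S _; have [C _ fC] := bdm_bound bf; exists C.
by move=> r S _; exists 0 => *; rewrite normr0.
Qed.

Lemma c1famD f f' g g' : c1fam f f' -> c1fam g g' ->
  c1fam (fun t x => f t x + g t x) (fun t x => f' t x + g' t x).
Proof.
move=> cf cg; split.
- by move=> t t0; apply: measurable_funD; [exact: c1fam_meas cf _ t0|exact: c1fam_meas cg _ t0].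
- by move=> t t0; apply: measurable_funD; [exact: c1fam_meas' cf _ t0|exact: c1fam_meas' cg _ t0].
- move=> t x t0; have df := c1fam_derive cf x t0; have dg := c1fam_derive cg x t0.
  by apply: is_derive_eq.
- move=> r S r0; have [K1 h1] := c1fam_bnd cf S r0; have [K2 h2] := c1fam_bnd cg S r0.
  exists (K1 + K2) => t x rt tS; rewrite (le_trans (ler_normD _ _))// lerD ?h1 ?h2//.
- move=> r S r0; have [K1 h1] := c1fam_bnd' cf S r0; have [K2 h2] := c1fam_bnd' cg S r0.
  exists (K1 + K2) => t x rt tS; rewrite (le_trans (ler_normD _ _))// lerD ?h1 ?h2//.
Qed.

Lemma c1famM f f' g g' : c1fam f f' -> c1fam g g' ->
  c1fam (fun t x => f t x * g t x) (fun t x => f' t x * g t x + f t x * g' t x).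
Proof.
move=> cf cg; split.
- by move=> t t0; apply: measurable_funM; [exact: c1fam_meas cf _ t0|exact: c1fam_meas cg _ t0].
- move=> t t0; apply: measurable_funD; apply: measurable_funM;
    by [exact: c1fam_meas cf _ t0|exact: c1fam_meas' cg _ t0|
        exact: c1fam_meas' cf _ t0|exact: c1fam_meas cg _ t0].
- move=> t x t0; have df := c1fam_derive cf x t0; have dg := c1fam_derive cg x t0.
  by apply: is_derive_eq; rewrite /GRing.scale/=; ring.
- move=> r S r0; have [K1 h1] := c1fam_bnd cf S r0; have [K2 h2] := c1fam_bnd cg S r0.
  by exists (K1 * K2) => t x rt tS; rewrite normrM ler_pM ?h1 ?h2.
- move=> r S r0; have [K1 h1] := c1fam_bnd cf S r0; have [K2 h2] := c1fam_bnd cg S r0.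
  have [K3 h3] := c1fam_bnd' cf S r0; have [K4 h4] := c1fam_bnd' cg S r0.
  exists (K3 * K2 + K1 * K4) => t x rt tS; rewrite (le_trans (ler_normD _ _))//.
  by rewrite !normrM lerD// ler_pM ?h1 ?h2 ?h3 ?h4.
Qed.

Lemma c1famN f f' : c1fam f f' -> c1fam (fun t x => - f t x) (fun t x => - f' t x).
Proof.
move=> cf; apply: (c1fam_ext (c1famM (c1fam_const (bdm_cst T (- 1))) cf)).
  by apply/funext => t; apply/funext => x; rewrite mulN1r.
by apply/funext => t; apply/funext => x; rewrite mul0r add0r mulN1r.
Qed.

Lemma c1famB f f' g g' : c1fam f f' -> c1fam g g' ->
  c1fam (fun t x => f t x - g t x) (fun t x => f' t x - g' t x).
Proof. by move=> cf cg; apply: c1famD => //; exact: c1famN. Qed.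

Lemma c1fam_int (mu : probability T R) f f' (t : R) : c1fam f f' -> 0 < t ->
  is_derive t 1 (fun s => \int[mu]_x f s x) (\int[mu]_x f' t x).
Proof.
move=> cf t0.
have t20 : 0 < t / 2 by rewrite divr_gt0.
have [K f'K] := c1fam_bnd' cf (t + t) t20.
have near_t s : `|s - t| < t / 2 -> t / 2 <= s <= t + t.
  by rewrite ltr_norml => /andP[h1 h2]; apply/andP; split; lra.
apply: (@is_derive_Rintegral _ _ _ mu f (f' t) t K (t / 2)) => //.
- by move=> s /near_t/andP[s1 _]; apply: c1fam_bdm cf _; lra.
- exact: c1fam_bdm' cf t0.
- move=> s y st; apply: (@lipschitz_of_derive_sym (f^~ y) (f'^~ y) K (t / 2) (t + t)).
  + by apply/andP; split; lra.
  + exact: near_t.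
  + by move=> x h1 h2; apply: (c1fam_derive cf y); lra.
  + by move=> x h1 h2; exact: f'K.
- by apply/aeW => y; exact: (c1fam_derive cf y t0).
Qed.

End Families.

Section DoubleFamilies.
Context d (T : measurableType d).
Variable mu : probability T R.

Definition c1fam2 (f f' : R -> T -> T -> R) :=
  c1fam (fun t (z : T * T) => f t z.1 z.2) (fun t (z : T * T) => f' t z.1 z.2).

Lemma c1fam_pull d' (U : measurableType d') (p : U -> T) f f' :
  measurable_fun setT p -> c1fam f f' ->
  c1fam (fun t z => f t (p z)) (fun t z => f' t (p z)).
Proof.
move=> mp cf; split.
- by move=> t t0; exact: (measurableT_comp (c1fam_meas cf t0) mp).
- by move=> t t0; exact: (measurableT_comp (c1fam_meas' cf t0) mp).
- by move=> t z t0; exact: (c1fam_derive cf (p z) t0).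
- by move=> r S r0; have [K h] := c1fam_bnd cf S r0; exists K => t z; exact: h.
- by move=> r S r0; have [K h] := c1fam_bnd' cf S r0; exists K => t z; exact: h.
Qed.

Lemma c1fam2_fst f f' : c1fam f f' -> c1fam2 (fun t x _ => f t x) (fun t x _ => f' t x).
Proof. exact: (c1fam_pull measurable_fst). Qed.

Lemma c1fam2_snd f f' : c1fam f f' -> c1fam2 (fun t _ y => f t y) (fun t _ y => f' t y).
Proof. exact: (c1fam_pull measurable_snd). Qed.

Lemma c1fam2_int f f' : c1fam2 f f' ->
  c1fam (fun t x => \int[mu]_y f t x y) (fun t x => \int[mu]_y f' t x y).
Proof.
move=> cf.
have bf t : 0 < t -> bdm2 (f t) by move=> t0; exact: c1fam_bdm cf t0.
have bf' t : 0 < t -> bdm2 (f' t) by move=> t0; exact: c1fam_bdm' cf t0.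
split.
- by move=> t t0; case: (bdm2_int mu (bf _ t0)).
- by move=> t t0; case: (bdm2_int mu (bf' _ t0)).
- move=> t x t0; apply: (@c1fam_int _ _ mu (fun t y => f t x y) (fun t y => f' t x y)) => //.
  split.
  + by move=> s s0; case: (bdm2_slice x (bf _ s0)).
  + by move=> s s0; case: (bdm2_slice x (bf' _ s0)).
  + by move=> s y s0; exact: (c1fam_derive cf (x, y) s0).
  + by move=> r S r0; have [K h] := c1fam_bnd cf S r0; exists K => s y; exact: (h s (x, y)).
  + by move=> r S r0; have [K h] := c1fam_bnd' cf S r0; exists K => s y; exact: (h s (x, y)).
- move=> r S r0; have [K h] := c1fam_bnd cf S r0; exists K => s x rs sS.
  have s0 : 0 < s by exact: lt_le_trans rs.
  apply: prob_norm_le; first exact/bdm2_slice/bf.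
  by move=> y; exact: (h s (x, y)).
- move=> r S r0; have [K h] := c1fam_bnd' cf S r0; exists K => s x rs sS.
  have s0 : 0 < s by exact: lt_le_trans rs.
  apply: prob_norm_le; first exact/bdm2_slice/bf'.
  by move=> y; exact: (h s (x, y)).
Qed.

End DoubleFamilies.
End C1Families.

Section Composition.
Context (R : realType) d (T : measurableType d).

Lemma c1fam_comp (F F' : R -> R) (f f' : R -> T -> R) :
  (forall s : R, is_derive s 1 F (F' s)) ->
  measurable_fun [set: measurableTypeR R] F -> measurable_fun [set: measurableTypeR R] F' ->
  (forall C : R, exists K : R, forall s, `|s| <= C -> `|F s| <= K /\ `|F' s| <= K) ->
  c1fam f f' -> c1fam (fun t x => F (f t x)) (fun t x => F' (f t x) * f' t x).
Proof.
move=> dF mF mF' bF cf; split.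
- by move=> t t0; exact: (measurableT_comp mF (c1fam_meas cf t0)).
- move=> t t0; apply: measurable_funM; last exact: (c1fam_meas' cf t0).
  exact: (measurableT_comp mF' (c1fam_meas cf t0)).
- move=> t x t0; have df := c1fam_derive cf x t0.
  have dFf := dF (f t x).
  exact: (@is_derive1_comp _ F (f^~ x) t _ _ dFf df).
- move=> r S r0; have [C h] := c1fam_bnd cf S r0; have [K hK] := bF C.
  by exists K => t x rt tS; have [] := hK _ (h t x rt tS).
- move=> r S r0; have [C h] := c1fam_bnd cf S r0; have [K hK] := bF C.
  have [C' h'] := c1fam_bnd' cf S r0.
  exists (K * C') => t x rt tS; rewrite normrM ler_pM//.
    by have [] := hK _ (h t x rt tS).
  exact: h'.
Qed.

End Composition.

(** * A nonlocal Poincare inequality *)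

Section Poincare.
Context (R : realType) d (T : measurableType d) (mu : probability T R).

Lemma bdm_bool d' (U : measurableType d') (P : U -> bool) :
  measurable_fun setT P -> bdm (fun x => (P x)%:R : R).
Proof.
move=> mP; split; last by exists 1 => x; case: (P x); rewrite ?normr1 ?normr0.
rewrite (_ : (fun x => _) = (fun x => if P x then 1 else 0)); last first.
  by apply/funext => x; case: (P x).
by apply: measurable_fun_ifT.
Qed.

(** The variance as a double integral. *)
Lemma prob_sqrB (f : T -> R) : bdm f ->
  \int[mu]_x \int[mu]_y (f x - f y) ^+ 2 =
  2 * \int[mu]_x (f x ^+ 2) - 2 * (\int[mu]_x f x) ^+ 2.
Proof.
move=> bf; set e := \int[mu]_x f x; set e2 := \int[mu]_x (f x ^+ 2).
have bf2 := bdmX 2 bf.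
rewrite (_ : (fun x => \int[mu]_y (f x - f y) ^+ 2) =
             (fun x => f x ^+ 2 - 2 * e * f x + e2)); last first.
  apply/funext => x.
  rewrite (_ : (fun y => (f x - f y) ^+ 2) =
             (fun y => f x ^+ 2 - 2 * f x * f y + f y ^+ 2)); last first.
    by apply/funext => y; ring.
  rewrite probD//; last by apply: bdmB; [exact: bdm_cst|exact: bdmZ].
  rewrite probB//; [|exact: bdm_cst|exact: bdmZ].
  by rewrite prob_cst probZ// -/e -/e2; ring.
rewrite probD//; [|by apply: bdmB => //; exact: bdmZ|exact: bdm_cst].
rewrite probB//; last exact: bdmZ.
by rewrite prob_cst probZ// -/e -/e2; ring.
Qed.

Implicit Types (r : R) (f : T -> R).
Variable m : T -> R.
Hypothesis mm : measurable_fun setT m.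
Hypothesis m01 : forall x, 0 <= m x <= 1.
Hypothesis mass : forall c r : R, 0 <= c <= 1 -> 0 <= r <= 2^-1 ->
  r <= \int[mu]_z (`|m z - c| <= r)%R%:R.

(** The Dirichlet form of the graph joining labels whose masses differ by at most r. *)
Definition near_energy (r : R) (f : T -> R) :=
  \int[mu]_x \int[mu]_y ((`|m x - m y| <= r)%R%:R * (f x - f y) ^+ 2).

Lemma bdm_near (c r : R) : bdm (fun z => (`|m z - c| <= r)%R%:R : R).
Proof.
apply: bdm_bool; apply: measurable_fun_ler => //.
by apply: measurableT_comp => //; apply: measurable_funB.
Qed.

Lemma bdm2_near (r : R) : @bdm2 _ T R (fun x y => (`|m x - m y| <= r)%R%:R).
Proof.
apply: bdm_bool; apply: measurable_fun_ler => //.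
apply: measurableT_comp => //; apply: measurable_funB.
  exact: (measurableT_comp mm measurable_fst).
exact: (measurableT_comp mm measurable_snd).
Qed.

Lemma bdm2_diff (f : T -> R) : bdm f -> bdm2 (fun x y => f x - f y).
Proof. by move=> bf; apply: bdmB; [exact: bdm2_fst|exact: bdm2_snd]. Qed.

Lemma bdm2_near_sqr r f : bdm f ->
  bdm2 (fun x y => (`|m x - m y| <= r)%R%:R * (f x - f y) ^+ 2).
Proof.
by move=> bf; apply: bdmM; [exact: bdm2_near|apply: bdmX; exact: bdm2_diff].
Qed.

(** Two labels at mass distance at most 3r/2 have a common set of neighbours, of mass at
    least r/4: those whose mass is within r/4 of the midpoint. Averaging the triangle
    inequality over these neighbours costs the factor 16/r. *)
Lemma near_energy_grow r f : 0 < r <= 1 -> bdm f ->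
  near_energy (3 / 2 * r) f <= 16 / r * near_energy r f.
Proof.
move=> /andP[r0 r1] bf.
pose q x := \int[mu]_y ((`|m x - m y| <= r)%R%:R * (f x - f y) ^+ 2).
have bq : bdm q by apply: (bdm2_int mu); exact: bdm2_near_sqr.
have qs y : \int[mu]_z ((`|m z - m y| <= r)%R%:R * (f z - f y) ^+ 2) = q y.
  by apply: eq_Rintegral => z _; rewrite distrC -sqrrN opprB.
suff H : r / 4 * near_energy (3 / 2 * r) f <= 4 * near_energy r f.
  have -> : 16 / r * near_energy r f = (r / 4)^-1 * (4 * near_energy r f).
    by field; rewrite gt_eqF.
  by rewrite ler_pdivlMl ?divr_gt0.
have pt x y : r / 4 * ((`|m x - m y| <= 3 / 2 * r)%R%:R * (f x - f y) ^+ 2)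
    <= 2 * q x + 2 * q y.
  have q0 z : 0 <= q z by apply: prob_ge0 => w; rewrite mulr_ge0 ?sqr_ge0.
  have [xy|] := boolP (`|m x - m y| <= 3 / 2 * r); last first.
    by rewrite mul0r mulr0 addr_ge0// mulr_ge0.
  rewrite mul1r.
  pose c := (m x + m y) / 2.
  have c01 : 0 <= c <= 1 by have := m01 x; have := m01 y; rewrite /c; lra.
  have r4 : 0 <= r / 4 <= 2^-1 by lra.
  rewrite -(qs y) -!probZ//; last 2 first.
    exact: (bdm2_slice2 y (bdm2_near_sqr r bf)).
    exact: (bdm2_slice x (bdm2_near_sqr r bf)).
  rewrite -probD//; last 2 first.
    by apply: bdmZ; exact: (bdm2_slice x (bdm2_near_sqr r bf)).
    by apply: bdmZ; exact: (bdm2_slice2 y (bdm2_near_sqr r bf)).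
  apply: (@le_trans _ _ (\int[mu]_z ((f x - f y) ^+ 2 * (`|m z - c| <= r / 4)%R%:R))).
    rewrite probZ; last exact: bdm_near.
    by rewrite mulrC ler_wpM2l ?sqr_ge0// mass.
  apply: prob_le.
  - by apply: bdmZ; exact: bdm_near.
  - apply: bdmD; apply: bdmZ.
      exact: (bdm2_slice x (bdm2_near_sqr r bf)).
    exact: (bdm2_slice2 y (bdm2_near_sqr r bf)).
  - move=> z; have [zc|_] := boolP (`|m z - c| <= r / 4); last first.
      by rewrite mulr0 addr_ge0// mulr_ge0// mulr_ge0// sqr_ge0.
    have xz : `|m x - m z| <= r.
      move: zc xy; rewrite /c !ler_norml => /andP[? ?] /andP[? ?].
      by apply/andP; split; lra.
    have zy : `|m z - m y| <= r.
      move: zc xy; rewrite /c !ler_norml => /andP[? ?] /andP[? ?].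
      by apply/andP; split; lra.
    rewrite xz zy !mul1r mulr1.
    have := sqr_ge0 ((f x - f z) - (f z - f y)); nra.
have b1 := bdm2_near_sqr (3 / 2 * r) bf.
rewrite /near_energy -probZ; last exact: bdm2_int.
rewrite -/(near_energy r f).
have -> : 4 * near_energy r f = \int[mu]_x \int[mu]_y (2 * q x + 2 * q y).
  transitivity (\int[mu]_x (2 * q x + 2 * near_energy r f)).
    rewrite (probD mu (bdmZ 2 bq) (bdm_cst T _)) probZ// prob_cst.
    by rewrite -/(near_energy r f); ring.
  apply: eq_Rintegral => x _; rewrite (probD mu (bdm_cst T _) (bdmZ 2 bq)).
  by rewrite prob_cst probZ.
apply: prob_le.
- by apply: bdmZ; exact: bdm2_int.
- apply: (bdm2_int mu); apply: bdmD; apply: bdmZ; [exact: bdm2_fst|exact: bdm2_snd].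
- move=> x; rewrite -probZ; last exact: (bdm2_slice x b1).
  apply: prob_le => [||y]; last exact: pt.
    by apply: bdmZ; exact: (bdm2_slice x b1).
  by apply: bdmD; apply: bdmZ => //; exact: bdm_cst.
Qed.

Lemma near_energy_full r f : 1 <= r ->
  near_energy r f = \int[mu]_x \int[mu]_y (f x - f y) ^+ 2.
Proof.
move=> r1; apply: eq_Rintegral => x _; apply: eq_Rintegral => y _.
suff -> : `|m x - m y| <= r by rewrite mul1r.
by rewrite (le_trans _ r1)// ler_norml; have := m01 x; have := m01 y; lra.
Qed.

(** Enlarging the range by 3/2 finitely often reaches 1, where all pairs of labels are
    joined and the form is twice the variance. *)
Lemma poincare r : 0 < r -> exists2 C : R, 0 < C &
  forall f, bdm f -> \int[mu]_x f x = 0 ->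
    \int[mu]_x (f x ^+ 2) <= C * near_energy r f.
Proof.
move=> r0.
suff [C C0 H] : exists2 C : R, 0 < C & forall f, bdm f ->
    \int[mu]_x \int[mu]_y (f x - f y) ^+ 2 <= C * near_energy r f.
  exists (C / 2); first by rewrite divr_gt0.
  move=> f bf f0; have := H f bf.
  by rewrite prob_sqrB// f0 expr0n/= mulr0 subr0; lra.
have [n rn] : exists n : nat, 1 <= (3 / 2) ^+ n * r.
  have [n] := @half_pow_le R (r^-1) 1 (ltac:(by rewrite invr_ge0 ltW)) ltr01.
  rewrite ler_pdivrMr ?exprn_gt0// mul1r => h; exists (n + n)%N.
  rewrite exprD -exprMn -ler_pdivrMr// mul1r (le_trans h)//.
  by rewrite lerXn2r ?nnegrE//; lra.
elim: n r r0 rn => [|n ih] r r0.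
  rewrite expr0 mul1r => r1; exists 1 => // f bf.
  by rewrite near_energy_full// mul1r.
rewrite exprSr -mulrA => rn.
have [|r1] := leP 1 r.
  by move=> r1; exists 1 => // f bf; rewrite near_energy_full// mul1r.
have [|C C0 H] := ih (3 / 2 * r) _ rn; first by rewrite mulr_gt0// divr_gt0.
exists (C * (16 / r)); first by rewrite mulr_gt0// divr_gt0.
move=> f bf; rewrite (le_trans (H f bf))// -[leRHS]mulrA ler_pM2l//.
by apply: near_energy_grow => //; rewrite r0 ltW.
Qed.

End Poincare.

(** * The particle flow *)

(** A Lipschitz velocity tames the singularity of the weight, since psi s * s is bounded
    near 0. *)
Lemma kernel_lip_mul_le (R : realType) (psi : R -> R) (s w K C : R) :
  comm_kernel psi -> 0 <= K -> `|s| <= C -> `|w| <= K * `|s| ->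
  `|psi s * w| <= K * prim_half psi C.
Proof.
move=> kp K0 sC hw; rewrite normrM ger0_norm ?kernel_ge0//.
have [s0|s0] := eqVneq s 0.
  move: hw; rewrite s0 normr0 mulr0 normr_le0 => /eqP->.
  by rewrite normr0 mulr0 mulr_ge0// prim_half_ge0.
have ps : psi s = psi `|s|.
  by have [s1|s1] := leP 0 s; [rewrite ger0_norm|rewrite ltr0_norm// (kernel_even kp)].
apply: (@le_trans _ _ (psi s * (K * `|s|))).
  by rewrite ler_wpM2l// kernel_ge0.
rewrite mulrCA ler_wpM2l// ps (le_trans (kernel_mul_le kp _)) ?normr_gt0//.
exact: prim_half_nd.
Qed.

Section Flow.
Context (R : realType) d (T : measurableType d) (mu : probability T R).
Implicit Types (t s r S C K : R) (x y : T).
Variables (psi : R -> R) (X v a : R -> T -> R) (m : T -> R).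

(** Positions X, velocities v, accelerations a of particles labelled by a probability
    space, and the mass m to the left of a label. [fl_mass] says that the law of m
    fills [0,1]; [fl_order] that trajectories never cross; [fl_null] that the mass
    has no concentrations, so that jumps of the weight are not seen. Nothing is assumed
    on derivatives at t = 0 beyond [fl_init], because a classical solution is only
    continuous there. *)
Record particle_flow : Prop := ParticleFlow {
  fl_kernel : comm_kernel psi;
  fl_Xmeas : forall t : R, 0 <= t -> measurable_fun [set: T] (X t);
  fl_vmeas : forall t : R, 0 <= t -> measurable_fun [set: T] (v t);
  fl_ameas : forall t : R, 0 < t -> measurable_fun [set: T] (a t);
  fl_mmeas : measurable_fun [set: T] m;
  fl_m01 : forall x, 0 <= m x <= 1;
  fl_mean : \int[mu]_x m x = 2^-1;
  fl_mass : forall c r : R, 0 <= c <= 1 -> 0 <= r <= 2^-1 ->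
    r <= \int[mu]_z (`|m z - c| <= r)%R%:R;
  fl_bnd : forall S : R, exists C : R, forall t x, 0 <= t -> t <= S ->
    `|X t x| <= C /\ `|v t x| <= C;
  fl_lip : forall r S : R, 0 < r -> exists2 K : R, 0 <= K &
    forall t x y, r <= t -> t <= S ->
      `|v t x - v t y| <= K * `|X t x - X t y| /\ `|a t x| <= K;
  fl_dX : forall (t : R) x, 0 < t -> is_derive t 1 (X^~ x) (v t x);
  fl_dv : forall (t : R) x, 0 < t -> is_derive t 1 (v^~ x) (a t x);
  fl_ode : forall (t : R) x, 0 < t -> a t x =
    2 * m x - 1 - (X t x - \int[mu]_y X t y) -
    \int[mu]_y (psi (X t x - X t y) * (v t x - v t y));
  fl_order : forall x y,
    (m x <= m y /\ forall t : R, 0 <= t -> X t x <= X t y) \/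
    (m y <= m x /\ forall t : R, 0 <= t -> X t y <= X t x);
  fl_null : forall (t : R) x (J : set R), 0 < t -> countable J ->
    mu.-negligible [set y | J (X t x - X t y)];
  fl_init : forall x, v n.+1%:R^-1 x @[n --> \oo] --> v 0 x }.

Hypothesis fl : particle_flow.
Let kp := fl_kernel fl.

Definition mean_velocity := \int[mu]_x v 0 x.
Definition mass_center (t : R) := \int[mu]_x X t x.
(** Deviations of velocity and position from the asymptotic state. *)
Definition fl_w (t : R) x := v t x - mean_velocity.
Definition fl_h (t : R) x := X t x - mass_center t - (2 * m x - 1).
Definition fl_q (t : R) x y := psi (X t x - X t y) * (v t x - v t y).
Definition fl_L (t : R) x := \int[mu]_y fl_q t x y.
Definition fl_P (t : R) x := \int[mu]_y prim psi (X t x - X t y).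
(** The drag L is the time derivative of P, so that w + P feels only the force - h. *)
Definition fl_om (t : R) x := fl_w t x + fl_P t x.

Local Notation w := fl_w.
Local Notation h := fl_h.
Local Notation q := fl_q.
Local Notation L := fl_L.
Local Notation P := fl_P.
Local Notation om := fl_om.

Lemma fl_X_bdm t : 0 <= t -> bdm (X t).
Proof.
move=> t0; split; first exact: fl_Xmeas.
by have [C hC] := fl_bnd fl t; exists C => x; have [] := hC t x t0 (lexx _).
Qed.

Lemma fl_v_bdm t : 0 <= t -> bdm (v t).
Proof.
move=> t0; split; first exact: fl_vmeas.
by have [C hC] := fl_bnd fl t; exists C => x; have [] := hC t x t0 (lexx _).
Qed.

Lemma fl_m_bdm : bdm m.
Proof.
split; first exact: fl_mmeas.
by exists 1 => x; rewrite ler_norml; have := fl_m01 fl x; lra.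
Qed.

Lemma fl_X_c1 : c1fam X v.
Proof.
split.
- by move=> t /ltW; exact: fl_Xmeas.
- by move=> t /ltW; exact: fl_vmeas.
- exact: fl_dX.
- move=> r S r0; have [C hC] := fl_bnd fl S; exists C => t x rt tS.
  by have [] := hC t x _ tS; rewrite // (le_trans _ rt)// ltW.
- move=> r S r0; have [C hC] := fl_bnd fl S; exists C => t x rt tS.
  by have [] := hC t x _ tS; rewrite // (le_trans _ rt)// ltW.
Qed.

Lemma fl_v_c1 : c1fam v a.
Proof.
split.
- by move=> t /ltW; exact: fl_vmeas.
- exact: fl_ameas.
- exact: fl_dv.
- exact: c1fam_bnd' fl_X_c1.
- move=> r S r0; have [K _ hK] := fl_lip fl S r0; exists K => t x rt tS.
  by have [] := hK t x x rt tS.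
Qed.

Lemma fl_qN t x y : q t y x = - q t x y.
Proof. by rewrite /fl_q -opprB (kernel_even kp) -[v t y - v t x]opprB mulrN. Qed.

Lemma prim_half_bound C s : `|s| <= C -> `|prim psi s| <= prim_half psi C.
Proof.
move=> sC; have hn := prim_half_nd kp.
have h0 s' := prim_half_ge0 kp s'.
have s1 : prim_half psi s <= prim_half psi C.
  by apply: hn; rewrite (le_trans (ler_norm _)).
have s2 : prim_half psi (- s) <= prim_half psi C.
  by apply: hn; rewrite (le_trans (ler_norm _))// normrN.
have := h0 s; have := h0 (- s); rewrite /prim ler_norml; lra.
Qed.

Lemma fl_q_bnd r S : 0 < r -> exists K : R, forall t x y, r <= t -> t <= S ->
  `|q t x y| <= K.
Proof.
move=> r0; have [K K0 hK] := fl_lip fl S r0; have [C hC] := fl_bnd fl S.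
exists (K * prim_half psi (C + C)) => t x y rt tS.
have [hv _] := hK t x y rt tS.
have t0 : 0 <= t by rewrite (le_trans _ rt)// ltW.
have [hx _] := hC t x t0 tS; have [hy _] := hC t y t0 tS.
apply: kernel_lip_mul_le => //.
by rewrite (le_trans (ler_normB _ _))// lerD.
Qed.

Lemma fl_X2_meas t : 0 <= t ->
  measurable_fun [set: T * T] (fun z => X t z.1 - X t z.2).
Proof.
move=> t0; apply: measurable_funB.
  exact: (measurableT_comp (fl_Xmeas fl t0) measurable_fst).
exact: (measurableT_comp (fl_Xmeas fl t0) measurable_snd).
Qed.

Lemma fl_q_bdm t : 0 < t -> bdm2 (q t).
Proof.
move=> t0; have tt := ltW t0; split; last first.
  have [K hK] := fl_q_bnd t t0; exists K => z; exact: hK.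
apply: measurable_funM.
  exact: (measurableT_comp (kernel_measurable kp) (fl_X2_meas tt)).
apply: measurable_funB.
  exact: (measurableT_comp (fl_vmeas fl tt) measurable_fst).
exact: (measurableT_comp (fl_vmeas fl tt) measurable_snd).
Qed.

Lemma fl_L_bdm t : 0 < t -> bdm (L t).
Proof. by move=> t0; apply: bdm2_int; exact: fl_q_bdm. Qed.

(** Exchanging x and y changes the sign of K. *)
Lemma fl_antisym (K : T -> T -> R) (f : T -> R) : bdm2 K -> bdm f ->
  (forall x y, K y x = - K x y) ->
  \int[mu]_x (f x * \int[mu]_y K x y) =
  2^-1 * \int[mu]_x \int[mu]_y ((f x - f y) * K x y).
Proof.
move=> bK bf KN.
have half (I J : R) : J = - I -> I = 2^-1 * (I - J) by move=> ->; lra.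
have b1 : bdm2 (fun x y => f x * K x y) by apply: bdmM => //; exact: bdm2_fst.
have b2 : bdm2 (fun x y => f y * K x y) by apply: bdmM => //; exact: bdm2_snd.
have e1 : \int[mu]_x (f x * \int[mu]_y K x y) =
   \int[mu]_x \int[mu]_y (f x * K x y).
  by apply: eq_Rintegral => x _; rewrite probZ//; exact: bdm2_slice bK.
have e2 : \int[mu]_x \int[mu]_y (f y * K x y) =
  - \int[mu]_x \int[mu]_y (f x * K x y).
  rewrite (prob_swap mu b2) -probN; last exact: bdm2_int.
  apply: eq_Rintegral => x _; rewrite -probN; last exact: bdm2_slice b1.
  by apply: eq_Rintegral => y _; rewrite KN mulrN.
rewrite e1.
have -> : \int[mu]_x \int[mu]_y ((f x - f y) * K x y) =
    \int[mu]_x \int[mu]_y (f x * K x y) - \int[mu]_x \int[mu]_y (f y * K x y).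
  rewrite -probB; [|exact: bdm2_int|exact: bdm2_int].
  apply: eq_Rintegral => x _; rewrite -probB.
  - by apply: eq_Rintegral => y _; rewrite mulrBl.
  - exact: bdm2_slice b1.
  - exact: bdm2_slice b2.
exact: half.
Qed.

Lemma fl_L_mean t : 0 < t -> \int[mu]_x L t x = 0.
Proof.
move=> t0.
have := @fl_antisym (q t) (fun=> 1) (fl_q_bdm t0) (bdm_cst _ _) (fl_qN t).
rewrite (@eq_prob _ _ _ mu _ (L t)); last by move=> x; rewrite mul1r.
move=> ->; rewrite (@eq_prob _ _ _ mu _ (fun=> 0)) ?prob_cst ?mulr0// => x.
rewrite (@eq_prob _ _ _ mu _ (fun=> 0)) ?prob_cst// => y.
by rewrite subrr mul0r.
Qed.

Lemma fl_h_bdm t : 0 <= t -> bdm (h t).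
Proof.
move=> t0; apply: bdmB; first by apply: bdmB; [exact: fl_X_bdm|exact: bdm_cst].
by apply: bdmB; [apply: bdmZ; exact: fl_m_bdm|exact: bdm_cst].
Qed.

Lemma fl_w_bdm t : 0 <= t -> bdm (w t).
Proof. by move=> t0; apply: bdmB; [exact: fl_v_bdm|exact: bdm_cst]. Qed.

Lemma fl_h_mean t : 0 <= t -> \int[mu]_x h t x = 0.
Proof.
move=> t0; have bX := fl_X_bdm t0; have bm := fl_m_bdm.
rewrite probB; [|by apply: bdmB => //; exact: bdm_cst|
  by apply: bdmB; [exact: bdmZ|exact: bdm_cst]].
rewrite probB//; last exact: bdm_cst.
rewrite probB; [|exact: bdmZ|exact: bdm_cst].
by rewrite probZ// !prob_cst (fl_mean fl) /mass_center; lra.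
Qed.

Lemma fl_aE t x : 0 < t -> a t x = - h t x - L t x.
Proof. by move=> t0; rewrite (fl_ode fl)// /fl_h /fl_L /fl_q /mass_center; ring. Qed.

Lemma fl_a_mean t : 0 < t -> \int[mu]_x a t x = 0.
Proof.
move=> t0; rewrite (@eq_prob _ _ _ mu _ (fun x => - h t x - L t x)); last first.
  by move=> x; rewrite fl_aE.
rewrite probB; [|exact/bdmN/fl_h_bdm/ltW|exact: fl_L_bdm].
by rewrite (probN mu (fl_h_bdm (ltW t0))) (fl_h_mean (ltW t0)) fl_L_mean// !oppr0 addr0.
Qed.

(** The mean acceleration vanishes, hence the mean velocity is constant for t > 0;
    [fl_init] identifies the constant. *)
Lemma fl_v_mean t : 0 <= t -> \int[mu]_x v t x = mean_velocity.
Proof.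
rewrite le_eqVlt => /predU1P[<-//|t0].
have cst s : 0 < s -> s <= t -> \int[mu]_x v t x = \int[mu]_x v s x.
  move=> s0 st; apply/eqP; rewrite -subr_eq0 -normr_le0.
  have := @lipschitz_of_derive _ (fun t => \int[mu]_x v t x)
    (fun t => \int[mu]_x a t x) 0 s t st; rewrite mul0r; apply.
    by move=> x sx _; apply: (c1fam_int mu fl_v_c1); exact: lt_le_trans sx.
  by move=> x sx _; rewrite fl_a_mean ?normr0// (lt_le_trans s0).
have [C hC] := fl_bnd fl 1.
have cv : \int[mu]_y v n.+1%:R^-1 y @[n --> \oo] --> \int[mu]_y v 0 y.
  apply: (cvg_Rintegral_seq (C := C)).
  - by move=> n; apply: fl_v_bdm; rewrite invr_ge0.
  - exact: fl_v_bdm.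
  - move=> n y; have n0 : 0 <= n.+1%:R^-1 :> R by rewrite invr_ge0.
    have n1 : n.+1%:R^-1 <= 1 :> R by rewrite invf_le1 ?ler1n.
    by have [] := hC _ y n0 n1.
  - by apply/aeW => y; exact: fl_init.
have cv2 : \int[mu]_y v n.+1%:R^-1 y @[n --> \oo] --> \int[mu]_y v t y.
  apply: cvg_near_cst; near=> n; rewrite -cst ?invr_gt0//.
  near: n; exists (Num.bound t^-1) => // n /= nt.
  rewrite invf_ple ?posrE// ltW// (lt_le_trans (archi_boundP _)) ?invr_ge0 ?ltW//.
  by rewrite ltr_nat ltnS.
exact: (cvg_unique _ cv2 cv).
Unshelve. all: by end_near. Qed.

Lemma fl_w_mean t : 0 <= t -> \int[mu]_x w t x = 0.
Proof.
move=> t0; rewrite probB ?fl_v_mean ?prob_cst ?subrr//; last exact: bdm_cst.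
exact: fl_v_bdm.
Qed.

Lemma fl_w_c1 : c1fam w a.
Proof.
apply: (c1fam_ext (c1famB fl_v_c1 (c1fam_const (bdm_cst T mean_velocity)))) => //.
by apply/funext => t; apply/funext => x; rewrite subr0.
Qed.

Lemma mass_center_derive t : 0 < t -> is_derive t 1 mass_center mean_velocity.
Proof.
by move=> t0; have := c1fam_int mu fl_X_c1 t0; rewrite fl_v_mean// ltW.
Qed.

Lemma fl_h_c1 : c1fam h w.
Proof.
split.
- by move=> t /ltW/fl_h_bdm[].
- by move=> t /ltW/fl_w_bdm[].
- move=> t x t0; have dX := fl_dX fl x t0; have dc := mass_center_derive t0.
  by apply: is_derive_eq; rewrite /fl_w; ring.
- move=> r S r0; have [C hC] := c1fam_bnd fl_X_c1 S r0.
  exists (C + C + 1) => t x rt tS.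
  have hc : `|mass_center t| <= C.
    apply: prob_norm_le; first by apply: fl_X_bdm; rewrite (le_trans _ rt)// ltW.
    by move=> y; exact: hC.
  have := hC t x rt tS; move: hc; rewrite /fl_h !ler_norml.
  by have := fl_m01 fl x; lra.
- exact: c1fam_bnd fl_w_c1.
Qed.

(** The velocity is Lipschitz in space, so the ratio of a distance at two times is
    bounded from above and below. *)
Lemma fl_ratio r S : 0 < r -> exists2 K, 0 <= K & forall s t x y,
  r <= s -> s <= t -> t <= S ->
  (forall t' : R, 0 <= t' -> X t' x <= X t' y) ->
  X t y - X t x <= (X s y - X s x) * expR (K * (t - s)) /\
  X s y - X s x <= (X t y - X t x) * expR (K * (t - s)).
Proof.
move=> r0; have [K K0 hK] := fl_lip fl S r0; exists K => // s t x y rs st tS ord.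
have dd z : s <= z -> z <= t -> is_derive z 1 (fun t => X t y - X t x) (v z y - v z x).
  move=> sz zt; have z0 : 0 < z by lra.
  have d1 := fl_dX fl x z0; have d2 := fl_dX fl y z0.
  by apply: is_derive_eq.
have vK z : s <= z -> z <= t -> `|v z y - v z x| <= K * (X z y - X z x).
  move=> sz zt; have [] := hK z y x _ _; [lra|lra|].
  by rewrite (ger0_norm (x := X z y - X z x))// subr_ge0; apply: ord; lra.
split.
  have H := @gronwall _ _ _ (- K) 0 s t st dd; rewrite !subr0 !mulNr !opprK in H.
  by apply: H => z sz zt; rewrite subr0 (le_trans (ler_norm _))// vK.
have dN z : s <= z -> z <= t ->
    is_derive z 1 (fun t => - (X t y - X t x)) (- (v z y - v z x)).
  by move=> sz zt; have dz := dd z sz zt; apply: is_derive_eq.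
have := @gronwall _ _ _ K 0 s t st dN; rewrite !subr0 => H.
have : - (X t y - X t x) <= - (X s y - X s x) * expR (- (K * (t - s))).
  apply: H => z sz zt; rewrite subr0 mulNr mulrN opprK.
  have := vK z sz zt; rewrite ler_norml; lra.
rewrite mulNr lerN2 expRN.
by rewrite ler_pdivrMr ?expR_gt0.
Qed.

(** For a singular weight Psi is not Lipschitz, but comparable arguments have close values:
    on [r1, r1 E] the weight is at most psi r1, and psi r1 * r1 is bounded. *)
Lemma prim_ratio C E (r1 r2 : R) : 1 <= E -> 0 <= r1 <= C -> 0 <= r2 <= C ->
  r1 <= r2 * E -> r2 <= r1 * E ->
  `|prim psi r1 - prim psi r2| <= prim_half psi C * (E - 1).
Proof.
move=> E1; wlog r12 : r1 r2 / r1 <= r2.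
  move=> H r1C r2C h1 h2; have [r12|/ltW r21] := leP r1 r2; first exact: H.
  by rewrite distrC; exact: H.
move=> /andP[r10 r1C] /andP[r20 r2C] h1 h2.
have E0 : 0 <= E - 1 by lra.
rewrite distrC ger0_norm ?subr_ge0 ?prim_nd//.
move: r10; rewrite le_eqVlt => /predU1P[r10|r10].
  have -> : r2 = r1 by apply/eqP; rewrite eq_le r12 andbT; move: h2; rewrite -r10 mul0r.
  by rewrite subrr mulr_ge0// prim_half_ge0.
have r10' := ltW r10.
rewrite /prim (@prim_half_neg _ _ (- r1)) ?(@prim_half_neg _ _ (- r2)) ?oppr_le0// !subr0.
have := @prim_half_le _ _ kp r1 r2 (psi r1) (ltW r10) r12 => /(_ _)/le_trans; apply.
  by move=> x h3 h4; apply: (kernel_noninc kp) => //; exact: ltW.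
apply: (@le_trans _ _ (psi r1 * (r1 * (E - 1)))).
  by rewrite ler_wpM2l ?kernel_ge0//; lra.
rewrite mulrA ler_wpM2r// (le_trans (kernel_mul_le kp r10))//.
exact: prim_half_nd.
Qed.

Lemma expR_sub1_le (K s : R) : 0 <= K -> 0 <= s <= 1 ->
  expR (K * s) - 1 <= K * expR K * s.
Proof.
move=> K0 /andP[s0 s1].
have h1 := expR_ge1Dx (- (K * s)).
have h2 : (1 - K * s) * expR (K * s) <= 1.
  by rewrite -[leRHS](expRxMexpNx_1 (K * s)) mulrC ler_wpM2l ?expR_ge0.
have h3 : K * s * expR (K * s) <= K * s * expR K.
  by rewrite ler_wpM2l ?mulr_ge0// ler_expR ler_piMr.
by lra.
Qed.

(** Although Psi may have infinite slope at 0 and particles may be arbitrarily close,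
    Psi of their distance is Lipschitz in time, uniformly in the pair. *)
Lemma fl_prim_lip r S : 0 < r -> exists K, forall s t x y,
  r <= s <= S -> r <= t <= S -> `|s - t| <= 1 ->
  `|prim psi (X s x - X s y) - prim psi (X t x - X t y)| <= K * `|s - t|.
Proof.
move=> r0; have [K K0 hK] := fl_ratio S r0; have [C hC] := fl_bnd fl S.
exists (prim_half psi (C + C) * (K * expR K)) => s t x y.
wlog ord : x y / forall t : R, 0 <= t -> X t x <= X t y.
  move=> H hs ht st; have [[_ o]|[_ o]] := fl_order fl x y; first exact: H.
  rewrite -[X s x - _]opprB -[X t x - _]opprB !primN -opprD normrN.
  exact: (H y x).
wlog st : s t / s <= t.
  move=> H hs ht h; have [st|/ltW ts] := leP s t; first exact: H.
  by rewrite distrC [`|s - t|]distrC; apply: H => //; rewrite distrC.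
move=> /andP[rs sS] /andP[rt tS]; rewrite [`|s - t|]distrC (ger0_norm (x := t - s)) ?subr_ge0// => ts1.
have [h1 h2] := hK s t x y rs st tS ord.
have bd z : r <= z -> z <= S -> 0 <= X z y - X z x <= C + C.
  move=> rz zS; have z0 : 0 <= z by lra.
  have [hx _] := hC z x z0 zS; have [hy _] := hC z y z0 zS.
  rewrite subr_ge0 ord//=; move: hx hy; rewrite !ler_norml; lra.
rewrite -[X s x - _]opprB -[X t x - _]opprB !primN -opprD normrN.
have E1 : 1 <= expR (K * (t - s)).
  by rewrite -expR0 ler_expR mulr_ge0// subr_ge0.
rewrite (le_trans (prim_ratio E1 (bd s rs sS) (bd t rt tS) h2 h1))//.
rewrite -mulrA ler_wpM2l ?prim_half_ge0// expR_sub1_le//.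
by rewrite subr_ge0 st.
Qed.

Lemma fl_prim_bdm t : 0 <= t -> bdm2 (fun x y => prim psi (X t x - X t y)).
Proof.
move=> t0; split.
  apply: (measurableT_comp _ (fl_X2_meas t0)).
  by apply: continuous_measurable_fun; exact: prim_continuous.
have [C hC] := fl_bnd fl t; exists (prim_half psi (C + C)) => z.
apply: prim_half_bound; rewrite (le_trans (ler_normB _ _))//.
by have [? _] := hC t z.1 t0 (lexx _); have [? _] := hC t z.2 t0 (lexx _); exact: lerD.
Qed.

(** The chain rule holds off the countable set where Psi is not differentiable, and this
    set is hit by almost no y. *)
Lemma fl_P_derive t x : 0 < t -> is_derive t 1 (P^~ x) (L t x).
Proof.
move=> t0.
have t20 : 0 < t / 2 by rewrite divr_gt0.
have [K hK] := fl_prim_lip (t + 1) t20.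
pose e := Num.min (t / 2) 1.
have e0 : 0 < e by rewrite lt_min t20 ltr01.
have near_t s : `|s - t| < e -> `|s - t| <= 1 /\ t / 2 <= s <= t + 1.
  rewrite lt_min => /andP[h1 h2]; split; first exact: ltW.
  by move: h1 h2; rewrite !ltr_norml; lra.
apply: (@is_derive_Rintegral _ _ _ mu (fun s y => prim psi (X s x - X s y))
  (q t x) t K e) => //.
- move=> s /near_t[_ /andP[s1 _]].
  by apply: (bdm2_slice x (fl_prim_bdm _)); lra.
- exact: (bdm2_slice x (fl_q_bdm t0)).
- by move=> s y /near_t[s1 s2]; apply: hK => //; apply/andP; split; lra.
have [J cJ dJ] := prim_derive_countable kp.
apply: (negligibleS _ (fl_null fl x t0 cJ)) => y /= ny.
apply: contrapT => nJ; apply: ny.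
have d1 := dJ _ nJ.
have d2 : is_derive t 1 (fun s => X s x - X s y) (v t x - v t y).
  have dx := fl_dX fl x t0; have dy := fl_dX fl y t0.
  by apply: is_derive_eq.
exact: (@is_derive1_comp _ (prim psi) (fun s => X s x - X s y) t _ _ d1 d2).
Qed.

Lemma fl_om_c1 : c1fam om (fun t x => - h t x).
Proof.
split.
- move=> t t0; apply: measurable_funD; first by have [] := fl_w_bdm (ltW t0).
  by have [] := bdm2_int mu (fl_prim_bdm (ltW t0)).
- by move=> t /ltW/fl_h_bdm/bdmN[].
- move=> t x t0; have d1 := fl_P_derive x t0.
  have d2 := c1fam_derive fl_w_c1 x t0.
  apply: is_derive_eq; rewrite fl_aE// /=.
  by move: (h t x) (L t x) => p1 p2; ring.
- move=> r S r0; have [K1 h1] := c1fam_bnd fl_w_c1 S r0.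
  have [C hC] := fl_bnd fl S.
  exists (K1 + prim_half psi (C + C)) => t x rt tS.
  rewrite (le_trans (ler_normD _ _))// lerD ?h1//.
  have t0 : 0 <= t by lra.
  apply: prob_norm_le; first exact: (bdm2_slice x (fl_prim_bdm t0)).
  move=> y; apply: prim_half_bound; rewrite (le_trans (ler_normB _ _))//.
  by have [? _] := hC t x t0 tS; have [? _] := hC t y t0 tS; exact: lerD.
- by move=> r S r0; have [K1 h1] := c1fam_bnd fl_h_c1 S r0; exists K1 => t x rt tS; rewrite normrN h1.
Qed.

(** [pairs_close] applied to each pair of labels from time 1 on. There G is the
    difference of P, which lies between 0 and eps + M d by the affine modulus of Psi;
    choosing the cut-off distance small makes eps at most r / 8. *)
Lemma fl_close (r : R) : 0 < r -> exists t0 dl0 : R, [/\ 1 <= t0, 0 < dl0 &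
  forall t x y, t0 <= t -> `|m x - m y| <= dl0 -> `|X t x - X t y| <= r].
Proof.
move=> r0.
have [s s0 hs] := prim_half_cvg0 kp (e := r / 16) ltac:(by rewrite divr_gt0).
pose M := Num.max 1 (psi s).
have M1 : 1 <= M by rewrite le_max lexx.
have psM : psi s <= M by rewrite le_max lexx orbT.
have mod : affine_modulus (prim psi) (r / 8) M.
  move=> b c bc; have := prim_modulus kp s0 bc.
  have : psi s * (c - b) <= M * (c - b) by rewrite ler_wpM2r// subr_ge0.
  by lra.
have [C hC] := fl_bnd fl (1 + pi / 2).
have p0 : 0 <= pi / 2 :> R by rewrite divr_ge0// pi_ge0.
have [C' C'0 hC'] : exists2 C' : R, 0 <= C' & forall x, `|om 1 x| <= C'.
  by apply: bdm_bound; exact: c1fam_bdm fl_om_c1 ltr01.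
have C20 : 0 <= `|C| + `|C| + (C' + C') by rewrite !addr_ge0.
have [t0 [dl0 [t00 dl00 H]]] := pairs_close r0 M1 C20.
exists (1 + t0), dl0; split => //; first by rewrite lerDl.
move=> t x y tt.
wlog [mxy ord] : x y / m x <= m y /\ forall t : R, 0 <= t -> X t x <= X t y.
  move=> W; have [xy|yx] := fl_order fl x y; first exact: W.
  by rewrite distrC [`|X t x - _|]distrC; exact: W.
rewrite distrC (ger0_norm (x := m y - m x)) ?subr_ge0// => mdl.
have tt0 : 0 <= t by lra.
rewrite distrC ger0_norm ?subr_ge0 ?ord//.
have PG (u : R) : 1 <= u -> 0 <= P u y - P u x <= r / 8 + M * (X u y - X u x).
  move=> u1; have u0 : 0 <= u by lra.
  have b1 := bdm2_slice x (fl_prim_bdm u0); have b2 := bdm2_slice y (fl_prim_bdm u0).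
  rewrite /fl_P -probB//; apply/andP; split.
    by apply: prob_ge0 => z; rewrite subr_ge0 prim_nd// lerD2r ord.
  apply: prob_le_cst; first exact: bdmB.
  move=> z; have := mod (X u x - X u z) (X u y - X u z).
  rewrite lerD2r => /(_ (ord _ u0))/le_trans; apply.
  by rewrite lerD2l ler_wpM2l//; lra.
have dom (u : R) : 0 < u -> is_derive u 1 (fun t => om t y - om t x)
    (2 * (m y - m x) - (X u y - X u x)).
  move=> u0; have E := is_deriveB (c1fam_derive fl_om_c1 y u0)
    (c1fam_derive fl_om_c1 x u0).
  have hE : - h u y - - h u x = 2 * (m y - m x) - (X u y - X u x).
    by rewrite /fl_h; move: (mass_center u) => c; ring.
  by rewrite -hE; exact: E.
have vE (u : R) : v u y - v u x = om u y - om u x - (P u y - P u x).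
  by rewrite /fl_om /fl_w; move: (P u x) (P u y) mean_velocity => *; ring.
have om1 : om 1 y - om 1 x <= C' + C'.
  move: (hC' x) (hC' y); move: (om 1 x) (om 1 y) => o1 o2.
  by rewrite !ler_norml; lra.
move: om P PG dom vE om1 => omf Pf PG dom vE om1.
apply: (H (fun t => X t y - X t x) (fun t => omf t y - omf t x)
  (fun t => Pf t y - Pf t x) (m y - m x) 1 _ _ _ PG) => //.
- move=> u u1; have u0 : 0 < u by lra.
  have d1 := fl_dX fl x u0; have d2 := fl_dX fl y u0.
  by rewrite /= -vE; apply: is_derive_eq.
- by move=> u u1; apply: dom; lra.
- by move=> u u1; rewrite subr_ge0 ord//; lra.
- by have := normr_ge0 C; lra.
- move=> u u1 u2; have u0 : 0 <= u by lra.
  have [hx _] := hC u x u0 u2; have [hy _] := hC u y u0 u2.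
  by have := ler_norm C; move: hx hy; rewrite !ler_norml; lra.
- by rewrite subr_ge0 mxy.
Qed.

End Flow.

(** * Energy, dissipation and corrector *)

Section Energy.
Context (R : realType) d (T : measurableType d) (mu : probability T R).
Implicit Types (t s r S C K : R) (x y : T).
Variables (psi : R -> R) (X v a : R -> T -> R) (m : T -> R).
Hypothesis fl : particle_flow mu psi X v a m.
Let kp := fl_kernel fl.

Local Notation w := (fl_w mu v).
Local Notation h := (fl_h mu X m).
Local Notation q := (fl_q psi X v).
Local Notation L := (fl_L mu psi X v).
Local Notation P := (fl_P mu psi X).
Local Notation om := (fl_om mu psi X v).

Definition energy t := 2^-1 * \int[mu]_x (h t x ^+ 2 + w t x ^+ 2).

Lemma energyE t : 0 <= t ->
  energy t = 2^-1 * (\int[mu]_x (h t x ^+ 2) + \int[mu]_x (w t x ^+ 2)).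
Proof.
move=> t0; rewrite /energy probD//; apply: bdmX.
  exact: (fl_h_bdm fl t0).
exact: (fl_w_bdm fl t0).
Qed.

Lemma prim2_bounded C : exists K, forall s : R, `|s| <= C ->
  `|prim2 psi s| <= K /\ `|prim psi s| <= K.
Proof.
exists (prim_half psi C * (1 + C)) => s sC.
have C0 : 0 <= C by rewrite (le_trans _ sC).
have hC := prim_half_ge0 kp C.
split; last first.
  rewrite (le_trans (prim_half_bound fl sC))// mulrDr mulr1 lerDl mulr_ge0//.
have [c [cs + _]] := prim2_bregman kp 0 s.
have -> : prim2 psi 0 = 0 by rewrite /prim2 normr0 set_itv1 Rintegral_set1.
rewrite prim0 mul0r !subr0 => ->; rewrite !subr0 in cs.
rewrite normrM (le_trans (ler_pM _ _ (prim_half_bound fl (le_trans cs sC)) sC))//.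
by rewrite mulrDr mulr1 lerDr.
Qed.

Lemma prim2_measurable : measurable_fun [set: measurableTypeR R] (prim2 psi).
Proof.
apply: continuous_measurable_fun => s.
apply: differentiable_continuous; apply/derivable1_diffP.
by have [] := prim2_derive kp s.
Qed.

Lemma fl_prim2_c1 : c1fam2 (fun t x y => prim2 psi (X t x - X t y))
  (fun t x y => prim psi (X t x - X t y) * (v t x - v t y)).
Proof.
have c1 := c1famB (c1fam2_fst (fl_X_c1 fl)) (c1fam2_snd (fl_X_c1 fl)).
apply: (c1fam_comp (F := prim2 psi) (F' := prim psi) _ _ _ _ c1).
- exact: (prim2_derive kp).
- exact: prim2_measurable.
- by apply: continuous_measurable_fun; exact: (prim_continuous kp).
- exact: prim2_bounded.
Qed.

(** The first term does not depend on time; subtracting the second makes the whole the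
    increment of Phi towards the asymptotic distance 2 (m x - m y). *)
Definition pair_potential t x y :=
  prim2 psi (2 * (m x - m y)) - prim2 psi (X t x - X t y).

Lemma pair_potential_c1 : c1fam2 pair_potential
  (fun t x y => - (prim psi (X t x - X t y) * (v t x - v t y))).
Proof.
have bm := fl_m_bdm fl.
have b0 : bdm (fun z : T * T => prim2 psi (2 * (m z.1 - m z.2))).
  split.
    apply: (measurableT_comp prim2_measurable).
    by apply: measurable_funM => //; case: (bdm2_diff bm).
  have [K hK] := prim2_bounded 2; exists K => z.
  have [] // := hK (2 * (m z.1 - m z.2)); rewrite ler_norml.
  by have := fl_m01 fl z.1; have := fl_m01 fl z.2; lra.
have := c1famB (c1fam_const b0) fl_prim2_c1.
move=> H; apply: (c1fam_ext H) => //.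
by apply/funext => t; apply/funext => z; rewrite sub0r.
Qed.

Definition corrector t := \int[mu]_x (h t x * om t x) +
  2^-1 * \int[mu]_x \int[mu]_y pair_potential t x y.

(** The derivative of h om is w om - h^2, and the part w P of w om is
    1/2 int int (w x - w y) Psi after exchanging x and y, which the derivative of the
    pair potential cancels. *)
Lemma corrector_derive t : 0 < t -> is_derive t 1 corrector
  (\int[mu]_x (w t x ^+ 2) - \int[mu]_x (h t x ^+ 2)).
Proof.
move=> t0; have tt := ltW t0.
have ar (A B C : R) : A + B - C - B = A - C by ring.
have bw := fl_w_bdm fl tt; have bh := fl_h_bdm fl tt.
have bp := fl_prim_bdm fl tt.
have bP : bdm (P t) by apply: bdm2_int.
have d1 := c1fam_int mu (c1famM (fl_h_c1 fl) (fl_om_c1 fl)) t0.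
have d2 := c1fam_int mu (c1fam2_int mu pair_potential_c1) t0.
have e1 : \int[mu]_x (w t x * om t x + h t x * - h t x) =
    \int[mu]_x (w t x ^+ 2) + \int[mu]_x (w t x * P t x) - \int[mu]_x (h t x ^+ 2).
  rewrite -probD; [|exact: bdmX|exact: bdmM].
  rewrite -probB; [|by apply: bdmD; [exact: bdmX|exact: bdmM]|exact: bdmX].
  apply: eq_prob => x; rewrite /fl_om.
  by move: (w t x) (P t x) (h t x) => *; ring.
have e2 : \int[mu]_x (w t x * P t x) = 2^-1 *
    \int[mu]_x \int[mu]_y ((w t x - w t y) * prim psi (X t x - X t y)).
  apply: fl_antisym => // x y; by rewrite -opprB primN.
have e3 : \int[mu]_x \int[mu]_y - (prim psi (X t x - X t y) * (v t x - v t y)) =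
   - \int[mu]_x \int[mu]_y ((w t x - w t y) * prim psi (X t x - X t y)).
  have bd : bdm2 (fun x y => (w t x - w t y) * prim psi (X t x - X t y)).
    by apply: bdmM => //; exact: bdm2_diff.
  rewrite -probN; last exact: bdm2_int.
  apply: eq_prob => x; rewrite -probN; last exact: (bdm2_slice x bd).
  by apply: eq_prob => y; rewrite /fl_w; move: (prim _ _) (mean_velocity _ _) => *; ring.
have d2' := is_deriveZ (2^-1) d2.
have D := is_deriveD d1 d2'.
apply: is_derive_eq D _.
by rewrite e1 e2 e3 /GRing.scale/= mulrN; exact: ar.
Qed.

Lemma dissipation_identity t : 0 < t -> \int[mu]_x (w t x * L t x) =
  2^-1 * \int[mu]_x \int[mu]_y (psi (X t x - X t y) * (w t x - w t y) ^+ 2).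
Proof.
move=> t0; rewrite /fl_L (fl_antisym mu (fl_q_bdm fl t0) (fl_w_bdm fl (ltW t0))).
  congr (_ * _); apply: eq_prob => x; apply: eq_prob => y.
  by rewrite /fl_q /fl_w; move: (psi _) (mean_velocity _ _) => *; ring.
by move=> x y; exact: (fl_qN fl _ _ _).
Qed.

Lemma energy_derive t : 0 < t ->
  is_derive t 1 energy (- \int[mu]_x (w t x * L t x)).
Proof.
move=> t0; have tt := ltW t0.
have ch := fl_h_c1 fl; have cw := fl_w_c1 fl.
have d1 := c1fam_int mu (c1famD (c1famM ch ch) (c1famM cw cw)) t0.
have D := is_deriveZ (2^-1) d1.
apply: is_derive_eq D _; rewrite /GRing.scale/= -probN; last first.
  by apply: bdmM; [exact: (fl_w_bdm fl tt)|exact: (fl_L_bdm fl t0)].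
rewrite -probZ; last first.
  apply: bdmD; apply: bdmD; apply: bdmM;
    by [exact: (fl_w_bdm fl tt)|exact: (fl_h_bdm fl tt)|exact: (c1fam_bdm' cw t0)].
apply: eq_prob => x; rewrite (fl_aE fl)//.
by move: (w t x) (h t x) (L t x) => p1 p2 p3; field.
Qed.

(** Exchanging x and y in int h P displays the Bregman distance of Phi between
    X x - X y and 2 (m x - m y), whose difference is h x - h y. *)
Lemma correctorE t : 0 <= t -> corrector t = \int[mu]_x (h t x * w t x) +
  2^-1 * \int[mu]_x \int[mu]_y
   (prim2 psi (2 * (m x - m y)) - prim2 psi (X t x - X t y) -
    prim psi (X t x - X t y) * (2 * (m x - m y) - (X t x - X t y))).
Proof.
move=> t0; have bw := fl_w_bdm fl t0; have bh := fl_h_bdm fl t0.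
have bp := fl_prim_bdm fl t0; have bm := fl_m_bdm fl; have bX := fl_X_bdm fl t0.
have bP : bdm (P t) by apply: bdm2_int.
have bpp : bdm2 (pair_potential t).
  split.
    apply: measurable_funB; apply: (measurableT_comp prim2_measurable).
      by apply: measurable_funM => //; case: (bdm2_diff bm).
    by case: (bdm2_diff bX).
  have [C hC] := fl_bnd fl t.
  have [K1 h1] := prim2_bounded 2; have [K2 h2] := prim2_bounded (C + C).
  exists (K1 + K2) => z; rewrite (le_trans (ler_normB _ _))// lerD//.
    have [] // := h1 (2 * (m z.1 - m z.2)); rewrite ler_norml.
    by have := fl_m01 fl z.1; have := fl_m01 fl z.2; lra.
  have [] // := h2 (X t z.1 - X t z.2); rewrite (le_trans (ler_normB _ _))//.
  have [? _] := hC t z.1 t0 (lexx _); have [? _] := hC t z.2 t0 (lexx _).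
  exact: lerD.
have bhp : bdm2 (fun x y => (h t x - h t y) * prim psi (X t x - X t y)).
  by apply: bdmM => //; exact: bdm2_diff.
have e1 : \int[mu]_x (h t x * om t x) =
    \int[mu]_x (h t x * w t x) + \int[mu]_x (h t x * P t x).
  rewrite -probD; [|exact: bdmM|exact: bdmM].
  by apply: eq_prob => x; rewrite /fl_om mulrDr.
have e2 : \int[mu]_x (h t x * P t x) = 2^-1 *
    \int[mu]_x \int[mu]_y ((h t x - h t y) * prim psi (X t x - X t y)).
  apply: fl_antisym => // x y; by rewrite -opprB primN.
rewrite /corrector e1 e2 -addrA -mulrDr -probD; [|exact: bdm2_int|exact: bdm2_int].
congr (_ + _ * _); apply: eq_prob => x; rewrite -probD.
- apply: eq_prob => y; rewrite /pair_potential /fl_h.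
  move: (mass_center _ _ _) (prim2 _ _) (prim2 _ _) (prim _ _) => c p1 p2 p3; ring.
- exact: (bdm2_slice x bhp).
- exact: (bdm2_slice x bpp).
Qed.

Lemma energy_le_corrector (t : R) : 0 <= t -> - energy t <= corrector t.
Proof.
move=> t0; have bw := fl_w_bdm fl t0; have bh := fl_h_bdm fl t0.
rewrite correctorE//.
have h1 : 0 <= \int[mu]_x \int[mu]_y
   (prim2 psi (2 * (m x - m y)) - prim2 psi (X t x - X t y) -
    prim psi (X t x - X t y) * (2 * (m x - m y) - (X t x - X t y))).
  apply: prob_ge0 => x; apply: prob_ge0 => y; exact: prim2_bregman_ge0.
have h2 : - energy t <= \int[mu]_x (h t x * w t x).
  have bs : bdm (fun x => h t x ^+ 2 + w t x ^+ 2) by apply: bdmD; exact: bdmX.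
  rewrite /energy -mulNr -probZ//.
  apply: prob_le; [exact: bdmZ|exact: bdmM|move=> x].
  have := sqr_ge0 (h t x + w t x); move: (h t x) (w t x) => p1 p2; nra.
by rewrite (le_trans h2)// lerDl mulr_ge0.
Qed.

Lemma corrector_le (e M : R) (t : R) : 0 <= t -> 0 <= e -> 0 < M ->
  affine_modulus (prim psi) e M ->
  corrector t <= (1 + 4 * M) * energy t + e ^+ 2 / M.
Proof.
move=> t0 e0 M0 mod; have bw := fl_w_bdm fl t0; have bh := fl_h_bdm fl t0.
have bs : bdm (fun x => h t x ^+ 2 + w t x ^+ 2) by apply: bdmD; exact: bdmX.
have bp := fl_prim_bdm fl t0; have bm := fl_m_bdm fl; have bX := fl_X_bdm fl t0.
rewrite correctorE//.
have ar (E B I J : R) : 0 <= B -> I <= E -> J <= B + 2 * M * (4 * E) ->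
    I + 2^-1 * J <= (1 + 4 * M) * E + B by nra.
apply: ar; first by rewrite divr_ge0 ?sqr_ge0// ltW.
  rewrite /energy -probZ//; apply: prob_le; [exact: bdmM|exact: bdmZ|move=> x].
  have := sqr_ge0 (h t x - w t x); move: (h t x) (w t x) => p1 p2; nra.
have bhh : bdm2 (fun x y => (h t x - h t y) ^+ 2).
  by apply: bdmX; exact: bdm2_diff.
have h4 : \int[mu]_x \int[mu]_y (h t x - h t y) ^+ 2 <= 4 * energy t.
  rewrite prob_sqrB// (fl_h_mean fl t0) expr0n/= mulr0 subr0 (energyE t0).
  have : 0 <= \int[mu]_x (w t x ^+ 2) by apply: prob_ge0 => x; exact: sqr_ge0.
  by move: (\int[mu]_x (w t x ^+ 2)) (\int[mu]_x (h t x ^+ 2)) => i1 i2; lra.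
apply: (@le_trans _ _ (\int[mu]_x \int[mu]_y
    (e ^+ 2 / M + 2 * M * (h t x - h t y) ^+ 2))); last first.
  have -> : \int[mu]_x \int[mu]_y (e ^+ 2 / M + 2 * M * (h t x - h t y) ^+ 2) =
     e ^+ 2 / M + 2 * M * \int[mu]_x \int[mu]_y (h t x - h t y) ^+ 2.
    transitivity (\int[mu]_x (e ^+ 2 / M + 2 * M * \int[mu]_y (h t x - h t y) ^+ 2)).
      apply: eq_prob => x; have bx := bdm2_slice x bhh.
      rewrite (probD mu (bdm_cst _ _) (bdmZ _ bx)) prob_cst probZ//.
    have bi := bdm2_int mu bhh.
    by rewrite (probD mu (bdm_cst _ _) (bdmZ _ bi)) prob_cst probZ.
  by rewrite lerD2l ler_wpM2l// mulr_ge0// ltW.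
have bmX : bdm2 (fun x y => 2 * (m x - m y) - (X t x - X t y)).
  by apply: bdmB; [apply: bdmZ|]; exact: bdm2_diff.
have bB : bdm2 (fun x y => prim2 psi (2 * (m x - m y)) - prim2 psi (X t x - X t y) -
    prim psi (X t x - X t y) * (2 * (m x - m y) - (X t x - X t y))).
  apply: bdmB; last by apply: bdmM.
  have comp f : bdm2 f -> bdm2 (fun x y => prim2 psi (f x y)).
    move=> [mf [C fC]]; split; first exact: (measurableT_comp prim2_measurable mf).
    by have [K hK] := prim2_bounded C; exists K => z; have [] := hK _ (fC z).
  have b1 : bdm2 (fun x y => 2 * (m x - m y)) by apply: bdmZ; exact: bdm2_diff.
  exact: (bdmB (comp _ b1) (comp _ (bdm2_diff bX))).
have bR : bdm2 (fun x y => e ^+ 2 / M + 2 * M * (h t x - h t y) ^+ 2).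
  by apply: bdmD; [exact: bdm_cst|exact: bdmZ].
apply: prob_le; [exact: bdm2_int|exact: bdm2_int|move=> x].
apply: prob_le; [exact: (bdm2_slice x bB)|exact: (bdm2_slice x bR)|move=> y].
rewrite (le_trans (prim2_bregman_le kp _ _ e0 M0 mod))// lerD2l.
suff -> : 2 * (m x - m y) - (X t x - X t y) = - (h t x - h t y) by rewrite sqrrN.
by rewrite /fl_h; move: (mass_center _ _ _) => c; ring.
Qed.

(** F = E + kap H. The dissipation dominates int w^2 by the Poincare inequality restricted
    to close labels, which interact at strength at least psim. With kap small, the
    term kap int w^2 in the derivative of kap H is absorbed, and - kap int h^2 remains. *)
Lemma energy_lyapunov (psim r : R) : 0 < psim -> 0 < r ->
  (forall x : R, `|x| <= r -> psim <= psi x) ->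
  exists kap t0 : R, exists F F' : R -> R, [/\ 0 < kap, 1 <= t0,
    forall t, t0 <= t -> is_derive t 1 F (F' t) /\ F' t <= - (2 * kap) * energy t,
    forall t, t0 <= t -> energy t <= 2 * F t &
    forall e M t, 0 <= e -> 0 < M -> affine_modulus (prim psi) e M -> t0 <= t ->
      F t <= (2 + 2 * M) * energy t + e ^+ 2 / M].
Proof.
move=> psim0 r0 psi_r.
have [t0 [dl [t01 dl0 close]]] := fl_close fl r0.
have [C C0 poin] := poincare (mu := mu) (fl_mmeas fl) (fl_m01 fl) (fl_mass fl) dl0.
pose kap := Num.min (1 / 4) (psim / (4 * C)).
have kap0 : 0 < kap by rewrite lt_min !divr_gt0// mulr_gt0.
have kap4 : kap <= 1 / 4 by rewrite ge_min lexx.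
have kapC : kap <= psim / (4 * C) by rewrite ge_min lexx orbT.
have en0 t : 0 <= energy t.
  by rewrite mulr_ge0// prob_ge0// => x; rewrite addr_ge0// sqr_ge0.
exists kap, t0, (fun t => energy t + kap * corrector t),
  (fun t => - (\int[mu]_x (w t x * L t x)) +
     kap * (\int[mu]_x (w t x ^+ 2) - \int[mu]_x (h t x ^+ 2))); split => //.
- move=> t tt; have tp : 0 < t by lra.
  have tp' := ltW tp.
  have bw := fl_w_bdm fl tp'.
  split.
    have D := is_deriveD (energy_derive tp) (is_deriveZ kap (corrector_derive tp)).
    exact: D.
  have diss : psim / (2 * C) * \int[mu]_x (w t x ^+ 2) <= \int[mu]_x (w t x * L t x).
    have p1 := poin _ bw (fl_w_mean fl tp').
    apply: (@le_trans _ _ (psim / 2 * near_energy mu m dl (w t))).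
      have -> : psim / (2 * C) * \int[mu]_x (w t x ^+ 2) =
          psim / 2 * (C^-1 * \int[mu]_x (w t x ^+ 2)).
        by move: (\int[mu]_x _) => I; field; rewrite gt_eqF.
      by rewrite ler_pM2l ?divr_gt0// ler_pdivrMl.
    rewrite (dissipation_identity tp).
    rewrite (_ : psim / 2 * near_energy mu m dl (w t) = 2^-1 * (psim * near_energy mu m dl (w t))); last first.
      by move: (near_energy _ _ _ _) => I; ring.
    have b1 := bdm2_near_sqr (fl_mmeas fl) dl bw.
    have bq : bdm2 (fun x y => psi (X t x - X t y) * (w t x - w t y) ^+ 2).
      have : bdm2 (fun x y => fl_q psi X v t x y * (w t x - w t y)).
        by apply: bdmM; [exact: (fl_q_bdm fl tp)|exact: bdm2_diff].
      congr (bdm _); apply/funext => z; rewrite /fl_q /fl_w.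
      by move: (psi _) (mean_velocity _ _) => *; ring.
    rewrite ler_pM2l ?invr_gt0// /near_energy -probZ; last exact: bdm2_int.
    apply: prob_le; [by apply: bdmZ; exact: bdm2_int|exact: bdm2_int|move=> x].
    rewrite -probZ; last exact: (bdm2_slice x b1).
    apply: prob_le; [by apply: bdmZ; exact: (bdm2_slice x b1)|exact: (bdm2_slice x bq)|].
    move=> y; rewrite [leLHS]mulrA ler_wpM2r ?sqr_ge0//.
    have [near|_] := boolP (`|m x - m y| <= dl); last first.
      by rewrite mulr0 kernel_ge0.
    by rewrite mulr1; apply: psi_r; exact: close.
  rewrite (energyE tp').
  have Iw : 0 <= \int[mu]_x (w t x ^+ 2) by apply: prob_ge0 => x; exact: sqr_ge0.
  have k2 : 2 * kap <= psim / (2 * C).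
    have -> : psim / (2 * C) = 2 * (psim / (4 * C)) by field; rewrite gt_eqF.
    by rewrite ler_pM2l.
  move: (\int[mu]_x (w t x ^+ 2)) (\int[mu]_x (w t x * L t x))
    (\int[mu]_x (h t x ^+ 2)) (psim / (2 * C)) Iw k2 diss => I1 I2 I3 c Iw k2 diss.
  have kI : 2 * kap * I1 <= c * I1 by rewrite ler_wpM2r.
  by lra.
- move=> t tt; have tp : 0 <= t by lra.
  have := energy_le_corrector tp; have := en0 t.
  move: (energy t) (corrector t) => E c E0 hc.
  have : kap * - E <= kap * c by rewrite ler_pM2l.
  have : kap * E <= 1 / 4 * E by rewrite ler_wpM2r.
  by lra.
- move=> e M t e0 M0 mod tt; have tp : 0 <= t by lra.
  have := corrector_le tp e0 M0 mod; have := en0 t.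
  have : 0 <= e ^+ 2 / M by rewrite divr_ge0 ?sqr_ge0// ltW.
  move: (e ^+ 2 / M) (energy t) (corrector t) => B E c B0 E0 hc.
  have h1 : kap * c <= kap * ((1 + 4 * M) * E + B) by rewrite ler_pM2l.
  have ME : 0 <= M * E by rewrite mulr_ge0// ltW.
  have : kap * ((1 + 4 * M) * E + B) <= 1 / 4 * ((1 + 4 * M) * E + B).
    by rewrite ler_wpM2r//; lra.
  by lra.
Qed.

End Energy.

(** * Decay of the flow *)

Section Decay.
Context (R : realType) d (T : measurableType d) (mu : probability T R).
Implicit Types (t s r S C K : R) (x y : T).
Variables (psi : R -> R) (X v a : R -> T -> R) (m : T -> R).
Hypothesis fl : particle_flow mu psi X v a m.
Let kp := fl_kernel fl.
Variables (psim r : R).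
Hypotheses (psim0 : 0 < psim) (r0 : 0 < r).
Hypothesis psi_r : forall x : R, `|x| <= r -> psim <= psi x.

Local Notation w := (fl_w mu v).
Local Notation h := (fl_h mu X m).
Local Notation L := (fl_L mu psi X v).
Local Notation En := (energy mu X v m).

(** With e = 0 the functional F is equivalent to the energy, so F' <= - c F. *)
Lemma energy_exp_decay (M : R) : 0 < M -> affine_modulus (prim psi) 0 M ->
  exists C c t0 : R, [/\ 0 <= C, 0 < c, 1 <= t0 &
    forall t, t0 <= t -> En t <= C * expR (- (c * t))].
Proof.
move=> M0 mod.
have [kap [t0 [F [F' [kap0 t01 dF EF FE]]]]] := energy_lyapunov fl psim0 r0 psi_r.
pose c := kap / (1 + M).
have c0 : 0 < c by rewrite divr_gt0//; lra.
have E0 t : 0 <= En t by rewrite mulr_ge0// prob_ge0// => x; rewrite addr_ge0// sqr_ge0.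
have F0 : 0 <= F t0 by have := E0 t0; have := EF _ (lexx t0); lra.
exists (2 * F t0 * expR (c * t0)), c, t0; split => //.
  by rewrite mulr_ge0 ?expR_ge0// mulr_ge0.
move=> t t0t; have := EF _ t0t.
have : F t <= F t0 * expR (- (c * (t - t0))).
  have := @gronwall _ F F' c 0 t0 t t0t; rewrite !subr0; apply.
    by move=> s s0 _; have [] := dF s s0.
  move=> s s0 _; have [_ /le_trans] := dF s s0; apply.
  have := FE 0 M s (lexx _) M0 mod s0; rewrite expr0n/= mul0r addr0 subr0 => FEs.
  rewrite mulNr mulNr lerN2 /c.
  have -> : kap / (1 + M) * F s = (2 * kap) * (F s / (2 + 2 * M)).
    by field; rewrite !gt_eqF//; lra.
  rewrite ler_pM2l ?mulr_gt0// ler_pdivrMr; last by lra.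
  by rewrite mulrC.
have -> : 2 * F t0 * expR (c * t0) * expR (- (c * t)) =
    2 * (F t0 * expR (- (c * (t - t0)))).
  have -> : - (c * (t - t0)) = c * t0 + - (c * t) by ring.
  by rewrite expRD !mulrA.
by lra.
Qed.

Lemma fl_hw_bnd S : exists2 C, 0 <= C & forall t x, 0 <= t -> t <= S ->
  `|h t x| <= C /\ `|w t x| <= C.
Proof.
have [C hC] := fl_bnd fl S.
have [C' C'0 hv0] := bdm_bound (fl_v_bdm fl (lexx 0)).
exists (`|C| + `|C| + 1 + C'); first by rewrite !addr_ge0.
move=> t x t0 tS; have [hX hv] := hC t x t0 tS.
have hc : `|mass_center mu X t| <= C.
  apply: prob_norm_le; first exact: (fl_X_bdm fl t0).
  by move=> y; have [] := hC t y t0 tS.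
have hm : `|mean_velocity mu v| <= C'.
  by apply: prob_norm_le => //; exact: (fl_v_bdm fl (lexx 0)).
have CC := ler_norm C; have m1 := fl_m01 fl x.
rewrite /fl_h /fl_w; move: hc hm hX hv.
move: (mass_center mu X t) (mean_velocity mu v) => c mv.
by rewrite !ler_norml; lra.
Qed.

Lemma sqr_mean_le (f : T -> R) : bdm f ->
  (\int[mu]_x f x) ^+ 2 <= \int[mu]_x (f x ^+ 2).
Proof.
move=> bf; have ar (I J K : R) : I = 2 * J - 2 * K -> 0 <= I -> K <= J by lra.
apply: ar (prob_sqrB mu bf) _.
by apply: prob_ge0 => x; apply: prob_ge0 => y; exact: sqr_ge0.
Qed.

(** The modified energy 1/2 (h^2 + w^2) + k h w of h' = w, w' = - h - a w + b, where
    a0 <= a <= M: the cross term makes h dissipate, and k is so small that the loss in w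
    is covered by a0 w^2. *)
Lemma damped_oscillator_ineq (a0 M k hh ww aa bb : R) :
  0 < a0 -> 0 < k -> k <= 1 / 2 -> k <= a0 -> k * (1 + M ^+ 2) <= a0 / 4 ->
  a0 <= aa -> `|aa| <= M ->
  hh * ww + ww * (- hh - aa * ww + bb) +
    k * (ww * ww + hh * (- hh - aa * ww + bb))
  <= - (k / 2) * (2^-1 * (hh ^+ 2 + ww ^+ 2) + k * (hh * ww)) + (a0^-1 + 1) * bb ^+ 2.
Proof.
move=> a00 k0 k12 ka kM aa0 aaM.
have h1 : a0 * ww ^+ 2 <= aa * ww ^+ 2 by rewrite ler_wpM2r ?sqr_ge0.
have h2 : - (aa * (hh * ww)) <= hh ^+ 2 / 4 + M ^+ 2 * ww ^+ 2.
  have : aa ^+ 2 <= M ^+ 2.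
    by rewrite -(real_normK (num_real aa)) lerXn2r ?nnegrE// (le_trans _ aaM).
  move=> /(ler_wpM2r (sqr_ge0 ww)).
  have := sqr_ge0 (hh / 2 + aa * ww); nra.
have h3 : bb * ww <= a0 / 4 * ww ^+ 2 + a0^-1 * bb ^+ 2.
  have -> : a0 / 4 * ww ^+ 2 + a0^-1 * bb ^+ 2 =
     bb * ww + (a0 / 2 * ww - bb) ^+ 2 / a0 by field; rewrite gt_eqF.
  by rewrite lerDl divr_ge0 ?sqr_ge0// ltW.
have h4 : bb * hh <= hh ^+ 2 / 4 + bb ^+ 2 by have := sqr_ge0 (hh / 2 - bb); nra.
have h5 : hh * ww <= 2^-1 * (hh ^+ 2 + ww ^+ 2) by have := sqr_ge0 (hh - ww); nra.
have h2' : k * - (aa * (hh * ww)) <= k * (hh ^+ 2 / 4 + M ^+ 2 * ww ^+ 2).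
  by rewrite ler_pM2l.
have h4' : k * (bb * hh) <= k * (hh ^+ 2 / 4 + bb ^+ 2) by rewrite ler_pM2l.
have h5' : k * (k * (hh * ww)) <= k * (1 / 2 * (2^-1 * (hh ^+ 2 + ww ^+ 2))).
  rewrite ler_pM2l//; apply: (@le_trans _ _ (k * (2^-1 * (hh ^+ 2 + ww ^+ 2)))).
    by rewrite ler_pM2l.
  by rewrite ler_wpM2r// mulr_ge0// addr_ge0 ?sqr_ge0.
have h6 : k * (1 + M ^+ 2) * ww ^+ 2 <= a0 / 4 * ww ^+ 2.
  by rewrite ler_wpM2r ?sqr_ge0.
have h7 : k * ww ^+ 2 <= a0 * ww ^+ 2 by rewrite ler_wpM2r ?sqr_ge0.
have h8 : k * bb ^+ 2 <= 1 / 2 * bb ^+ 2 by rewrite ler_wpM2r ?sqr_ge0.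
have w0 := sqr_ge0 ww; have hh0 := sqr_ge0 hh; have b0 := sqr_ge0 bb.
have kh : 0 <= k * hh ^+ 2 by rewrite mulr_ge0// ltW.
have kw : 0 <= k * ww ^+ 2 by rewrite mulr_ge0// ltW.
by lra.
Qed.

(** Once the energy decays, each label carries the oscillator w' = - h - aa w + bb, where
    aa is the mean weight seen by the particle and bb the mean of w against this weight.
    Close labels, of mass at least dl', make aa at least psim dl', and bb is bounded by
    the energy. *)
Lemma flow_exp_decay (M : R) : 0 < M -> (forall x : R, psi x <= M) ->
  exists C c : R, [/\ 0 < C, 0 < c & forall t x, 0 <= t ->
    `|h t x| <= C * expR (- (c * t)) /\ `|w t x| <= C * expR (- (c * t))].
Proof.
move=> M0 psiM.
have [C1 [c1 [t1 [C10 c10 t11 enC]]]] :=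
  energy_exp_decay M0 (prim_modulus_bounded kp psiM).
have [t2 [dl [t21 dl0 close]]] := fl_close fl r0.
pose t0 := Num.max t1 t2.
have t01 : t1 <= t0 by rewrite le_max lexx.
have t02 : t2 <= t0 by rewrite le_max lexx orbT.
pose dl' := Num.min dl 2^-1.
have dl'0 : 0 < dl' by rewrite lt_min dl0/= invr_gt0.
have dl'1 : dl' <= 2^-1 by rewrite ge_min lexx orbT.
have dl'dl : dl' <= dl by rewrite ge_min lexx.
pose a0 := psim * dl'; have a00 : 0 < a0 by rewrite mulr_gt0.
pose k := Num.min (1 / 2) (Num.min a0 (a0 / 4 / (1 + M ^+ 2))).
have M2 : 0 < 1 + M ^+ 2 by rewrite ltr_pwDl// sqr_ge0.
have k0 : 0 < k by rewrite !lt_min a00 !divr_gt0.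
have k12 : k <= 1 / 2 by rewrite ge_min lexx.
have ka : k <= a0 by rewrite !ge_min lexx !orbT.
have kM : k * (1 + M ^+ 2) <= a0 / 4.
  by rewrite -ler_pdivlMr// !ge_min lexx !orbT.
pose q := Num.min (k / 2) (c1 / 2).
have q0 : 0 < q by rewrite lt_min !divr_gt0.
have qk : q <= k / 2 by rewrite ge_min lexx.
have qc : q <= c1 / 2 by rewrite ge_min lexx orbT.
have qc1 : 0 < c1 - q by lra.
pose B := (a0^-1 + 1) * (2 * M ^+ 2 * C1).
have B0 : 0 <= B.
  apply: mulr_ge0; first by rewrite addr_ge0// invr_ge0 ltW.
  by apply: mulr_ge0 => //; apply: mulr_ge0 => //; exact: sqr_ge0.
have [Cb Cb0 hCb] := fl_hw_bnd t0.
pose e t x := 2^-1 * (h t x ^+ 2 + w t x ^+ 2) + k * (h t x * w t x).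
have e_ge t x : h t x ^+ 2 + w t x ^+ 2 <= 4 * e t x.
  rewrite /e; move: (h t x) (w t x) => p1 p2.
  have : - (2^-1 * (p1 ^+ 2 + p2 ^+ 2)) <= p1 * p2.
    by have := sqr_ge0 (p1 + p2); nra.
  rewrite -(ler_pM2l k0) => hk.
  have : k * (2^-1 * (p1 ^+ 2 + p2 ^+ 2)) <= 1 / 2 * (2^-1 * (p1 ^+ 2 + p2 ^+ 2)).
    by rewrite ler_wpM2r// mulr_ge0// addr_ge0 ?sqr_ge0.
  by lra.
have e_ge0 t x : 0 <= e t x.
  by have := e_ge t x; have := sqr_ge0 (h t x); have := sqr_ge0 (w t x);
    move: (e t x) (h t x) (w t x) => *; lra.
pose aa t x := \int[mu]_y psi (X t x - X t y).
pose bb t x := \int[mu]_y (psi (X t x - X t y) * w t y).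
have t0p t : t0 <= t -> 0 < t by lra.
have bpsi t x : t0 <= t -> bdm (fun y => psi (X t x - X t y)).
  move=> tt; have tp := ltW (t0p _ tt); split.
    apply: (measurableT_comp (kernel_measurable kp)).
    by apply: measurable_funB => //; exact: (fl_Xmeas fl tp).
  by exists M => y; rewrite ger0_norm ?(kernel_ge0 kp).
have LE t x : t0 <= t -> L t x = aa t x * w t x - bb t x.
  move=> tt; have bw := fl_w_bdm fl (ltW (t0p _ tt)).
  rewrite mulrC -probZ; last exact: bpsi.
  rewrite -probB; [|by apply: bdmZ; exact: bpsi|by apply: bdmM => //; exact: bpsi].
  apply: eq_prob => y; rewrite /fl_q /fl_w.
  by move: (psi _) (mean_velocity _ _) => *; ring.
have aaM t x : t0 <= t -> `|aa t x| <= M.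
  move=> tt; apply: prob_norm_le; first exact: bpsi.
  by move=> y; rewrite ger0_norm ?(kernel_ge0 kp).
have aa0 t x : t0 <= t -> a0 <= aa t x.
  move=> tt; have bn := bdm_near (fl_mmeas fl) (m x) dl'.
  apply: (@le_trans _ _ (\int[mu]_y (psim * (`|m y - m x| <= dl')%R%:R))).
    rewrite probZ// ler_pM2l//; apply: (fl_mass fl); first exact: fl_m01 fl x.
    by rewrite (ltW dl'0).
  apply: prob_le; [exact: bdmZ|exact: bpsi|move=> y].
  have [near|_] := boolP (`|m y - m x| <= dl'); last by rewrite mulr0 kernel_ge0.
  rewrite mulr1; apply: psi_r; apply: close; first exact: le_trans tt.
  by rewrite distrC (le_trans near).
have bbE t x : t0 <= t -> (a0^-1 + 1) * bb t x ^+ 2 <= B * expR (- (c1 * t)).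
  move=> tt; have tp := ltW (t0p _ tt); have bw := fl_w_bdm fl tp.
  have bpw : bdm (fun y => psi (X t x - X t y) * w t y).
    by apply: bdmM => //; exact: bpsi.
  rewrite /B -mulrA ler_wpM2l ?addr_ge0 ?invr_ge0 ?(ltW a00)//.
  rewrite (le_trans (sqr_mean_le bpw))//.
  apply: (@le_trans _ _ (M ^+ 2 * \int[mu]_y (w t y ^+ 2))).
    rewrite -probZ; last exact: bdmX.
    apply: prob_le; [exact: bdmX|by apply: bdmZ; exact: bdmX|move=> y].
    rewrite exprMn ler_wpM2r ?sqr_ge0// lerXn2r ?nnegrE ?(kernel_ge0 kp)//.
    exact: ltW.
  have -> : 2 * M ^+ 2 * C1 * expR (- (c1 * t)) =
     M ^+ 2 * (2 * (C1 * expR (- (c1 * t)))) by ring.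
  rewrite ler_wpM2l ?sqr_ge0//.
  have := enC t (le_trans t01 tt); rewrite (energyE fl)//.
  have : 0 <= \int[mu]_x (h t x ^+ 2) by apply: prob_ge0 => z; exact: sqr_ge0.
  by move: (\int[mu]_x (w t x ^+ 2)) (\int[mu]_x (h t x ^+ 2)) => *; lra.
(* the added multiple of exp (- c1 t) absorbs the forcing, so that Z' <= - q Z *)
pose Z x t := e t x + B / (c1 - q) * expR (- (c1 * t)).
have Zdec x t : t0 <= t -> Z x t <= Z x t0 * expR (- (q * (t - t0))).
  move=> tt.
  pose e' s := h s x * w s x + w s x * (- h s x - aa s x * w s x + bb s x) +
    k * (w s x * w s x + h s x * (- h s x - aa s x * w s x + bb s x)).
  have := @gronwall _ (Z x) (fun s => e' s - B / (c1 - q) * c1 * expR (- (c1 * s)))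
    q 0 t0 t tt; rewrite !subr0; apply.
    move=> s s0 _; have sp := t0p _ s0.
    have dh := c1fam_derive (fl_h_c1 fl) x sp.
    have dw := c1fam_derive (fl_w_c1 fl) x sp.
    rewrite (fl_aE fl)// LE// in dw.
    rewrite /Z /e /e'; move: (aa s x) (bb s x) dw => as_ bs dw.
    by apply: is_derive_eq; rewrite /GRing.scale/=;
      move: (h s x) (w s x) (expR _) => p1 p2 p3; field; rewrite gt_eqF.
  move=> s s0 _; rewrite subr0.
  have := damped_oscillator_ineq (h s x) (w s x) (bb s x) a00 k0 k12 ka kM (aa0 s x s0) (aaM s x s0).
  rewrite -/(e' s) -/(e s x) => h1.
  have h2 := bbE s x s0.
  have h3 : q * e s x <= k / 2 * e s x by rewrite ler_wpM2r.
  rewrite /Z.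
  have h4 : B / (c1 - q) * c1 * expR (- (c1 * s)) =
    B * expR (- (c1 * s)) + q * (B / (c1 - q) * expR (- (c1 * s))).
    by move: (expR _) => p; field; rewrite gt_eqF.
  rewrite h4; move: h1 h2 h3.
  move: (e' s) (e s x) (bb s x) (expR _) (B / (c1 - q)) => p1 p2 p3 p4 p5.
  by lra.
pose K1 := 4 * ((2^-1 + k) * (Cb ^+ 2 + Cb ^+ 2) + B / (c1 - q)) * expR (q * t0).
have K10 : 0 <= K1.
  rewrite mulr_ge0 ?expR_ge0// mulr_ge0// addr_ge0//.
    by rewrite mulr_ge0 ?addr_ge0 ?sqr_ge0// ?(ltW k0)// invr_ge0.
  by rewrite divr_ge0// ltW.
have main t x : t0 <= t -> h t x ^+ 2 + w t x ^+ 2 <= K1 * expR (- (q * t)).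
  move=> tt; apply: (le_trans (e_ge t x)).
  have z1 : e t x <= Z x t.
    by rewrite lerDl mulr_ge0 ?expR_ge0// divr_ge0// ltW.
  have z2 : Z x t0 <= (2^-1 + k) * (Cb ^+ 2 + Cb ^+ 2) + B / (c1 - q).
    rewrite lerD//; last first.
      rewrite ler_piMr ?divr_ge0 ?(ltW qc1)// -expR0 ler_expR oppr_le0.
      by rewrite mulr_ge0 ?(ltW c10)//; lra.
    have [h1 h2] := hCb t0 x (ltW (t0p _ (lexx _))) (lexx _).
    have s1 : h t0 x ^+ 2 <= Cb ^+ 2.
      by rewrite -(real_normK (num_real (h t0 x))) lerXn2r ?nnegrE.
    have s2 : w t0 x ^+ 2 <= Cb ^+ 2.
      by rewrite -(real_normK (num_real (w t0 x))) lerXn2r ?nnegrE.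
    rewrite /e [leRHS]mulrDl lerD//.
      by rewrite ler_pM2l ?invr_gt0// lerD.
    rewrite ler_pM2l//; move: (h t0 x) (w t0 x) s1 s2 => p1 p2.
    by have := sqr_ge0 (p1 - p2); have := sqr_ge0 p1; have := sqr_ge0 p2; nra.
  have := Zdec x t tt.
  have -> : K1 * expR (- (q * t)) =
    4 * (((2^-1 + k) * (Cb ^+ 2 + Cb ^+ 2) + B / (c1 - q)) * expR (- (q * (t - t0)))).
    have -> : - (q * (t - t0)) = q * t0 + - (q * t) by ring.
    by rewrite expRD /K1 !mulrA.
  have : Z x t0 * expR (- (q * (t - t0))) <=
    ((2^-1 + k) * (Cb ^+ 2 + Cb ^+ 2) + B / (c1 - q)) * expR (- (q * (t - t0))).
    by rewrite ler_wpM2r ?expR_ge0.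
  move=> i1 i2; rewrite ler_pM2l//; apply: (le_trans z1); exact: le_trans i2 i1.
pose K := K1 + 1 + Cb * expR (q / 2 * t0).
have K1K : K1 + 1 <= K by rewrite lerDl mulr_ge0 ?expR_ge0.
exists K, (q / 2); split; [|by rewrite divr_gt0|].
  by apply: lt_le_trans K1K; rewrite ltr_wpDl.
move=> t x tp; have [tt|/ltW tt] := leP t0 t.
  have sq (z : R) : z ^+ 2 <= K1 * expR (- (q * t)) -> `|z| <= K * expR (- (q / 2 * t)).
    have -> : - (q * t) = - (q / 2 * t) + - (q / 2 * t) by field.
    rewrite expRD => zz.
    have E0 := expR_gt0 (- (q / 2 * t)).
    have K11 : 1 <= K by apply: le_trans K1K; rewrite lerDr.
    have K0 : 0 <= K by rewrite (le_trans _ K11).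
    rewrite -(@ler_pXn2r _ 2)// ?nnegrE ?mulr_ge0 ?expR_ge0//.
    rewrite real_normK ?num_real// (le_trans zz)// exprMn expr2 ler_wpM2r//.
    have K1K' : K1 <= K by apply: le_trans K1K; rewrite lerDl.
    by rewrite (le_trans K1K')// ler_peMr.
  have mm := main t x tt.
  by split; apply: sq; apply: (le_trans _ mm); rewrite ?lerDl ?lerDr sqr_ge0.
have [h1 h2] := hCb t x tp tt.
have Cb1 : Cb <= K * expR (- (q / 2 * t)).
  apply: (@le_trans _ _ (Cb * expR (q / 2 * t0) * expR (- (q / 2 * t)))).
    rewrite -mulrA -expRD ler_peMr// -[leLHS]expR0 ler_expR.
    have -> : q / 2 * t0 - q / 2 * t = q / 2 * (t0 - t) by ring.
    by rewrite mulr_ge0 ?subr_ge0// divr_ge0// ltW.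
  by rewrite ler_wpM2r ?expR_ge0// lerDr addr_ge0.
by split; [exact: le_trans h1 Cb1|exact: le_trans h2 Cb1].
Qed.

(** At time t use the modulus with parameter s = lam / t. Then F is at most
    t / (p + 1) times its dissipation rate plus a term of order t^-p, so that
    t^(p + 1) F - C' t is nonincreasing. *)
Lemma energy_alg_decay (p K0 s0 : R) : 0 < p -> 0 < K0 -> 0 < s0 ->
  (forall s, 0 < s -> s <= s0 -> exists e M : R, [/\ 0 <= e, 0 < M,
     affine_modulus (prim psi) e M, M <= K0 / s & e ^+ 2 / M <= K0 * s `^ p]) ->
  exists C t1 : R, [/\ 0 <= C, 1 <= t1 &
    forall t, t1 <= t -> En t <= C * t `^ (- p)].
Proof.
move=> p0 K00 s00 mod.
have [kap [t0 [F [F' [kap0 t01 dF EF FE]]]]] := energy_lyapunov fl psim0 r0 psi_r.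
have E0 t : 0 <= En t by rewrite mulr_ge0// prob_ge0// => x; rewrite addr_ge0// sqr_ge0.
pose A := 2 + 2 * K0.
have A0 : 0 < A by rewrite /A; lra.
pose lam := (p + 1) * A / (2 * kap).
have lam0 : 0 < lam by rewrite divr_gt0 ?mulr_gt0//; lra.
pose t1 := Num.max t0 (Num.max lam (lam / s0)).
have t1t0 : t0 <= t1 by rewrite le_max lexx.
have t1lam : lam <= t1 by rewrite !le_max lexx !orbT.
have t1s : lam / s0 <= t1 by rewrite !le_max lexx !orbT.
have t11 : 1 <= t1 by exact: le_trans t1t0.
pose C' := (p + 1) * K0 * lam `^ p.
have C'0 : 0 <= C' by rewrite mulr_ge0 ?powR_ge0// mulr_ge0 ?(ltW K00)//; lra.
pose Y t := t `^ (p + 1) * F t - C' * t.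
have Ydec t : t1 <= t -> Y t <= Y t1.
  move=> tt.
  apply: (@le_of_derive_le0 _ Y
    (fun s => (p + 1) * s `^ p * F s + s `^ (p + 1) * F' s - C')) => //.
    move=> s ss _; have [dFs _] := dF s (le_trans t1t0 ss).
    have sp : 0 < s by lra.
    have dpow := is_derive1_powR (p + 1) sp; rewrite addrK in dpow.
    by rewrite /Y; apply: is_derive_eq; rewrite /GRing.scale/=; ring.
  move=> s ss _; have st0 := le_trans t1t0 ss; have sp : 0 < s by lra.
  have [_ dFs] := dF s st0.
  have ls0 : 0 < lam / s by rewrite divr_gt0.
  have ls1 : lam / s <= 1 by rewrite ler_pdivrMr// mul1r (le_trans t1lam).
  have lss : lam / s <= s0.
    by rewrite ler_pdivrMr// mulrC -ler_pdivrMr// (le_trans t1s).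
  have [e [M [e0 M0 modM MK eK]]] := mod _ ls0 lss.
  have FEs := FE e M s e0 M0 modM st0.
  have h1 : F s <= A * s / lam * En s + K0 * (lam / s) `^ p.
    rewrite (le_trans FEs)// lerD// ler_wpM2r//.
    have z1 : 1 <= s / lam by rewrite ler_pdivlMr// mul1r (le_trans t1lam).
    rewrite invf_div in MK.
    by rewrite -mulrA /A; move: (s / lam) z1 MK => z z1 MK; lra.
  have pw : s `^ (p + 1) = s `^ p * s by rewrite powRD ?powRr1 ?(ltW sp)//; apply/implyP => _; rewrite gt_eqF.
  have lp : s `^ p * (lam / s) `^ p = lam `^ p.
    by rewrite -powRM ?(ltW sp) ?(ltW ls0)// mulrC divfK// gt_eqF.
  have sp0 : 0 < s `^ p by rewrite powR_gt0.
  have h2 : s * F' s <= - (p + 1) * (F s - K0 * (lam / s) `^ p).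
    have : (p + 1) * (F s - K0 * (lam / s) `^ p) <= (p + 1) * (A * s / lam * En s).
      by rewrite ler_pM2l; lra.
    have -> : (p + 1) * (A * s / lam * En s) = s * (2 * kap * En s).
      by rewrite /lam; field; rewrite !gt_eqF//; lra.
    have : s * F' s <= s * (- (2 * kap) * En s) by rewrite ler_pM2l.
    by rewrite !mulNr; lra.
  have h3 : s `^ p * (s * F' s) <= s `^ p * (- (p + 1) * (F s - K0 * (lam / s) `^ p)).
    by rewrite ler_pM2l.
  rewrite pw /C' -lp.
  by move: (s `^ p) ((lam / s) `^ p) (F' s) (F s) h3 => z1 z2 z3 z4 h3; lra.
exists (2 * (C' + `|Y t1|)), t1; split => //; first by rewrite mulr_ge0// addr_ge0.
move=> t tt; have tp : 0 < t by lra.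
rewrite (le_trans (EF t (le_trans t1t0 tt)))// -mulrA ler_pM2l//.
have Yt := Ydec t tt.
rewrite powRN -[leRHS]mulrC mulrC -ler_pdivrMr; last by rewrite invr_gt0 powR_gt0.
rewrite invrK.
have pw : t `^ (p + 1) = t `^ p * t by rewrite powRD ?powRr1 ?(ltW tp)//; apply/implyP => _; rewrite gt_eqF.
have t1' : 1 <= t by exact: le_trans tt.
rewrite -(ler_pM2r tp) -mulrA mulrC -/(t `^ p).
have : t `^ p * t * F t <= C' * t + `|Y t1|.
  have := le_trans Yt (ler_norm (Y t1)); rewrite {1}/Y pw.
  by move: (`|Y t1|) (t `^ p) (F t) => *; lra.
have : `|Y t1| <= `|Y t1| * t by rewrite ler_peMr.
by move: (`|Y t1|) (t `^ p) (F t) => *; lra.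
Qed.

End Decay.

(** * Weights bounded by a power of the distance *)

Section PowerKernel.
Context (R : realType).
Local Notation leb := (@lebesgue_measure R).
Variables (psi : R -> R).
Hypothesis psi_ge0 : forall x, 0 <= psi x.
Hypothesis psi_noninc : forall r s, 0 < r -> r <= s -> psi s <= psi r.
Implicit Types x y b : R.

Let mpsi y : measurable_fun (`]0, y]%classic : set R) psi.
Proof.
apply: (measurable_funS _ _ (noninc_pos_measurable psi_noninc)) => //.
by move=> x /=; rewrite !in_itv/= => /andP[->].
Qed.

Let mpsic y : measurable_fun (`[0, y]%classic : set R) psi.
Proof.
apply/measurable_fun_itv_obnd_cbndP; exact: mpsi.
Qed.

Lemma integrable_of_bounded y M : (forall x, psi x <= M) ->
  leb.-integrable `[0, y] (EFin \o psi).
Proof.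
move=> pM; apply: (@le_integrable _ _ _ leb _ _ _ (cst M%:E)) => //.
- by apply/measurable_EFinP; exact: mpsic.
- move=> x _ /=; rewrite lee_fin ger0_norm// ger0_norm// (le_trans (psi_ge0 0))//.
- apply/integrableP; split; first exact: measurable_cst.
  under eq_integral do rewrite /=.
  rewrite integral_cst//= lebesgue_measure_itv/=.
  by case: ifP => _; rewrite ?mule0// -EFinM ltry.
Qed.

Variables (al B R1 : R).
Hypotheses (al0 : 0 < al) (al1 : al < 1) (B0 : 0 < B) (R10 : 0 < R1).
Hypothesis psi_le : forall x, 0 < x -> x <= R1 -> psi x <= B / x `^ al.

Let powint b y : 0 < b -> b < y ->
  (\int[leb]_(x in `[b, y]) (B / x `^ al)%:E =
   (B / (1 - al) * (y `^ (1 - al) - b `^ (1 - al)))%:E)%E.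
Proof.
move=> b0 by_; have al1' : 1 - al != 0 by rewrite gt_eqF// subr_gt0.
pose F x := B / (1 - al) * x `^ (1 - al).
have dF x : 0 < x -> is_derive x 1 F (B / x `^ al).
  move=> x0; have dp := is_derive1_powR (1 - al) x0.
  apply: is_derive_eq; rewrite /GRing.scale/= (_ : 1 - al - 1 = - al) ?powRN; last by ring.
  by field; rewrite al1' powR_eq0 gt_eqF.
have cF x : 0 < x -> {for x, continuous F}.
  move=> x0; apply: differentiable_continuous; apply/derivable1_diffP.
  by have [] := dF x x0.
have cg x : 0 < x -> {for x, continuous (fun z => B / z `^ al)}.
  move=> x0; apply: differentiable_continuous; apply/derivable1_diffP.
  have dp := is_derive1_powR (- al) x0.
  have D : is_derive x 1 (fun z => B * z `^ (- al)) (B * (- al * x `^ (- al - 1))).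
    by apply: is_derive_eq.
  rewrite (_ : (fun z => B / z `^ al) = fun z => B * z `^ (- al)).
    by have [] := D.
  by apply/funext => z; rewrite powRN.
rewrite (@continuous_FTC2 _ _ F) //.
- by rewrite -EFinB -mulrBr.
- apply: continuous_in_subspaceT => x; rewrite inE/= in_itv/= => /andP[bx _].
  by apply: cg; lra.
- split.
  + move=> x; rewrite in_itv/= => /andP[bx _].
    by have [] := dF x ltac:(lra).
  + apply: cvg_at_right_filter; exact: cF.
  + by apply: cvg_at_left_filter; apply: cF; lra.
- move=> x; rewrite in_itv/= => /andP[bx _].
  by have [_] := dF x ltac:(lra); rewrite derive1E.
Unshelve. all: by end_near. Qed.

(** The bound holds on [b, y] for every b > 0, where the power is continuous; monotone
    convergence lets b tend to 0. *)
Lemma power_kernel_integral_le y : 0 < y -> y <= R1 ->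
  (\int[leb]_(x in `]0%R, y]) (psi x)%:E <= (B / (1 - al) * y `^ (1 - al))%:E)%E.
Proof.
move=> y0 yR.
pose b n : R := y / n.+2%:R.
have b0 n : 0 < b n by rewrite divr_gt0.
have by_ n : b n < y by rewrite ltr_pdivrMr// ltr_pMr// ltr1n.
have mpsib n : measurable_fun (`[b n, y]%classic : set R) psi.
  apply: (measurable_funS _ _ (noninc_pos_measurable psi_noninc)) => //.
  move=> x /=; rewrite !in_itv/= andbT => /andP[bx _]; exact: lt_le_trans bx.
pose g n x := ((psi \_ `[b n, y]) x)%:E.
have mg n : measurable_fun (`]0, y]%classic : set R) (g n).
  apply/measurable_EFinP; apply: measurable_funTS; apply/(measurable_restrictT _ _).1 => //.
have g0 n x : (`]0, y]%classic : set R) x -> (0 <= g n x)%E.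
  by move=> _; rewrite lee_fin patchE; case: ifP.
have ndg x : (`]0, y]%classic : set R) x ->
    {homo g^~ x : n m / (n <= m)%N >-> (n <= m)%E}.
  move=> _ n n' nn; rewrite lee_fin !patchE.
  case: ifPn => [|_]; last by case: ifP.
  rewrite inE/= in_itv/= => /andP[bx xy]; rewrite mem_set//= in_itv/= xy andbT.
  rewrite (le_trans _ bx)// ler_pM2l// lef_pV2 ?posrE//.
  by rewrite ler_nat !ltnS.
have := cvg_monotone_convergence (mu := leb) _ mg g0 ndg.
move=> /(_ _)/cvg_lim => H.
have -> : (\int[leb]_(x in `]0%R, y]) (psi x)%:E =
   \int[leb]_(x in `]0%R, y]) limn (g^~ x))%E.
  apply: eq_integral => x; rewrite inE/= in_itv/= => /andP[x0 xy].
  apply/esym/cvg_lim => //; apply: cvg_near_cst.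
  exists (Num.bound (y / x)) => // n /= nb.
  rewrite /g patchE mem_set//= in_itv/= xy andbT ler_pdivrMr//.
  rewrite mulrC -ler_pdivrMr// (le_trans (ltW (archi_boundP _)))//.
    by rewrite divr_ge0// ltW.
  by rewrite ler_nat (leq_trans nb)// -addn2 leq_addr.
rewrite -H//; apply: lime_le.
  apply: ereal_nondecreasing_is_cvgn => n n' nn; apply: ge0_le_integral => //.
  - by move=> x xy; exact: g0.
  - exact: mg.
  - exact: mg.
  - by move=> x xy; exact: ndg.
apply: nearW => n.
rewrite (_ : (\int[leb]_(x in `]0%R, y]) g n x = \int[leb]_(x in `[b n, y]) (psi x)%:E)%E); last first.
  rewrite integral_mkcond [RHS]integral_mkcond; apply: eq_integral => x _.
  rewrite /g !patchE; case: ifPn => [|]; rewrite ?inE/= ?in_itv/=.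
    by move=> /andP[x0 xy]; case: ifP.
  move=> nx; case: ifPn => //; rewrite inE/= in_itv/= => /andP[bx xy]; exfalso.
  by move/negP: nx; apply; rewrite inE/= in_itv/= xy andbT; exact: lt_le_trans bx.
apply: (@le_trans _ _ (\int[leb]_(x in `[b n, y]) (B / x `^ al)%:E)%E).
  apply: ge0_le_integral => //=.
  - by move=> x _; rewrite lee_fin.
  - by apply/measurable_EFinP; exact: mpsib.
  - apply/measurable_EFinP; apply: measurable_funTS; apply: measurable_funM => //.
    by under eq_fun do rewrite -powRN; exact: measurable_powR.
  - move=> x; rewrite in_itv/= => /andP[bx xy]; rewrite lee_fin.
    by apply: psi_le; [exact: (lt_le_trans (b0 n))|exact: (le_trans xy)].
rewrite powint// lee_fin ler_pM2l ?divr_gt0 ?subr_gt0//.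
by rewrite gerBl powR_ge0.
Qed.

Lemma power_kernel_integrable y : leb.-integrable `[0, y] (EFin \o psi).
Proof.
have iR : leb.-integrable `[0, R1] (EFin \o psi).
  apply/integrableP; split; first by apply/measurable_EFinP; exact: mpsic.
  under eq_integral do rewrite /= ger0_norm//.
  rewrite -integral_itv_obnd_cbnd; last by apply/measurable_EFinP; exact: mpsi.
  by rewrite (le_lt_trans (power_kernel_integral_le R10 (lexx _)))// ltry.
apply: (@le_integrable _ _ _ leb _ _ _ (fun x => ((psi \_ `[0, R1]) x + psi R1)%:E)) => //.
- by apply/measurable_EFinP; exact: mpsic.
- move=> x /=; rewrite in_itv/= => /andP[x0 xy]; rewrite lee_fin patchE.
  case: ifPn => [_|]; first by rewrite !ger0_norm ?addr_ge0// lerDl.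
  rewrite notin_setE/= in_itv/= x0/= => /negP; rewrite -ltNge => Rx.
  by rewrite add0r !ger0_norm//; apply: psi_noninc => //; exact: ltW.
- apply: (@integrableD _ _ _ leb _ _ (EFin \o (psi \_ `[0, R1])) (cst (psi R1)%:E)) => //.
    apply: (@integrableS _ _ _ leb setT) => //.
    by rewrite -restrict_EFin -integrable_mkcond.
  apply/integrableP; split; first exact: measurable_cst.
  under eq_integral do rewrite /=.
  rewrite integral_cst//= lebesgue_measure_itv/=.
  by case: ifP => _; rewrite ?mule0// -EFinM ltry.
Qed.

Lemma power_kernel_prim_half_le y : 0 < y -> y <= R1 ->
  prim_half psi y <= B / (1 - al) * y `^ (1 - al).
Proof.
move=> y0 yR; rewrite /prim_half /Rintegral -lee_fin fineK.
  rewrite -integral_itv_obnd_cbnd; last by apply/measurable_EFinP; exact: mpsi.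
  exact: power_kernel_integral_le.
by apply: integrable_fin_num => //; exact: power_kernel_integrable.
Qed.

(** Cut at th = s^(1/al): then psi th <= B / s and the integral of psi up to th is of order
    th^(1 - al), whose square divided by B / s is a multiple of th^(2 - al) = s^(2/al - 1). *)
Lemma power_kernel_modulus : comm_kernel psi ->
  exists K0 s0 : R, [/\ 0 < K0, 0 < s0 & forall s, 0 < s -> s <= s0 ->
    exists e M : R, [/\ 0 <= e, 0 < M, affine_modulus (prim psi) e M,
      M <= K0 / s & e ^+ 2 / M <= K0 * s `^ (2 / al - 1)]].
Proof.
move=> kp; have al1' : 0 < 1 - al by rewrite subr_gt0.
have K0 : 0 < 4 * B / (1 - al) ^+ 2 by rewrite divr_gt0 ?mulr_gt0// exprn_gt0.
exists (4 * B / (1 - al) ^+ 2), (R1 `^ al); split => //; first exact: powR_gt0.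
move=> s s0 sR.
have [th thE] : exists th, th = s `^ al^-1 by exists (s `^ al^-1).
have th0 : 0 < th by rewrite thE powR_gt0.
have thal : th `^ al = s by rewrite thE -powRrM mulVf ?gt_eqF// powRr1// ltW.
have thR : th <= R1.
  have -> : R1 = (R1 `^ al) `^ al^-1 by rewrite -powRrM mulfV ?gt_eqF// powRr1// ltW.
  by rewrite thE; apply: ge0_ler_powR => //; rewrite ?nnegrE ?powR_ge0 ?invr_ge0// ltW.
exists (2 * (B / (1 - al) * th `^ (1 - al))), (B / s); split.
- by rewrite mulr_ge0// mulr_ge0 ?powR_ge0// divr_ge0// ltW.
- by rewrite divr_gt0.
- move=> b c bc; rewrite (le_trans (prim_modulus kp th0 bc))// lerD//.
    by rewrite ler_pM2l// power_kernel_prim_half_le.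
  by rewrite ler_wpM2r ?subr_ge0// -thal psi_le.
- rewrite ler_pM2r ?invr_gt0// ler_pdivlMr ?exprn_gt0//.
  rewrite [leRHS]mulrC ler_pM2l//; apply: (@le_trans _ _ 1); last by rewrite ler1n.
  by rewrite expr_le1// ?ltW// gtrBl.
- have e1 : s `^ (2 / al - 1) = (th `^ (1 - al)) ^+ 2 * s.
    rewrite -powR_mulrn ?powR_ge0// -powRrM -[in RHS]thal -powRD ?(gt_eqF th0) ?implybT//.
    by rewrite thE -powRrM; congr (_ `^ _); field; rewrite gt_eqF.
  rewrite e1; move: (th `^ (1 - al)) => z.
  have -> // : (2 * (B / (1 - al) * z)) ^+ 2 / (B / s) =
    4 * B / (1 - al) ^+ 2 * (z ^+ 2 * s).
  by field; rewrite !gt_eqF.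
Qed.

End PowerKernel.

(** * Measures with a density *)

Section Density.
Context (R : realType).
Local Notation leb := (@lebesgue_measure R).
Local Notation Rm := (measurableTypeR R).
Implicit Types (r f g : R -> R).

(** The proof is an argument so that the measure can be declared a probability. *)
Definition dens_prob r (pr : prob_density r) : set Rm -> \bar R := dens r.

Section DensProb.
Variables (r : R -> R) (pr : prob_density r).

Let mr : measurable_fun [set: Rm] r. Proof. by case: pr. Qed.
Let r0 x : 0 <= r x. Proof. by case: pr. Qed.
Let r1 : dens r setT = 1%E. Proof. by case: pr. Qed.

Lemma dens_integrable : leb.-integrable setT (EFin \o r).
Proof.
apply/integrableP; split; first exact/measurable_EFinP.
under eq_integral do rewrite /= ger0_norm//.
by move: r1; rewrite /dens => ->; rewrite ltry.
Qed.

Let dens0 : dens_prob pr set0 = 0%E.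
Proof. by rewrite /dens_prob /dens integral_set0. Qed.

Let dens_ge0 A : (0 <= dens_prob pr A)%E.
Proof. by apply: integral_ge0 => x _; rewrite lee_fin. Qed.

Let dens_sigma_additive : semi_sigma_additive (dens_prob pr).
Proof.
move=> /= A mA tA mUA; rewrite /dens_prob /dens integral_bigcup//=; last first.
  by apply: (integrableS _ _ (@subsetT _ _)) => //; exact: dens_integrable.
apply: is_cvg_ereal_nneg_natsum_cond => n _ _.
by apply: integral_ge0 => /= x _; rewrite lee_fin.
Qed.

HB.instance Definition _ := isMeasure.Build _ _ _
  (dens_prob pr) dens0 dens_ge0 dens_sigma_additive.

HB.instance Definition _ := @Measure_isProbability.Build _ _ R (dens_prob pr) r1.

Lemma dens_prob_dominates : dens_prob pr `<< leb.
Proof.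
apply/null_content_dominatesP => A mA A0; rewrite /dens_prob /dens.
by apply: null_set_integral => //; apply: measurable_funTS; exact/measurable_EFinP.
Qed.

Let nik := Radon_Nikodym_SigmaFinite.f (dens_prob pr) leb.

Let nikE : ae_eq leb setT nik (EFin \o r).
Proof.
apply: integral_ae_eq => //.
- exact: Radon_Nikodym_SigmaFinite.f_integrable dens_prob_dominates.
- exact/measurable_EFinP.
- by move=> E _ mE; rewrite -Radon_Nikodym_SigmaFinite.f_integral//; exact: dens_prob_dominates.
Qed.

(** The density agrees almost everywhere with the Radon-Nikodym derivative, for which the
    change of variables is known. *)
Lemma ge0_integral_dens g : measurable_fun [set: Rm] g -> (forall x, 0 <= g x) ->
  (\int[leb]_x (g x * r x)%:E = \int[dens_prob pr]_x (g x)%:E)%E.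
Proof.
move=> mg g0.
rewrite -(Radon_Nikodym_SigmaFinite.change_of_variables dens_prob_dominates)//; last first.
  exact/measurable_EFinP.
have mn : measurable_fun setT nik.
  apply: measurable_int; exact: Radon_Nikodym_SigmaFinite.f_integrable dens_prob_dominates.
apply: ae_eq_integral => //.
- by apply/measurable_EFinP; exact: measurable_funM.
- by apply: emeasurable_funM => //; exact/measurable_EFinP.
by apply: filterS nikE => x /= H _; rewrite EFinM -(H I).
Qed.

Lemma integral_dens g : measurable_fun [set: Rm] g ->
  (\int[leb]_x (g x * r x)%:E = \int[dens_prob pr]_x (g x)%:E)%E.
Proof.
move=> mg; rewrite integralE [RHS]integralE; congr (_ - _)%E.
- transitivity (\int[leb]_x (Num.max (g x) 0 * r x)%:E)%E.
    apply: eq_integral => x _; rewrite funeposE -EFin_max maxr_pMl//.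
    by rewrite mul0r.
  rewrite ge0_integral_dens//; last by move=> x; rewrite le_max lexx orbT.
    by apply: eq_integral => x _; rewrite funeposE -EFin_max.
  exact: measurable_maxr.
- transitivity (\int[leb]_x (Num.max (- g x) 0 * r x)%:E)%E.
    apply: eq_integral => x _; rewrite funenegE -EFinN -EFin_max maxr_pMl//.
    by rewrite mul0r mulNr.
  rewrite ge0_integral_dens//; last by move=> x; rewrite le_max lexx orbT.
    by apply: eq_integral => x _; rewrite funenegE -EFinN -EFin_max.
  by apply: measurable_maxr => //; exact: measurableT_comp.
Qed.

Section Image.
Context d (T : measurableType d) (mu : probability T R).
Variable phi : T -> Rm.
Hypothesis mphi : measurable_fun [set: T] phi.
Hypothesis law : forall A : set Rm, measurable A -> dens r A = mu (phi @^-1` A).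

Let phiM : {mfun T >-> Rm} :=
  MeasurableFun.Pack (MeasurableFun.Class (isMeasurableFun.Build _ _ _ _ _ mphi)).

Lemma ge0_integral_dens_image g : measurable_fun [set: Rm] g -> (forall x, 0 <= g x) ->
  (\int[leb]_x (g x * r x)%:E = \int[mu]_x (g (phi x))%:E)%E.
Proof.
move=> mg g0; rewrite ge0_integral_dens//.
rewrite (eq_measure_integral (distribution mu phiM)); last by move=> A mA _; exact: law.
by rewrite ge0_integral_distribution//; exact/measurable_EFinP.
Qed.

(** An Eulerian integral as an integral over labels. *)
Lemma integral_dens_image g : measurable_fun [set: Rm] g -> bdm (g \o phi) ->
  \int[leb]_x (g x * r x) = \int[mu]_x g (phi x).
Proof.
move=> mg bg; rewrite /Rintegral integral_dens//; congr (fine _).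
rewrite (eq_measure_integral (distribution mu phiM)); last by move=> A mA _; exact: law.
rewrite integral_distribution//; first exact/measurable_EFinP.
exact: (bdm_integrable mu bg).
Qed.

End Image.
End DensProb.
End Density.

(** * The mass to the left of a label *)

Section Labels.
Context (R : realType) d (T : measurableType d) (mu : probability T R).
Local Notation leb := (@lebesgue_measure R).
Local Notation Rm := (measurableTypeR R).
Variables (r : R -> R) (l : T -> Rm) (M a b : R).
Hypothesis pr : prob_density r.
Hypothesis ml : measurable_fun [set: T] l.
Hypothesis law : forall A : set Rm, measurable A -> dens r A = mu (l @^-1` A).
Hypothesis rM : forall x, r x <= M.
Hypothesis rout : forall x, x <= a \/ b <= x -> r x = 0.
Implicit Types c z : R.

(** The distribution function of the label. *)
Definition mass_below z : R := fine (mu (l @^-1` `]-oo, z])).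
Local Notation F := mass_below.
Local Notation m := (fun x => F (l x)).

Let mpre (A : set Rm) : measurable A -> measurable (l @^-1` A).
Proof. by move=> mA; rewrite -[X in measurable X]setTI; exact: ml. Qed.

Lemma mass_belowE z : mu (l @^-1` `]-oo, z]) = (F z)%:E.
Proof. by rewrite fineK// fin_num_measure//; exact: mpre. Qed.

Lemma mass_below_nd : {homo F : x y / x <= y}.
Proof.
move=> x y xy; rewrite -lee_fin -!mass_belowE; apply: le_measure; rewrite ?inE; try exact: mpre.
by apply: preimage_subset; apply: subset_itvl; rewrite bnd_simp.
Qed.

Lemma mass_below01 z : 0 <= F z <= 1.
Proof.
rewrite fine_ge0//= -lee_fin -mass_belowE; apply: probability_le1; exact: mpre.
Qed.

Lemma mass_below_lip x y : x <= y -> F y - F x <= M * (y - x).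
Proof.
move=> xy; rewrite lerBlDl -lee_fin EFinD -!mass_belowE -!law//.
have -> : `]-oo, y]%classic = `]-oo, x] `|` `]x, y] :> set R.
  by rewrite -itv_bndbnd_setU ?bnd_simp.
rewrite -/(dens_prob pr) measureU//; last first.
  rewrite -subset0 => z /=; rewrite !in_itv/= => -[zx /andP[xz _]].
  by move: xz; rewrite ltNge zx.
apply: leeD => //; apply: (@le_trans _ _ (\int[leb]_(z in `]x, y]) M%:E)%E).
  apply: ge0_le_integral => //=.
  - by move=> z _; rewrite lee_fin; case: pr.
  - by apply: measurable_funTS; apply/measurable_EFinP; case: pr.
  - by move=> z _; rewrite lee_fin.
rewrite integral_cst//= lebesgue_measure_itv/= lte_fin.
move: xy; rewrite le_eqVlt => /predU1P[->|->]; first by rewrite ltxx mule0 subrr mulr0.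
by rewrite -EFinB -EFinM.
Qed.

Lemma mass_below_cont : continuous F.
Proof.
have M0 : 0 <= M by apply: le_trans (rM 0); case: pr.
have Flip x y : `|F x - F y| <= M * `|x - y|.
  wlog xy : x y / y <= x => [H|].
    by have [/H//|/ltW/H] := leP y x; rewrite distrC (distrC y).
  by rewrite !ger0_norm ?subr_ge0 ?mass_below_nd// mass_below_lip.
move=> x; apply/cvgrPdist_le => /= e e0.
have eM : 0 < e / (M + 1) by rewrite divr_gt0// ltr_wpDl.
have : y @[y --> x] --> x by exact: cvg_id.
move/cvgrPdist_le => /(_ _ eM); apply: filterS => y xy; rewrite (le_trans (Flip _ _))//.
apply: (@le_trans _ _ ((M + 1) * `|x - y|)); first by rewrite ler_wpM2r// lerDl.
by rewrite mulrC -ler_pdivlMr// ltr_wpDl.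
Qed.

Let Fa : F a = 0.
Proof.
rewrite /mass_below -law// /dens integral0_eq// => x/=; rewrite in_itv/= => xa.
by rewrite rout//; left.
Qed.

Let Fb : F b = 1.
Proof.
apply: (@EFin_inj R); rewrite -mass_belowE -law//; case: pr => _ _ <-.
rewrite /dens integral_mkcond; apply: eq_integral => x _; rewrite patchE.
case: ifPn => //; rewrite notin_setE/= in_itv/= => /negP; rewrite -ltNge => bx.
by rewrite rout//; right; exact: ltW.
Qed.

Lemma mass_below_surj c : 0 <= c <= 1 -> exists z, F z = c.
Proof.
move=> c01; have ab : a <= b.
  have [//|ba] := leP a b; have := mass_below_nd (ltW ba).
  by rewrite Fa Fb ler10.
have [] := @IVT R F a b c ab _ _; last by move=> z _ <-; exists z.
  by apply: continuous_subspaceT => x; exact: mass_below_cont.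
by rewrite Fa Fb (min_idPl _) ?(max_idPr _).
Qed.

Lemma mass_label_measurable : measurable_fun [set: T] m.
Proof.
apply: measurableT_comp ml; apply: nondecreasing_measurable => // x y.
exact: mass_below_nd.
Qed.

Let mpre_m (A : set R) : measurable A -> measurable (m @^-1` A).
Proof. by move=> mA; rewrite -[X in measurable X]setTI; exact: mass_label_measurable. Qed.

Let mle c : measurable [set x | m x <= c].
Proof.
rewrite (_ : [set x | _] = m @^-1` `]-oo, c]); first exact: mpre_m.
by apply/seteqP; split => x /=; rewrite in_itv.
Qed.

Let mlt c : measurable [set x | m x < c].
Proof.
rewrite (_ : [set x | _] = m @^-1` `]-oo, c[); first exact: mpre_m.
by apply/seteqP; split => x /=; rewrite in_itv.
Qed.

(** A continuous distribution function maps its own law to the uniform law: by the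
    intermediate value theorem, the set where m <= c lies between half-lines of mass c
    and c + eps. *)
Lemma mass_label_le c : 0 <= c <= 1 -> mu [set x | m x <= c] = c%:E.
Proof.
move=> /andP[c0]; rewrite le_eqVlt => /predU1P[->|c1].
  rewrite (_ : [set x | _] = setT) ?probability_setT//; apply/seteqP; split => // x _ /=.
  by case/andP: (mass_below01 (l x)).
apply/eqP; rewrite eq_le; apply/andP; split; last first.
  have [z zc] : exists z, F z = c by apply: mass_below_surj; rewrite c0 ltW.
  rewrite -zc -mass_belowE; apply: le_measure; rewrite ?inE//; first exact: mpre.
  by move=> x /=; rewrite in_itv/= => lz; rewrite zc -zc mass_below_nd.
apply/lee_addgt0Pr => e e0.
wlog ec : e e0 / c + e <= 1 => [H|].
  have [/H ->//|ce] := leP (c + e) 1; apply: (@le_trans _ _ 1%E); first exact: probability_le1.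
  by rewrite -EFinD lee_fin ltW.
have [z zc] : exists z, F z = c + e.
  by apply: mass_below_surj; rewrite ec andbT addr_ge0// ltW.
rewrite -EFinD -zc -mass_belowE; apply: le_measure; rewrite ?inE//; first exact: mpre.
move=> x /= mx; rewrite in_itv/= leNgt; apply/negP => zx.
by have := mass_below_nd (ltW zx); rewrite zc leNgt (le_lt_trans mx)// ltrDl.
Qed.

Lemma mass_label_lt c : 0 <= c <= 1 -> mu [set x | m x < c] = c%:E.
Proof.
move=> /andP[c0 c1]; apply/eqP; rewrite eq_le; apply/andP; split.
  rewrite -mass_label_le ?c0//; apply: le_measure; rewrite ?inE// => x /=.
  exact: ltW.
apply/lee_subgt0Pr => e e0.
have [ec|ce] := leP e c; last first.
  by apply: (@le_trans _ _ 0%E) => //; rewrite -EFinB lee_fin subr_le0 ltW.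
rewrite -EFinB -mass_label_le; last by rewrite subr_ge0 ec/= (le_trans _ c1)// gerBl ltW.
apply: le_measure; rewrite ?inE// => x /= mx.
by rewrite (le_lt_trans mx)// ltrBlDr ltrDl.
Qed.

Lemma prob_bool (P : T -> bool) : measurable_fun setT P ->
  \int[mu]_x (P x)%:R = fine (mu [set x | P x]) :> R.
Proof.
move=> mP; have mPs : measurable [set x | P x].
  rewrite -[X in measurable X]setTI (_ : [set x | P x] = P @^-1` [set true]).
    exact: mP.
  by apply/seteqP; split => x /=.
rewrite /Rintegral; congr fine; rewrite -[in RHS](setIT [set x | P x]) -integral_indic//.
by apply: eq_integral => x _; rewrite indicE; congr ((nat_of_bool _)%:R%:E);
  apply/idP/idP; rewrite inE.
Qed.

Let bdm_lel z : bdm (fun y => ((l y : R) <= z)%R%:R : R).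
Proof. by apply: bdm_bool; apply: measurable_fun_ler. Qed.

Let bdm_gel z : bdm (fun y => (z <= l y)%R%:R : R).
Proof. by apply: bdm_bool; apply: measurable_fun_ler. Qed.

Lemma prob_label_le z : \int[mu]_y ((l y : R) <= z)%R%:R = F z.
Proof.
rewrite prob_bool; last exact: measurable_fun_ler.
by rewrite /mass_below; congr (fine (mu _)); apply/seteqP; split => y /=; rewrite in_itv.
Qed.

(** The label has no atoms. *)
Lemma prob_label_ge z : \int[mu]_y (z <= l y)%R%:R = 1 - F z.
Proof.
apply/eqP; rewrite eq_sym subr_eq eq_sym -prob_label_le -probD//.
rewrite -[eqbRHS](prob_cst mu); apply/eqP; apply: prob_ae_eq.
- exact: bdmD.
- exact: bdm_cst.
- exists (l @^-1` [set z]); split.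
  + exact: mpre.
  + rewrite -law// /dens; apply: null_set_integral => //.
      by apply: measurable_funTS; apply/measurable_EFinP; case: pr.
    exact: lebesgue_measure_set1.
  + by move=> y /=; have [yz|zy|//] := ltgtP (l y) z; rewrite ?addr0 ?add0r eqxx.
Qed.

Lemma prob_label_sg z : \int[mu]_y Num.sg (z - l y) = 2 * F z - 1.
Proof.
have sgE y : Num.sg (z - l y) = ((l y : R) <= z)%R%:R - (z <= l y)%R%:R.
  have [yz|zy|->] := ltgtP (l y) z.
  - by rewrite subr0 gtr0_sg// subr_gt0.
  - by rewrite sub0r ltr0_sg// subr_lt0.
  - by rewrite !subrr sgr0.
rewrite (@eq_prob _ _ _ mu _ _ sgE) probB// prob_label_le prob_label_ge; ring.
Qed.

Let mle_fun c : measurable_fun setT (fun x => m x <= c).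
Proof. by apply: measurable_fun_ler => //; exact: mass_label_measurable. Qed.

Let mlt_fun c : measurable_fun setT (fun x => m x < c).
Proof. by apply: measurable_fun_ltr => //; exact: mass_label_measurable. Qed.

(** By symmetry in x and y, the probabilities of l y <= l x and of l x <= l y agree, and
    they add up to 1. *)
Lemma prob_mass_label_mean : \int[mu]_x m x = 2^-1.
Proof.
have b2 : @bdm2 d T R (fun x y => ((l y : R) <= l x)%R%:R).
  by apply: bdm_bool; apply: measurable_fun_ler; apply: measurableT_comp.
have b2' := bdm2_swap b2.
have e1 : \int[mu]_x m x = \int[mu]_x \int[mu]_y ((l y : R) <= l x)%R%:R.
  by apply: eq_prob => x; rewrite prob_label_le.
have e2 : \int[mu]_x m x + \int[mu]_x m x = 1.
  rewrite {1}e1 (prob_swap mu b2) e1 -probD; [|exact: bdm2_int mu _ b2'|exact: bdm2_int mu _ b2].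
  rewrite -[RHS](prob_cst mu); apply: eq_prob => x.
  by rewrite prob_label_ge prob_label_le subrK.
by move: e2; lra.
Qed.

Lemma prob_mass_label_near c s : 0 <= c <= 1 -> 0 <= s <= 2^-1 ->
  s <= \int[mu]_x (`|m x - c| <= s)%R%:R.
Proof.
move=> c01 s01.
have [c1 [c2 [c1s c2s c12 cc1 cc2]]] : exists c1 c2 : R,
    [/\ 0 <= c1 <= 1, 0 <= c2 <= 1, c2 - c1 = s, c - s <= c1 & c2 <= c + s].
  have [ch|ch] := leP c 2^-1.
    by exists c, (c + s); split; lra.
  by exists (c - s), c; split; lra.
have e1 : \int[mu]_x (m x <= c2)%R%:R = c2.
  by rewrite prob_bool// mass_label_le.
have e2 : \int[mu]_x (m x < c1)%R%:R = c1.
  by rewrite prob_bool// mass_label_lt.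
rewrite -{1}c12 -{1}e1 -{1}e2 -probB; try by apply: bdm_bool.
apply: prob_le.
- by apply: bdmB; apply: bdm_bool.
- apply: bdm_bool; apply: measurable_fun_ler => //; apply: measurableT_comp => //.
  by apply: measurable_funB => //; exact: mass_label_measurable.
move=> x; rewrite ler_norml.
have [mx2|_] := leP (m x) c2; have [_|mx1] := ltP (m x) c1.
- by rewrite subrr ler0n.
- by rewrite subr0 ler_nat lt0b; apply/andP; split; lra.
- by rewrite sub0r (le_trans _ (ler0n _ _))// lerN10.
- by rewrite subr0 ler0n.
Qed.

Lemma dens_uniform c (A : set Rm) : measurable A ->
  dens (fun x => 2^-1 * \1_`[c - 1, c + 1] x) A = ((2^-1)%:E * leb (`[(c - 1)%R, (c + 1)%R] `&` A))%E.
Proof.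
move=> mA; rewrite /dens.
under eq_integral do rewrite EFinM.
rewrite ge0_integralZl//.
- by rewrite integral_indic.
- by apply: measurable_funTS; apply/measurable_EFinP; exact: measurable_indic.
Qed.

Lemma uniform_density c : prob_density (fun x => 2^-1 * \1_`[c - 1, c + 1] x).
Proof.
split.
- by apply: measurable_funM => //; exact: measurable_indic.
- by move=> x; rewrite mulr_ge0 ?invr_ge0.
- rewrite dens_uniform// setIT lebesgue_measure_itv/= lte_fin ltrD2l gtrN//.
  by rewrite -EFinB -EFinM; congr (_%:E); field.
Qed.

(** Both sides are probabilities in A that agree on half-lines. *)
Lemma mass_label_law c (A : set Rm) : measurable A ->
  dens (fun x => 2^-1 * \1_`[c - 1, c + 1] x) A = mu ((fun x => c + (2 * m x - 1)) @^-1` A).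
Proof.
have mp : measurable_fun [set: T] (fun x => (c + (2 * m x - 1) : Rm)).
  apply: measurable_funD => //; apply: measurable_funB => //.
  by apply: measurable_funM => //; exact: mass_label_measurable.
pose pM : {mfun T >-> Rm} :=
  MeasurableFun.Pack (MeasurableFun.Class (isMeasurableFun.Build _ _ _ _ _ mp)).
move=> mA; rewrite -[LHS]/(dens_prob (uniform_density c) A) -[RHS]/(distribution mu pM A).
apply: (@measure_unique _ R Rm (@RGenInftyO.G R) (fun n => `]-oo, n%:R[%classic) _ _ _ _
  (dens_prob (uniform_density c)) (distribution mu pM)) => //.
- exact: RGenInftyO.measurableE.
- move=> _ _ [x ->] [y ->]; exists (Num.min x y).
  by apply/seteqP; split => z /=; rewrite !in_itv/= lt_min; [move=> [-> ->]|move=> /andP].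
- by move=> n; exists n%:R.
- apply/seteqP; split => // x _; exists (Num.truncn x).+1 => //=.
  by rewrite in_itv/= truncnS_gt.
- move=> _ [z ->].
  rewrite /= /dens_prob dens_uniform// /distribution /pushforward.
  have -> : pM @^-1` `]-oo, z[ = [set x | m x < (z - c + 1) / 2].
    by apply/seteqP; split => x /=; rewrite in_itv/= ltr_pdivlMr//; lra.
  have [zl|zl] := leP z (c - 1).
    rewrite (_ : _ `&` _ = set0); last first.
      rewrite -subset0 => x /=; rewrite !in_itv/= => -[/andP[cx _] xz]; lra.
    rewrite (_ : [set x | m x < _] = set0) ?measure0 ?mule0// -subset0 => x /=.
    by have := mass_below01 (l x); lra.
  have [zr|zr] := ltP (c + 1) z.
    rewrite (_ : [set x | m x < _] = setT) ?probability_setT; last first.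
      by apply/seteqP; split => // x _ /=; have := mass_below01 (l x); lra.
    case: (uniform_density c) => _ _ <-.
    rewrite dens_uniform// setIT; congr (_ * leb _)%E; apply/seteqP; split => x /=; first by case.
    by rewrite !in_itv/= => /andP[h1 h2]; split; rewrite ?h1//; lra.
  rewrite mass_label_lt; last by lra.
  rewrite (_ : _ `&` _ = `[c - 1, z[%classic); last first.
    apply/seteqP; split => x /=; rewrite !in_itv/=; first by move=> [/andP[-> _] ->].
    by move=> /andP[-> xz]; split => //=; lra.
  rewrite lebesgue_measure_itv/= lte_fin zl -EFinB -EFinM; congr (_%:E).
  by rewrite mulrC; congr (_ / _); ring.
- move=> n; apply: le_lt_trans (ltry 1); exact: probability_le1.
Qed.

End Labels.

(** * Functions of class C^1 in time and space *)

Section ClassicalCalculus.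
Context (R : realType).
Implicit Types (t x s S C e : R) (f : R -> R -> R).

Lemma is_derive_eps (p : R -> R) (A t : R) :
  (forall e, 0 < e -> \forall s \near t, `|p s - p t - A * (s - t)| <= e * `|s - t|) ->
  is_derive t 1 p A.
Proof.
move=> pe.
suff H : h^-1 *: (p (h *: 1 + t) - p t) @[h --> 0^'] --> A.
  apply: DeriveDef; first by apply/cvg_ex; exists A.
  by rewrite /derive/=; apply/cvg_lim => //; exact: Rhausdorff.
apply/cvgrPdist_le => /= e e0.
have /nbhs_ballP[r /= r0 rP] := pe _ e0.
exists r => //= h; rewrite /ball_/= sub0r normrN => hr h0.
have -> : h *: 1 + t = h + t :> R by rewrite [h *: 1]mulr1.
have /rP : ball t r (h + t) by rewrite /ball/= opprD addrCA subrr addr0 normrN.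
rewrite addrK => H; rewrite distrC.
have -> : h^-1 *: (p (h + t) - p t) - A = h^-1 * (p (h + t) - p t - A * h).
  by rewrite mulrBr mulrCA mulVf// mulr1.
by rewrite normrM normfV mulrC ler_pdivrMr ?normr_gt0.
Qed.

Lemma derive1_val (p : R -> R) (A t : R) : is_derive t 1 p A -> derive1 p t = A.
Proof. by move=> D; rewrite derive1E derive_val. Qed.

Lemma box_bounded (F : R * R -> R) (a b c d : R) :
  {within `[a, b] `*` `[c, d], continuous F} ->
  exists2 K : R, 0 <= K &
    forall t x, a <= t -> t <= b -> c <= x -> x <= d -> `|F (t, x)| <= K.
Proof.
move=> cF; have cK := compact_setX (@segment_compact R a b) (@segment_compact R c d).
have [M [_ HM]] := compact_bounded (continuous_compact cF cK).
exists `|M + 1| => // t x at_ tb cx xd.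
apply: (HM `|M + 1|); first by rewrite (lt_le_trans _ (ler_norm _))// ltrDl.
by exists (t, x) => //; split; rewrite /= in_itv/= ?at_ ?cx.
Qed.

Section Regular.
Variable f : R -> R -> R.
Hypothesis cf : classical_regular f.

Local Notation ft t x := (derive1 (f^~ x) t).
Local Notation fx t x := (derive1 (f t) x).

Lemma classical_dt t x : 0 < t -> is_derive t 1 (f^~ x) (ft t x).
Proof. by move=> t0; have [h _ _ _] := cf.2 t x t0; rewrite derive1E; exact: derivableP. Qed.

Lemma classical_dx t x : 0 < t -> is_derive x 1 (f t) (fx t x).
Proof. by move=> t0; have [_ h _ _] := cf.2 t x t0; rewrite derive1E; exact: derivableP. Qed.

Let slice_continuous (F : R * R -> R) t :
  (forall z, {for (t, z), continuous F}) -> forall x, F (t, y) @[y --> x] --> F (t, x).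
Proof.
move=> cF z; apply: (@cvg_comp _ _ _ (fun z => (t, z)) F _ (nbhs (t, z))); last exact: cF.
exact: (cvg_pair (cvg_cst t) (@cvg_id _ (nbhs z))).
Qed.

Lemma classical_dt_continuous t : 0 < t -> continuous (fun x => ft t x).
Proof.
move=> t0 x.
have H y : {for (t, y), continuous (fun z => ft z.1 z.2)} by have [_ _ c1 c2] := cf.2 t y t0.
exact: (slice_continuous H).
Qed.

Lemma classical_dx_continuous t : 0 < t -> continuous (fun x => fx t x).
Proof.
move=> t0 x.
have H y : {for (t, y), continuous (fun z => fx z.1 z.2)} by have [_ _ c1 c2] := cf.2 t y t0.
exact: (slice_continuous H).
Qed.

Lemma classical_cvg I (G : set_system I) (s y : I -> R) t x : Filter G -> 0 <= t ->
  (\forall i \near G, 0 <= s i) -> s i @[i --> G] --> t -> y i @[i --> G] --> x ->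
  f (s i) (y i) @[i --> G] --> f t x.
Proof.
move=> FG t0 s0 cs cy.
have /subspace_continuousP/(_ (t, x) t0) cF := cf.1.
apply: (@cvg_comp _ _ _ (fun i => (s i, y i)) (fun z : R * R => f z.1 z.2) G _ _ _ cF).
move=> P /= wP; have cp : (s i, y i) @[i --> G] --> (t, x) by apply: (cvg_pair cs cy).
have := cp _ wP; apply: filter_app; near=> i => /=; apply.
by near: i.
Unshelve. all: by end_near. Qed.

Lemma classical_continuous t : 0 <= t -> continuous (f t).
Proof.
move=> t0 x; apply: classical_cvg => //; [exact: nearW|exact: cvg_cst].
Qed.

Lemma classical_bounded S C : exists2 K : R, 0 <= K &
  forall t x, 0 <= t -> t <= S -> `|x| <= C -> `|f t x| <= K.
Proof.
have [|K K0 HK] := @box_bounded (fun z => f z.1 z.2) 0 S (- C) C.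
  by apply: continuous_subspaceW cf.1 => -[t x] [/=]; rewrite in_itv/= => /andP[].
by exists K => // t x t0 tS; rewrite ler_norml => /andP[x1 x2]; apply: (HK t x).
Qed.

Lemma classical_partials_bounded r S C : 0 < r -> exists2 K : R, 0 <= K &
  forall t x, r <= t -> t <= S -> `|x| <= C -> `|ft t x| <= K /\ `|fx t x| <= K.
Proof.
move=> r0; have t0 t : t \in `[r, S] -> 0 < t.
  by rewrite in_itv/= => /andP[rt _]; exact: lt_le_trans rt.
have [|K K0 HK] := @box_bounded (fun z => ft z.1 z.2) r S (- C) C.
  apply: continuous_in_subspaceT => -[t x]; rewrite inE => -[/= /t0 tp _].
  by have [_ _ c1 c2] := cf.2 t x tp.
have [|K' K'0 HK'] := @box_bounded (fun z => fx z.1 z.2) r S (- C) C.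
  apply: continuous_in_subspaceT => -[t x]; rewrite inE => -[/= /t0 tp _].
  by have [_ _ c1 c2] := cf.2 t x tp.
exists (K + K'); first by rewrite addr_ge0.
move=> t x rt tS; rewrite ler_norml => /andP[x1 x2]; split.
  by rewrite (le_trans (HK t x _ _ _ _))// lerDl.
by rewrite (le_trans (HK' t x _ _ _ _))// lerDr.
Qed.

(** The increment of f along the curve splits into one in space at the fixed time t, for
    which the usual chain rule applies, and one in time at the moving point y s, for
    which the mean value theorem and the joint continuity of the time derivative do. *)
Lemma classical_chain (y : R -> R) (dy t : R) : 0 < t -> is_derive t 1 y dy ->
  is_derive t 1 (fun s => f s (y s)) (ft t (y t) + fx t (y t) * dy).
Proof.
move=> t0 Dy.
have D2 : is_derive t 1 (fun s => f t (y s)) (fx t (y t) * dy).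
  have Dx := classical_dx (y t) t0.
  exact: (@is_derive1_comp _ (f t) y t _ _ Dx Dy).
have D1 : is_derive t 1 (fun s => f s (y s) - f t (y s)) (ft t (y t)).
  apply: is_derive_eps => e e0; rewrite subrr.
  have [_ _ cft _] := cf.2 t (y t) t0.
  have cy : {for t, continuous y}.
    by apply: differentiable_continuous; apply/derivable1_diffP; have [] := Dy.
  have /cvgrPdist_le/(_ _ e0) := cft.
  rewrite near_simpl /= => /nbhs_ballP[d /= d0 dP].
  have t2 : 0 < Num.min d t by rewrite lt_min d0.
  have /cvgrPdist_lt/(_ _ d0) yd := cy.
  near=> s.
  have st : `|t - s| < Num.min d t by near: s; exact: nbhsx_ballx.
  have ys : `|y t - y s| < d by near: s.
  pose g x := f x (y s) - ft t (y t) * x.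
  rewrite subr0 (_ : _ - _ - _ = g s - g t); last by rewrite /g; ring.
  have hm : Num.min d t <= t by rewrite ge_min lexx orbT.
  have hm' : Num.min d t <= d by rewrite ge_min lexx.
  apply: (@lipschitz_of_derive_sym _ g (fun x => ft x (y s) - ft t (y t)) e
    (t - `|t - s|) (t + `|t - s|)).
  - by rewrite gerBl normr_ge0 lerDl normr_ge0.
  - by rewrite -ler_distlC.
  - move=> x x1 x2; have x0 : 0 < x by apply: lt_le_trans x1; lra.
    by have Dx := classical_dt (y s) x0; apply: is_derive_eq; rewrite /GRing.scale/=; ring.
  - move=> x x1 x2; rewrite distrC; apply: (dP (x, y s)); split => //=.
    rewrite /ball/=; apply: le_lt_trans (lt_le_trans st hm').
    by rewrite distrC ler_distl x1.
rewrite (_ : (fun s => f s (y s)) = (fun s => (f s (y s) - f t (y s)) + f t (y s))).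
  exact: is_deriveD.
by apply/funext => s; rewrite subrK.
Unshelve. all: by end_near. Qed.

End Regular.
End ClassicalCalculus.

(** * From a classical solution to the particle flow *)

Section Solution.
Context (R : realType).
Local Notation leb := (@lebesgue_measure R).
Local Notation Rm := (measurableTypeR R).
Variables (psi : R -> R) (rho u eta : R -> R -> R) (x0 : R).
Hypothesis kp : comm_kernel psi.
Hypotheses (crho : classical_regular rho) (cu : classical_regular u).
Hypothesis pr : forall t : R, 0 <= t -> prob_density (rho t).
Hypothesis eqs : forall t x : R, 0 < t ->
  continuity_eq rho u t x /\ momentum_eq psi rho u t x.
Hypothesis fc : forward_characteristics rho u (rho 0) eta.
Hypothesis cS : compact (supp (rho 0)).
Hypothesis x0P : 0 < rho 0 x0.
Implicit Types (t s : R) (x y z : R).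

Local Notation S0 := (supp (rho 0)).

Let rho_ge0 t x : 0 <= t -> 0 <= rho t x.
Proof. by move=> /pr[]. Qed.

Lemma pos_supp x : 0 < rho 0 x -> S0 x.
Proof.
move=> r0 U oU Ux; have cr := @classical_continuous _ _ crho 0 (lexx _) x.
have h2 : 0 < rho 0 x / 2 by rewrite divr_gt0.
have /cvgrPdist_lt/(_ _ h2)/nbhs_ballP[d /= d0 dP] := cr.
have /nbhs_ballP[e /= e0 eP] : nbhs x U by exact: open_nbhs_nbhs.
pose k := Num.min d e; have k0 : 0 < k by rewrite lt_min d0.
pose B : set Rm := `]x - k, x + k[%classic.
have Bk y : B y -> `|x - y| < k by rewrite /B/= in_itv/= ltr_distlC.
have mB : measurable B by exact: measurable_itv.
have mU : measurable (U : set Rm) by exact: open_measurable.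
apply: (@lt_le_trans _ _ (\int[leb]_(y in B) (rho 0 x / 2)%:E)%E).
  rewrite integral_cst//= /B lebesgue_measure_itv/= lte_fin ltrD2l gtrN//.
  by rewrite -EFinB -EFinM lte_fin mulr_gt0//; lra.
rewrite -/(dens_prob (pr (lexx 0))).
apply: (@le_trans _ _ (dens_prob (pr (lexx 0)) B)); last first.
  apply: le_measure; rewrite ?inE// => y /Bk ky; apply: eP.
  by apply: lt_le_trans ky _; rewrite ge_min lexx orbT.
apply: ge0_le_integral => //=.
- by move=> y _; rewrite lee_fin ltW.
- by apply: measurable_funTS; apply/measurable_EFinP; case: (pr (lexx 0)).
- move=> y /Bk ky; rewrite lee_fin; have : ball x d y.
    by apply: lt_le_trans ky _; rewrite ge_min lexx.
  by move=> /dP /=; rewrite ltr_distl => /andP[_ h3]; lra.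
Qed.

Lemma supp_out x : ~ S0 x -> rho 0 x = 0.
Proof.
move=> nS; apply/eqP; rewrite eq_le rho_ge0// andbT leNgt; apply/negP.
by move/pos_supp.
Qed.

Let eta0 x : S0 x -> eta 0 x = x. Proof. by move=> Sx; have [/(_ x Sx)[]] := fc. Qed.

Let eta_cont x : S0 x -> {within [set t : R | 0 <= t], continuous (eta^~ x)}.
Proof. by move=> Sx; have [/(_ x Sx)[]] := fc. Qed.

Let eta_cvg x t (I : Type) (G : set_system I) (s : I -> R) : Filter G -> S0 x -> 0 <= t ->
  (\forall i \near G, 0 <= s i) -> s i @[i --> G] --> t ->
  eta (s i) x @[i --> G] --> eta t x.
Proof.
move=> FG Sx t0 s0 cs; have /subspace_continuousP/(_ t t0) cF := eta_cont Sx.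
apply: (@cvg_comp _ _ _ s (eta^~ x) G _ _ _ cF).
move=> P /= wP; have := cs _ wP; apply: filter_app; near=> i => /=; apply.
by near: i.
Unshelve. all: by end_near. Qed.

(** Otherwise two characteristics would collide by the intermediate value theorem. *)
Lemma characteristics_lt t x y : 0 <= t -> S0 x -> S0 y -> x < y -> eta t x < eta t y.
Proof.
move=> t0 Sx Sy xy; rewrite ltNge; apply/negP => le_yx.
pose g s := eta s y - eta s x.
have cg : {within `[0, t], continuous g}.
  have sub : `[0, t] `<=` [set s : R | 0 <= s] by move=> s /=; rewrite in_itv/= => /andP[].
  have c1 := continuous_subspaceW sub (eta_cont Sx).
  have c2 := continuous_subspaceW sub (eta_cont Sy).
  by move=> s; apply: cvgB; [exact: c2|exact: c1].
have [] := @IVT R g 0 t 0 t0 cg _.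
  by rewrite /g !eta0// ge_min le_max !subr_le0 le_yx orbT/= subr_ge0 ltW.
move=> s; rewrite in_itv/= => /andP[s0 _] /eqP; rewrite subr_eq0 => /eqP es.
have [_ inj _] := fc.
by have := inj s s0 y x Sy Sx es; move: xy => /[swap] ->; rewrite ltxx.
Qed.

Lemma characteristics_le t x y : 0 <= t -> S0 x -> S0 y -> x <= y -> eta t x <= eta t y.
Proof.
move=> t0 Sx Sy; rewrite le_eqVlt => /predU1P[->//|xy].
by apply: ltW; exact: characteristics_lt.
Qed.

(** Along characteristics starting where the density is positive it stays positive, and the
    momentum equation can be divided by it. The remaining labels have measure 0 and
    are sent to x0. *)
Definition label (x : Rm) : Rm := if (0 < rho 0 x) then x else x0.

Lemma label_pos (x : Rm) : 0 < rho 0 (label x).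
Proof. by rewrite /label; case: ifPn. Qed.

Let label_supp (x : Rm) : S0 (label x). Proof. by apply: pos_supp; exact: label_pos. Qed.

Definition label_prob : probability Rm R := dens_prob (pr (lexx 0)).
Local Notation mu := label_prob.

Let mrho0 : measurable_fun [set: Rm] (rho 0). Proof. by case: (pr (lexx 0)). Qed.

Lemma label_measurable : measurable_fun [set: Rm] label.
Proof.
apply: measurable_fun_ifT => //; apply: measurable_fun_ltr => //.
Qed.

Let preim_label (P Q : set Rm) : (forall x, 0 < rho 0 x -> P x <-> Q x) ->
  dens (rho 0) P = dens (rho 0) Q.
Proof.
move=> PQ; rewrite /dens integral_mkcond [RHS]integral_mkcond; apply: eq_integral => x _.
rewrite !patchE; have [r0|] := boolP (0 < rho 0 x).
  by have [PQx QPx] := PQ x r0; congr (if _ then _ else _); apply/idP/idP; rewrite !inE.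
rewrite lt_neqAle rho_ge0// andbT negbK => /eqP <-.
by case: ifP; case: ifP.
Qed.

Lemma label_law (A : set Rm) : measurable A -> dens (rho 0) A = mu (label @^-1` A).
Proof. by move=> mA; apply: preim_label => x r0; rewrite /preimage/= /label r0. Qed.

Definition traj t (x : Rm) : R := eta t (label x).
Local Notation X := traj.

Lemma traj_law t (A : set Rm) : 0 <= t -> measurable A ->
  dens (rho t) A = mu (X t @^-1` A).
Proof.
move=> t0 mA; have [_ _ ->//] := fc; apply: preim_label => x r0.
rewrite /preimage/= /traj /label r0; split; first by case.
by move=> Ax; split => //; exact: pos_supp.
Qed.

Lemma traj_measurable t : 0 <= t -> measurable_fun [set: Rm] (X t).
Proof.
move=> t0.
pose P := [set x : Rm | 0 < rho 0 x].
have mP : measurable P.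
  rewrite -[X in measurable X]setTI (_ : P = rho 0 @^-1` `]0, +oo[).
    exact: mrho0.
  by apply/seteqP; split => x /=; rewrite in_itv/= andbT.
apply: (measurability (@RGenCInfty.G R)) => [|/= _ [_] [r] -> <-].
  exact: RGenCInfty.measurableE.
pose Q := [set z : Rm | exists2 x, P x /\ x <= z & r <= eta t x].
have mQ : measurable Q.
  apply: is_interval_measurable => a b/= [x [Px xa] rx] _ z /andP[az _].
  by exists x => //; split => //; exact: le_trans az.
rewrite setTI (_ : _ @^-1` _ = (P `&` Q) `|` (~` P `&` [set _ | r <= eta t x0])).
  apply: measurableU; apply: measurableI => //; first exact: measurableC.
  have [rx|rx] := boolP (r <= eta t x0).
    by rewrite (_ : [set _ | _] = setT)//; apply/seteqP; split.
  by rewrite (_ : [set _ | _] = set0)//; apply/seteqP; split.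
apply/seteqP; split => x /=; rewrite in_itv/= andbT /traj /label.
  case: ifPn => [Px rx|Px rx]; [left|right]; split => //; first by exists x.
  by move/negP: Px.
case=> -[]; last by move=> /negP/negbTE ->.
move=> Px [y [Py yx] ry]; rewrite Px (le_trans ry)//.
by apply: characteristics_le => //; exact: pos_supp.
Qed.

Let ends : exists x1 x2, [/\ S0 x1, S0 x2 & forall x, S0 x -> x1 <= x <= x2].
Proof.
have S0n : S0 !=set0 by exists x0; exact: pos_supp.
have ci : {within S0, continuous (id : R -> R)} by apply: continuous_subspaceT => x; exact: cvg_id.
have [x1 Sx1 h1] := compact_EVT_min S0n cS ci.
have [x2 Sx2 h2] := compact_EVT_max S0n cS ci.
exists x1, x2; split; [exact: set_mem|exact: set_mem|].
by move=> x /mem_set Sx; rewrite h1//= h2.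
Qed.

Lemma traj_bounded s : exists2 C : R, 0 <= C & forall t (x : Rm), 0 <= t -> t <= s -> `|X t x| <= C.
Proof.
have [x1 [x2 [Sx1 Sx2 x12]]] := ends.
have bnd x : S0 x -> exists2 C : R, 0 <= C & forall t, 0 <= t -> t <= s -> `|eta t x| <= C.
  move=> Sx; have sub : `[0, s] `<=` [set r : R | 0 <= r].
    by move=> r /=; rewrite in_itv/= => /andP[].
  have cK := continuous_compact (continuous_subspaceW sub (eta_cont Sx)) (@segment_compact R 0 s).
  have [M [_ HM]] := compact_bounded cK.
  exists `|M + 1| => // t t0 ts; apply: (HM `|M + 1|).
    by rewrite (lt_le_trans _ (ler_norm _))// ltrDl.
  by exists t => //=; rewrite in_itv/= t0.
have [C1 C10 h1] := bnd _ Sx1; have [C2 C20 h2] := bnd _ Sx2.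
exists (C1 + C2); first by rewrite addr_ge0.
move=> t x t0 ts; have /andP[l1 l2] := x12 _ (@label_supp x).
have := characteristics_le t0 Sx1 (@label_supp x) l1.
have := characteristics_le t0 (@label_supp x) Sx2 l2.
have := h1 t t0 ts; have := h2 t t0 ts; rewrite !ler_norml /traj; lra.
Qed.

Definition traj_vel t (x : Rm) : R := u t (X t x).
Definition material_acc t z : R := derive1 (u^~ z) t + derive1 (u t) z * u t z.
Definition traj_acc t (x : Rm) : R := material_acc t (X t x).
Local Notation v := traj_vel.
Local Notation a := traj_acc.

Lemma traj_derive t (x : Rm) : 0 < t -> is_derive t 1 (X^~ x) (v t x).
Proof. by move=> t0; have [/(_ _ (@label_supp x))[_ _ h] _ _] := fc; exact: h. Qed.

Lemma traj_vel_derive t (x : Rm) : 0 < t -> is_derive t 1 (v^~ x) (a t x).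
Proof. by move=> t0; exact: (classical_chain cu t0 (traj_derive x t0)). Qed.

Lemma traj_vel_measurable t : 0 <= t -> measurable_fun [set: Rm] (v t).
Proof.
move=> t0; apply: measurableT_comp (traj_measurable t0).
by apply: continuous_measurable_fun; exact: classical_continuous cu _ t0.
Qed.

Lemma traj_acc_measurable t : 0 < t -> measurable_fun [set: Rm] (a t).
Proof.
move=> t0; apply: measurableT_comp (traj_measurable (ltW t0)).
have c1 : continuous (fun z => derive1 (u^~ z) t) by exact: (classical_dt_continuous cu t0).
have c2 : continuous (fun z => derive1 (u t) z) by exact: (classical_dx_continuous cu t0).
apply: continuous_measurable_fun => z; apply: cvgD; first exact: c1.
by apply: cvgM; [exact: c2|exact: (classical_continuous cu (ltW t0))].
Qed.

Lemma traj_vel_bounded s : exists C : R, forall t (x : Rm), 0 <= t -> t <= s ->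
  `|X t x| <= C /\ `|v t x| <= C.
Proof.
have [C C0 hC] := traj_bounded s; have [K K0 hK] := classical_bounded cu s C.
exists (C + K) => t x t0 ts; split.
  by rewrite (le_trans (hC t x t0 ts))// lerDl.
by rewrite (le_trans (hK t _ t0 ts (hC t x t0 ts)))// lerDr.
Qed.

Lemma traj_lip r s : 0 < r -> exists2 K : R, 0 <= K &
  forall t (x y : Rm), r <= t -> t <= s ->
    `|v t x - v t y| <= K * `|X t x - X t y| /\ `|a t x| <= K.
Proof.
move=> r0; have [C C0 hC] := traj_bounded s.
have [K K0 hK] := classical_partials_bounded cu s C r0.
have [L L0 hL] := classical_bounded cu s C.
exists (K + K * L); first by rewrite addr_ge0// mulr_ge0.
move=> t x y rt ts; have t0 : 0 < t by exact: lt_le_trans rt.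
have Xx := hC t x (ltW t0) ts; have Xy := hC t y (ltW t0) ts; split.
  apply: (@le_trans _ _ (K * `|X t x - X t y|)); last first.
    by rewrite ler_wpM2r// lerDl mulr_ge0.
  apply: (@lipschitz_of_derive_sym _ (u t) (derive1 (u t)) K (- C) C); rewrite -?ler_norml//.
    by move=> z _ _; exact: classical_dx.
  by move=> z z1 z2; have [] := hK t z rt ts; rewrite // ler_norml z1.
have [h1 h2] := hK t _ rt ts Xx.
rewrite /traj_acc /material_acc (le_trans (ler_normD _ _))// lerD// normrM ler_pM//.
exact: hL (ltW t0) ts Xx.
Qed.

(** The density g along a characteristic solves g' = - u_x g, so g exp(K t) is
    nondecreasing where u_x <= K. A zero at time t would force g to vanish on (0, t], on
    each [s, t] with its own K, and g 0 = 0 by continuity. The detour is needed since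
    u_x need not be bounded near t = 0. *)
Lemma density_pos_along t (x : Rm) : 0 < t -> 0 < rho t (X t x).
Proof.
move=> t0; pose g s := rho s (X s x).
have g_ge0 s : 0 <= s -> 0 <= g s by exact: rho_ge0.
have dg s : 0 < s -> is_derive s 1 g (- (derive1 (u s) (X s x)) * g s).
  move=> s0; have D := classical_chain crho s0 (traj_derive x s0).
  apply: is_derive_eq D _.
  have [+ _] := eqs (X s x) s0; rewrite /continuity_eq.
  have D1 := classical_dx crho (X s x) s0; have D2 := classical_dx cu (X s x) s0.
  have D3 : is_derive (X s x) 1 (fun y => rho s y * u s y)
    (rho s (X s x) * derive1 (u s) (X s x) + derive1 (rho s) (X s x) * u s (X s x)).
    by apply: is_derive_eq; rewrite /GRing.scale/=; ring.
  rewrite (derive1_val D3) /g /traj_vel.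
  move: (derive1 (rho^~ (X s x)) s) (derive1 (rho s) (X s x)) (derive1 (u s) (X s x)).
  by move: (rho s (X s x)) (u s (X s x)) => A B C D E h; lra.
rewrite lt_neqAle g_ge0 ?ltW// andbT eq_sym; apply/eqP => gt0.
have gs s : 0 < s -> s <= t -> g s = 0.
  move=> s0 st; have [C C0 hC] := traj_bounded t.
  have [K K0 hK] := classical_partials_bounded cu t C s0.
  have : - (g t * expR (K * t)) <= - (g s * expR (K * s)).
    apply: (@le_of_derive_le0 _ (fun r => - (g r * expR (K * r)))
      (fun r => - ((K - derive1 (u r) (X r x)) * g r * expR (K * r))) s t st).
      move=> r sr rt; have r0 : 0 < r by exact: lt_le_trans sr.
      have dgr := dg r r0.
      by apply: is_derive_eq; rewrite /GRing.scale/=; ring.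
    move=> r sr rt; have r0 : 0 < r by exact: lt_le_trans sr.
    have gr := g_ge0 r (ltW r0); rewrite oppr_le0 mulr_ge0 ?expR_ge0// mulr_ge0//.
    have [_] := hK r _ sr rt (hC r x (ltW r0) rt).
    by rewrite ler_norml => /andP[_]; rewrite subr_ge0.
  rewrite {1}/g gt0 mul0r oppr0 oppr_ge0 => h.
  apply/eqP; rewrite eq_le (g_ge0 s (ltW s0)) andbT.
  by move: h; rewrite pmulr_lle0 ?expR_gt0.
have : g n.+1%:R^-1 @[n --> \oo] --> rho 0 (X 0 x).
  apply: (classical_cvg crho) => //; first exact: nearW.
    exact: cvg_harmonic.
  apply: eta_cvg => //; [exact: nearW|exact: cvg_harmonic].
have : g n.+1%:R^-1 @[n --> \oo] --> 0.
  apply: cvg_near_cst; near=> n; apply: gs => //.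
  apply: ltW; near: n; exact: (near_infty_natSinv_lt (PosNum t0)).
move=> c1 c2; have := @cvg_unique _ (@Rhausdorff R) _ _ _ _ c1 c2.
rewrite /traj eta0// => e0; have := label_pos x; rewrite -e0 ltxx//.
Unshelve. all: by end_near. Qed.

(** The momentum equation minus u times the continuity equation. *)
Lemma momentum_divided t z : 0 < t -> 0 < rho t z ->
  material_acc t z = - (\int[leb]_y (dW (z - y) * rho t y))
    - \int[leb]_y (psi (z - y) * (u t z - u t y) * rho t y).
Proof.
move=> t0 r0; have [] := eqs z t0; rewrite /continuity_eq /momentum_eq.
have D1 := classical_dx crho z t0; have D2 := classical_dx cu z t0.
have D3 := classical_dt crho z t0; have D4 := classical_dt cu z t0.
have E1 : is_derive z 1 (fun y => rho t y * u t y)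
    (rho t z * derive1 (u t) z + derive1 (rho t) z * u t z).
  by apply: is_derive_eq; rewrite /GRing.scale/=; ring.
have E2 : is_derive z 1 (fun y => rho t y * u t y ^+ 2)
    (2 * rho t z * u t z * derive1 (u t) z + derive1 (rho t) z * u t z ^+ 2).
  by apply: is_derive_eq; rewrite /GRing.scale/=; ring.
have E3 : is_derive t 1 (fun s => rho s z * u s z)
    (rho t z * derive1 (u^~ z) t + derive1 (rho^~ z) t * u t z).
  by apply: is_derive_eq; rewrite /GRing.scale/=; ring.
rewrite (derive1_val E1) (derive1_val E2) (derive1_val E3).
have ar (I J r w A B C D : R) : 0 < r -> A + (r * B + C * w) = 0 ->
    r * D + A * w + (2 * r * w * B + C * w ^+ 2) = - (r * I) - r * J ->
    D + B * w = - I - J.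
  move=> rp h1 h2; apply: (mulfI (lt0r_neq0 rp)).
  transitivity ((r * D + A * w + (2 * r * w * B + C * w ^+ 2)) -
    w * (A + (r * B + C * w))); first by ring.
  by rewrite h1 h2; ring.
exact: ar.
Qed.

Lemma initial_density_bound : exists M b1 b2 : R,
  (forall x, rho 0 x <= M) /\ (forall x, x <= b1 \/ b2 <= x -> rho 0 x = 0).
Proof.
have [x1 [x2 [_ _ x12]]] := ends.
have [K K0 hK] := classical_bounded crho 0 (`|x1| + `|x2|).
exists K, (x1 - 1), (x2 + 1); split=> x; last first.
  by move=> xo; apply: supp_out => /x12; case: xo => h /andP[h1 h2]; lra.
have [/x12 /andP[h1 h2]|nS] := pselect (S0 x); last by rewrite supp_out.
rewrite (le_trans (ler_norm _))// hK// ler_norml.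
have := ler_norm x2; have := ler_norm (- x1); rewrite normrN.
have := normr_ge0 x1; have := normr_ge0 x2; lra.
Qed.

Definition traj_mass (x : Rm) : R := mass_below mu label (label x).
Local Notation m := traj_mass.

Lemma sg_label_traj t (x y : Rm) : 0 <= t ->
  Num.sg (X t x - X t y) = Num.sg ((label x : R) - label y).
Proof.
move=> t0; have [xy|yx|xy] := ltgtP (label x : R) (label y).
- rewrite !ltr0_sg// subr_lt0//; apply: characteristics_lt => //; exact: label_supp.
- rewrite !gtr0_sg// subr_gt0//; apply: characteristics_lt => //; exact: label_supp.
- by rewrite /traj xy !subrr.
Qed.

Let sg_measurable : measurable_fun [set: Rm] (Num.sg : R -> R).
Proof.
rewrite (_ : Num.sg = fun x : R => if x == 0 then 0 else if x < 0 then -1 else 1); last first.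
  by apply/funext => x; rewrite sgr_def; case: (x == 0); case: (x < 0).
apply: measurable_fun_ifT => //; first exact: measurable_fun_eqr.
by apply: measurable_fun_ifT => //; exact: measurable_fun_ltr.
Qed.

Let bdm_X t : 0 <= t -> bdm (X t).
Proof.
move=> t0; split; first exact: traj_measurable.
by have [C _ hC] := traj_bounded t; exists C => x; exact: hC.
Qed.

(** By monotonicity of the flow, the sign of X x - X y is that of the labels, whose mean
    over y is 2m - 1. *)
Lemma traj_force t (x : Rm) : 0 <= t ->
  \int[leb]_y (dW (X t x - y) * rho t y) = - (2 * m x - 1) + (X t x - \int[mu]_y X t y).
Proof.
move=> t0; have bX := bdm_X t0.
have bd : bdm (fun y => X t x - X t y) by apply: bdmB => //; exact: bdm_cst.
have bs : bdm (fun y => Num.sg (X t x - X t y)).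
  split; last by exists 1 => y; rewrite normr_sg lern1 leq_b1.
  by apply: measurableT_comp sg_measurable _; case: bd.
rewrite (@integral_dens_image _ _ (pr t0) _ _ mu (X t) (traj_measurable t0) (fun A => traj_law t0)
  (fun y => dW (X t x - y))).
- rewrite /dW probD//; last exact: bdmN.
  rewrite probN// probB//; last exact: bdm_cst.
  rewrite prob_cst; congr (- _ + _).
  have [M [b1 [b2 [hM hb]]]] := initial_density_bound.
  rewrite /traj_mass -(prob_label_sg (pr (lexx 0)) label_measurable label_law).
  by apply: eq_prob => y; exact: sg_label_traj.
- apply: measurable_funD; last exact: measurable_funB.
  by apply: measurableT_comp => //; apply: measurableT_comp sg_measurable _; exact: measurable_funB.
- by apply: bdmD => //; exact: bdmN.
Qed.

Lemma traj_alignment t (x : Rm) : 0 < t ->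
  \int[leb]_y (psi (X t x - y) * (u t (X t x) - u t y) * rho t y) =
  \int[mu]_y (psi (X t x - X t y) * (v t x - v t y)).
Proof.
move=> t0; have t0' := ltW t0.
have mg : measurable_fun [set: Rm] (fun y => psi (X t x - y) * (u t (X t x) - u t y)).
  apply: measurable_funM; first by apply: measurableT_comp (kernel_measurable kp) _; exact: measurable_funB.
  apply: measurable_funB => //; apply: continuous_measurable_fun.
  exact: classical_continuous cu _ t0'.
have [C C0 hC] := traj_bounded t; have [K K0 hK] := traj_lip t t0.
rewrite (integral_dens_image (pr t0') (traj_measurable t0') (fun A => traj_law t0') mg)//.
split; first exact: measurableT_comp mg (traj_measurable t0').
exists (K * prim_half psi (C + C)) => y /=.
have [hv _] := hK t x y (lexx _) (lexx _).
apply: kernel_lip_mul_le => //.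
by rewrite (le_trans (ler_normB _ _))// lerD// hC.
Qed.

Lemma solution_flow : particle_flow mu psi X v a m.
Proof.
have [M [b1 [b2 [hM hb]]]] := initial_density_bound.
have p0 := pr (lexx 0); have ll := label_law.
split => //.
- exact: traj_measurable.
- exact: traj_vel_measurable.
- exact: traj_acc_measurable.
- exact: (mass_label_measurable mu label_measurable).
- by move=> x; apply: mass_below01; exact: label_measurable.
- exact: (prob_mass_label_mean p0 label_measurable ll).
- by move=> c r c01 r01; exact: (prob_mass_label_near p0 label_measurable ll hM hb).
- exact: traj_vel_bounded.
- exact: traj_lip.
- exact: traj_derive.
- exact: traj_vel_derive.
- move=> t x t0; rewrite /traj_acc (momentum_divided t0 (density_pos_along x t0)).
  rewrite traj_force ?ltW// traj_alignment//.
  by move: (\int[mu]_y X t y) (\int[mu]_y _) => I J; ring.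
- move=> x y; have [xy|/ltW yx] := leP (label x : R) (label y); [left|right]; split;
    try (apply: mass_below_nd => //; exact: label_measurable);
    by move=> t t0; apply: characteristics_le => //; exact: label_supp.
- move=> t x J t0 cJ; have t0' := ltW t0.
  pose A : set Rm := [set y | J (X t x - y)].
  have cA : countable A.
    rewrite (_ : A = (fun z => X t x - z) @` J); first exact: sub_countable (card_image_le _ _) cJ.
    apply/seteqP; split => y /=; first by move=> Jy; exists (X t x - y) => //; rewrite subKr.
    by move=> [z Jz <-]; rewrite /A/= subKr.
  have mA : measurable A by exact: countable_measurable.
  exists (X t @^-1` A); split => //.
    by rewrite -[X in measurable X]setTI; exact: (traj_measurable t0').
  rewrite -traj_law// /dens; apply: null_set_integral => //.
    by apply: measurable_funTS; apply/measurable_EFinP; case: (pr t0').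
  exact: countable_lebesgue_measure0.
- move=> x; apply: (classical_cvg cu) => //; first exact: nearW.
    exact: cvg_harmonic.
  apply: eta_cvg => //; [exact: nearW|exact: cvg_harmonic].
Qed.

Lemma solution_mass_center t : 0 <= t -> mass_center mu X t = eta_c rho t.
Proof.
move=> t0; rewrite /mass_center /eta_c.
by rewrite (@integral_dens_image _ _ (pr t0) _ _ mu (X t) (traj_measurable t0) (fun A => traj_law t0)
  id)//; exact: bdm_X.
Qed.

Lemma solution_mean_velocity : mean_velocity mu v = u_inf (rho 0) (u 0).
Proof.
have [C hC] := traj_vel_bounded 0.
rewrite /mean_velocity /u_inf.
transitivity (\int[leb]_y (u 0 y * rho 0 y)); last by apply: eq_Rintegral => y _; rewrite mulrC.
rewrite (@integral_dens_image _ _ (pr (lexx 0)) _ _ mu label label_measurable label_law (u 0)).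
- by apply: eq_prob => x; rewrite /traj_vel /traj eta0//; exact: label_supp.
- by apply: continuous_measurable_fun; exact: classical_continuous cu _ (lexx 0).
- split.
    apply: measurableT_comp label_measurable; apply: continuous_measurable_fun.
    exact: classical_continuous cu _ (lexx 0).
  exists C => x /=; have [_] := hC 0 x (lexx _) (lexx _).
  by rewrite /traj_vel /traj eta0//; exact: label_supp.
Qed.

End Solution.

(** * Distances and norms in Lagrangian variables *)

Section Metrics.
Context (R : realType) d (T : measurableType d) (mu : probability T R).
Local Notation leb := (@lebesgue_measure R).
Local Notation Rm := (measurableTypeR R).

Lemma prob_poweR (g : T -> R) (p : R) : bdm g ->
  ((\int[mu]_x (g x)%:E) `^ p)%E = ((\int[mu]_x g x) `^ p)%:E.
Proof.
move=> bg; rewrite -poweR_EFin /Rintegral fineK//.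
by apply: integrable_fin_num => //; exact: (bdm_integrable mu bg).
Qed.

Section Coupling.
Variables (r q : R -> R) (X Y : T -> Rm).
Hypotheses (mX : measurable_fun [set: T] X) (mY : measurable_fun [set: T] Y).
Hypothesis lawX : forall A : set Rm, measurable A -> dens r A = mu (X @^-1` A).
Hypothesis lawY : forall A : set Rm, measurable A -> dens q A = mu (Y @^-1` A).

Let XY (x : T) : (Rm * Rm)%type := (X x, Y x).

Let mXY : measurable_fun [set: T] XY.
Proof. exact: measurable_fun_pair. Qed.

Let XYM : {mfun T >-> (Rm * Rm)%type} :=
  MeasurableFun.Pack (MeasurableFun.Class (isMeasurableFun.Build _ _ _ _ _ mXY)).

Definition joint_law : probability (Rm * Rm)%type R := distribution mu XYM.

Lemma joint_law_coupling : couplings (dens r) (dens q) joint_law.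
Proof.
split=> A mA.
- rewrite lawX// /joint_law /= /distribution /pushforward; congr (mu _).
  by apply/seteqP; split => x //= [].
- rewrite lawY// /joint_law /= /distribution /pushforward; congr (mu _).
  by apply/seteqP; split => x //= [].
Qed.

Lemma d2_le_joint : bdm (fun x => X x - Y x : R) ->
  (d2 (dens r) (dens q) <= ((\int[mu]_x (X x - Y x) ^+ 2) `^ 2^-1)%:E)%E.
Proof.
move=> bXY; rewrite -(prob_poweR 2^-1 (bdmX 2 bXY)).
apply: ereal_inf_lbound; exists joint_law; first exact: joint_law_coupling.
congr (_ `^ _)%E; rewrite ge0_integral_distribution//.
- by apply: eq_integral => x _ /=; rewrite real_normK// num_real.
- apply/measurable_EFinP; apply: measurable_funX; apply: measurableT_comp => //.
  by apply: measurable_funB; [exact: measurable_fst|exact: measurable_snd].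
Qed.

(** The set where the distance exceeds D is open and null for the joint law, hence disjoint
    from its support. *)
Lemma dinf_le_joint (D : R) : (forall x, `|(X x : R) - Y x| <= D) ->
  (dinf (dens r) (dens q) <= D%:E)%E.
Proof.
move=> XYD; apply: (@le_trans _ _ (ereal_sup [set (`|z.1 - z.2|)%:E
  | z in @msupport R (R * R)%type joint_law])).
  by apply: ereal_inf_lbound; exists joint_law => //; exact: joint_law_coupling.
apply: ge_ereal_sup => _ [z sz <-]; rewrite lee_fin leNgt; apply/negP => Dz.
have oU : open [set z : R * R | D < `|z.1 - z.2|].
  have cf : continuous (fun z : R * R => `|z.1 - z.2|).
    move=> w; apply: cvg_norm; apply: cvgB; [exact: cvg_fst|exact: cvg_snd].
  by move/continuousP : cf => /(_ _ (@open_gt R D)); rewrite /preimage.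
have := sz _ oU Dz; rewrite /joint_law /= /distribution /pushforward.
rewrite (_ : _ @^-1` _ = set0) ?measure0 ?ltxx//.
by rewrite -subset0 => x /=; rewrite ltNge XYD.
Qed.

End Coupling.

Section Norms.
Variables (r f : R -> R) (X : T -> Rm).
Hypothesis pr : prob_density r.
Hypotheses (mX : measurable_fun [set: T] X) (cf : continuous f).
Hypothesis lawX : forall A : set Rm, measurable A -> dens r A = mu (X @^-1` A).

(** A point of the support where |f| > D would have a neighbourhood of positive mass with
    this property, but no particle is there. *)
Lemma norm_Linf_le_law (D : R) : 0 <= D -> (forall x, `|f (X x)| <= D) ->
  (norm_Linf (supp r) f <= D%:E)%E.
Proof.
move=> D0 fD; rewrite /norm_Linf unlock; case: ifPn => _; last by rewrite lee_fin.
have fs x : supp r x -> `|f x| <= D.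
  move=> sx; rewrite leNgt; apply/negP => Dx.
  have oU : open [set x : R | D < `|f x|].
    have cnf : continuous (fun x => `|f x|) by move=> w; apply: cvg_norm; exact: cf.
    by move/continuousP : cnf => /(_ _ (@open_gt R D)); rewrite /preimage.
  have := sx _ oU Dx; rewrite lawX; last exact: open_measurable.
  rewrite (_ : _ @^-1` _ = set0) ?measure0 ?ltxx//.
  by rewrite -subset0 => y /=; rewrite ltNge fD.
apply/ess_sup_inf.ess_supP; apply: nearW => x /=; rewrite lee_fin normrM indicE.
by case: (boolP (x \in supp r)) => [|_];
  [rewrite inE normr1 mulr1 => /fs|rewrite normr0 mulr0].
Qed.

Lemma norm_L2_law : bdm (f \o X) ->
  norm_L2 r f = ((\int[mu]_x f (X x) ^+ 2) `^ 2^-1)%:E.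
Proof.
move=> bf; rewrite -(prob_poweR 2^-1 (bdmX 2 bf)) /norm_L2; congr (_ `^ _)%E.
rewrite (ge0_integral_dens_image pr mX lawX (g := fun x => `|f x| ^+ 2)).
- by apply: eq_integral => x _ /=; rewrite real_normK// num_real.
- apply: measurable_funX; apply: measurableT_comp => //.
  exact: continuous_measurable_fun.
- by move=> x; rewrite exprn_ge0.
Qed.

End Norms.
End Metrics.

(** * The decay estimates *)

Section RegularizedWeight.
Context (R : realType).
Variables (psi : R -> R) (psim Rm : R).
Hypotheses (cw : comm_weight psi) (psim0 : 0 < psim) (Rm0 : 0 < Rm).
Hypothesis psi_ge : forall x, x != 0 -> `|x| <= Rm -> psim <= psi x.
Implicit Types (x r s : R).

(** The value of the weight at 0 is arbitrary and may be negative. It multiplies a vanishing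
    velocity difference, so it can be replaced by psim. *)
Definition fill_weight x := if x == 0 then psim else psi x.
Local Notation psi' := fill_weight.

Lemma fill_weightE x : x != 0 -> psi' x = psi x.
Proof. by rewrite /fill_weight => /negbTE ->. Qed.

Lemma fill_weight_even x : psi' (- x) = psi' x.
Proof.
rewrite /fill_weight oppr_eq0; case: ifP => // _.
by have [phi [h _ _]] := cw; rewrite !h normrN.
Qed.

Lemma fill_weight_ge0 x : 0 <= psi' x.
Proof.
rewrite /fill_weight; have [_|x0] := eqVneq x 0; first exact: ltW.
by have [phi [-> h _]] := cw; rewrite h// normr_gt0.
Qed.

Lemma fill_weight_noninc r s : 0 < r -> r <= s -> psi' s <= psi' r.
Proof.
move=> r0 rs; have s0 : 0 < s by exact: lt_le_trans rs.
rewrite !fill_weightE ?gt_eqF//; have [phi [h _ nd]] := cw.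
by rewrite !h !gtr0_norm//; exact: nd.
Qed.

Lemma fill_weight_ge x : `|x| <= Rm -> psim <= psi' x.
Proof. by rewrite /fill_weight; have [//|x0] := eqVneq x 0; exact: psi_ge. Qed.

Lemma fill_weight_momentum rho u (t x : R) :
  momentum_eq psi rho u t x -> momentum_eq psi' rho u t x.
Proof.
rewrite /momentum_eq => ->; congr (_ - _ * _); apply: eq_Rintegral => y _.
have [xy|xy] := eqVneq x y; first by rewrite xy !subrr !mulr0.
by rewrite fill_weightE// subr_eq0.
Qed.

End RegularizedWeight.

Section MeasuredDecay.
Context (R : realType).
Local Notation Rm := (measurableTypeR R).
Variables (psi : R -> R) (rho u : R -> R -> R).
Hypothesis kp : comm_kernel psi.
Hypothesis crho : classical_regular rho.
Hypothesis cu : classical_regular u.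
Hypothesis pr : forall t : R, 0 <= t -> prob_density (rho t).
Hypothesis eqs : forall t x : R, 0 < t ->
  continuity_eq rho u t x /\ momentum_eq psi rho u t x.
Hypothesis fc : exists eta, forward_characteristics rho u (rho 0) eta.
Hypothesis cS : compact (supp (rho 0)).

(** The coupling is the joint law of X and eta_c + 2m - 1, whose difference is h. *)
Lemma flow_of_solution : exists (mu : probability Rm R) X v a m,
  particle_flow mu psi X v a m /\ forall t : R, 0 <= t ->
  [/\ (d2 (dens (rho t)) (dens (rho_inf rho t)) <=
        ((\int[mu]_x fl_h mu X m t x ^+ 2) `^ 2^-1)%:E)%E,
      norm_L2 (rho t) (fun x => u t x - u_inf (rho 0) (u 0)) =
        ((\int[mu]_x fl_w mu v t x ^+ 2) `^ 2^-1)%:E,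
      forall D : R, (forall x, `|fl_h mu X m t x| <= D) ->
        (dinf (dens (rho t)) (dens (rho_inf rho t)) <= D%:E)%E
    & forall D : R, 0 <= D -> (forall x, `|fl_w mu v t x| <= D) ->
        (norm_Linf (supp (rho t)) (fun x => u t x - u_inf (rho 0) (u 0))%R <= D%:E)%E].
Proof.
have [eta fe] := fc.
have [x0 x0P] : exists x0, 0 < rho 0 x0.
  apply: contrapT => /forallNP H; have [_ r0 r1] := pr (lexx 0).
  have r00 x : rho 0 x = 0.
    by apply/eqP; rewrite eq_le r0 andbT leNgt; apply/negP; exact: H.
  move: r1; rewrite /dens integral0_eq; last by move=> x _; rewrite r00.
  by move=> /esym/eqP; rewrite onee_eq0.
have fl := solution_flow kp crho cu pr eqs fe cS x0P.
exists (label_prob pr), (traj rho eta x0), (traj_vel rho u eta x0),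
  (traj_acc rho u eta x0), (traj_mass x0 pr); split=> // t t0.
have ec := solution_mass_center crho pr fe cS x0P t0.
have ev := solution_mean_velocity crho cu pr fe cS x0P.
have ml := @label_measurable _ rho x0 pr.
have ll := @label_law _ rho x0 pr.
have [M [b1 [b2 [hM hb]]]] := initial_density_bound crho pr cS x0P.
have mX := traj_measurable x0 crho pr fe t0.
have lX A := @traj_law _ _ _ _ x0 crho pr fe t A t0.
have lY := mass_label_law (pr (lexx 0)) ml ll hM hb (eta_c rho t).
have mY : measurable_fun [set: Rm]
    (fun x => (eta_c rho t + (2 * traj_mass x0 pr x - 1) : Rm)).
  apply: measurable_funD => //; apply: measurable_funB => //; apply: measurable_funM => //.
  exact: (fl_mmeas fl).
have hE x : traj rho eta x0 t x - (eta_c rho t + (2 * traj_mass x0 pr x - 1)) =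
    fl_h (label_prob pr) (traj rho eta x0) (traj_mass x0 pr) t x.
  by rewrite /fl_h ec opprD addrA.
have bh := fl_h_bdm fl t0; have bw := fl_w_bdm fl t0.
have wE x : u t (traj rho eta x0 t x) - u_inf (rho 0) (u 0) =
    fl_w (label_prob pr) (traj_vel rho u eta x0) t x.
  by rewrite /fl_w ev.
have cu' : continuous (fun x => u t x - u_inf (rho 0) (u 0)).
  by move=> x; apply: cvgB; [exact: (classical_continuous cu t0)|exact: cvg_cst].
split.
- have bXY : bdm (fun x => (traj rho eta x0 t x : R) -
      (eta_c rho t + (2 * traj_mass x0 pr x - 1))).
    by rewrite (_ : (fun x => _) = fl_h (label_prob pr) (traj rho eta x0) (traj_mass x0 pr) t)//;
      apply/funext => x; exact: hE.
  apply: le_trans (d2_le_joint mX mY lX lY bXY) _; rewrite lee_fin.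
  rewrite (_ : \int[_]_x _ = \int[label_prob pr]_x
    fl_h (label_prob pr) (traj rho eta x0) (traj_mass x0 pr) t x ^+ 2)//.
  by apply: eq_prob => x; rewrite hE.
- rewrite (norm_L2_law (pr t0) mX cu' lX); last first.
    by rewrite (_ : _ \o _ = fl_w (label_prob pr) (traj_vel rho u eta x0) t)//;
      apply/funext => x; exact: wE.
  rewrite (_ : \int[_]_x _ = \int[label_prob pr]_x
    fl_w (label_prob pr) (traj_vel rho u eta x0) t x ^+ 2)//.
  by apply: eq_prob => x; rewrite wE.
- by move=> D hD; apply: (dinf_le_joint mX mY lX lY) => x; rewrite hE.
- by move=> D D0 hD; apply: (norm_Linf_le_law cu' lX) => // x; rewrite wE.
Qed.

End MeasuredDecay.

Section Rates.
Context (R : realType).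

(** Taking C + 1 instead of the square root of C avoids a case distinction. *)
Lemma sqrt_alg_rate (I C p q t : R) : 0 <= C -> 1 <= t -> q <= p / 2 ->
  0 <= I -> I <= C * t `^ (- p) -> I `^ 2^-1 <= (C + 1) * t `^ (- q).
Proof.
move=> C0 t1 qp I0 IC; have t0 : 0 < t by exact: lt_le_trans t1.
apply: (@le_trans _ _ ((C * t `^ (- p)) `^ 2^-1)).
  by apply: ge0_ler_powR; rewrite ?nnegrE ?invr_ge0// mulr_ge0 ?powR_ge0.
rewrite powRM ?powR_ge0// -powRrM ler_pM ?powR_ge0//.
  rewrite -[leRHS]powRr1 ?addr_ge0//.
  apply: (@le_trans _ _ ((C + 1) `^ 2^-1)).
    by apply: ge0_ler_powR; rewrite ?nnegrE ?invr_ge0 ?addr_ge0// lerDl.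
  by apply: ler_powR; rewrite ?lerDr//; lra.
by apply: ler_powR => //; lra.
Qed.

End Rates.

Theorem theorem1p2 (R : realType) (psi : R -> R) (rho u : R -> R -> R)
    (rho0 u0 : R -> R) (psim Rm : R) :
  comm_weight psi ->
  global_classical_solution psi rho u rho0 u0 ->
  compact (supp rho0) ->
  0 < psim -> 0 < Rm ->
  (forall x, x != 0 -> `|x| <= Rm -> psim <= psi x) ->
  ((exists M : R, forall x, psi x <= M) ->
     exp_decay (fun t =>
       dinf (dens (rho t)) (dens (rho_inf rho t)) +
       norm_Linf (supp (rho t)) (fun x => u t x - u_inf rho0 u0)%R)%E)
  /\
  (forall alpha B R1 : R, 0 < alpha -> alpha < 1 -> 0 < B -> 0 < R1 ->
     (forall x, x != 0 -> `|x| <= R1 -> psi x <= B / `|x| `^ alpha) ->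
     bigO_pinfty (fun t => d2 (dens (rho t)) (dens (rho_inf rho t)))
       (fun t => t `^ (- (3 / (4 * alpha) - 1 / 2)))
     /\
     bigO_pinfty (fun t => norm_L2 (rho t) (fun x => u t x - u_inf rho0 u0))
       (fun t => t `^ (- ((1 - alpha) * (3 / (4 * alpha) - 1 / 2))))).
Proof.
move=> cw [[crho cu] [i1 i2] pr eqs fc] cS psim0 Rm0 psi_ge.
have {i1} ? : rho0 = rho 0 by apply/funext => x; rewrite i1.
have {i2} ? : u0 = u 0 by apply/funext => x; rewrite i2.
subst rho0 u0.
pose w := fill_weight psi psim.
have w0 : forall x, 0 <= w x by exact: fill_weight_ge0 cw psim0.
have wn : forall r s : R, 0 < r -> r <= s -> w s <= w r by exact: fill_weight_noninc cw.
have wge : forall x, `|x| <= Rm -> psim <= w x by exact: fill_weight_ge psi_ge.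
have weqs t x : 0 < t -> continuity_eq rho u t x /\ momentum_eq w rho u t x.
  by move=> /(eqs t x)[? /(fill_weight_momentum psim)].
have we := fill_weight_even psim cw.
split.
- move=> [M psiM].
  have M0 : 0 < Num.max M psim by rewrite lt_max psim0 orbT.
  have wM x : w x <= Num.max M psim.
    by rewrite /w /fill_weight le_max; case: ifP => _; rewrite ?lexx ?orbT// psiM.
  have kp : comm_kernel w.
    by split=> // y; exact: (integrable_of_bounded w0 wn y wM).
  have [mu [X [v [a [m [fl mt]]]]]] := flow_of_solution kp crho cu pr weqs fc cS.
  have [C [c [C0 c0 hC]]] := flow_exp_decay fl psim0 Rm0 wge M0 wM.
  exists (2 * C), c; split => //; first by rewrite mulr_gt0.
  move=> t t0; have [_ _ hinf hLinf] := mt t t0.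
  rewrite -mulrA mulrDl mul1r EFinD leeD//.
    by apply: hinf => x; have [] := hC t x t0.
  apply: hLinf; first by rewrite mulr_ge0 ?expR_ge0// ltW.
  by move=> x; have [] := hC t x t0.
move=> al B R1 al0 al1 B0 R10 psiB.
have wB x : 0 < x -> x <= R1 -> w x <= B / x `^ al.
  move=> x0 xR; rewrite /w fill_weightE ?gt_eqF//.
  by have := psiB x; rewrite gtr0_norm// gt_eqF//; exact.
have kp : comm_kernel w.
  by split=> // y; exact: (power_kernel_integrable w0 wn al1 B0 R10 wB).
have [mu [X [v [a [m [fl mt]]]]]] := flow_of_solution kp crho cu pr weqs fc cS.
have [K0 [s0 [K00 s00 hmod]]] := power_kernel_modulus w0 wn al0 al1 B0 R10 wB kp.
have p0 : 0 < 2 / al - 1.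
  by rewrite subr_gt0 ltr_pdivlMr// mul1r; lra.
have [C [t1 [C0 t11 hE]]] := energy_alg_decay fl psim0 Rm0 wge p0 K00 s00 hmod.
have q1 : 3 / (4 * al) - 1 / 2 <= (2 / al - 1) / 2.
  have ia : 1 < al^-1 by rewrite invf_gt1.
  by rewrite invfM; move: (al^-1) ia => z; lra.
have q2 : (1 - al) * (3 / (4 * al) - 1 / 2) <= (2 / al - 1) / 2.
  apply: le_trans q1; rewrite ger_pMl; first by lra.
  by rewrite subr_gt0 ltr_pdivlMr ?mulr_gt0//; lra.
have split_energy t : 0 <= t ->
    \int[mu]_x fl_h mu X m t x ^+ 2 + \int[mu]_x fl_w mu v t x ^+ 2 =
    2 * energy mu X v m t.
  move=> t0; rewrite /energy probD; [|exact/bdmX/(fl_h_bdm fl)|exact/bdmX/(fl_w_bdm fl)].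
  by rewrite mulrA mulfV ?mul1r.
have h0 t : 0 <= \int[mu]_x fl_h mu X m t x ^+ 2 by apply: prob_ge0 => x; exact: sqr_ge0.
have v0 t : 0 <= \int[mu]_x fl_w mu v t x ^+ 2 by apply: prob_ge0 => x; exact: sqr_ge0.
have C2 : 0 <= 2 * C by rewrite mulr_ge0.
split; exists (2 * C + 1); rewrite ?ltr_wpDl//; near=> t.
- have tt : t1 <= t by near: t; apply: nbhs_pinfty_ge; rewrite num_real.
  have t_ge1 := le_trans t11 tt; have t0 : 0 <= t by exact: le_trans t_ge1.
  have [hd2 _ _ _] := mt t t0; apply: le_trans hd2 _; rewrite lee_fin.
  apply: (sqrt_alg_rate C2 t_ge1 q1) => //.
  have := split_energy t t0; have := hE t tt; have := v0 t.
  rewrite -mulrA; move: (\int[mu]_x _) (\int[mu]_x _) (energy _ _ _ _ _) (C * _).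
  by move=> ? ? ? ?; lra.
- have tt : t1 <= t by near: t; apply: nbhs_pinfty_ge; rewrite num_real.
  have t_ge1 := le_trans t11 tt; have t0 : 0 <= t by exact: le_trans t_ge1.
  have [_ -> _ _] := mt t t0; rewrite lee_fin.
  apply: (sqrt_alg_rate C2 t_ge1 q2) => //.
  have := split_energy t t0; have := hE t tt; have := h0 t.
  rewrite -mulrA; move: (\int[mu]_x _) (\int[mu]_x _) (energy _ _ _ _ _) (C * _).
  by move=> ? ? ? ?; lra.
Unshelve. all: by end_near. Qed.
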